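(* Let $\mathbf M$ be an SPCA model and let $k$ be an integer with $1\le k<\omega(\mathbf M)$. The following statements are equivalent. 1. $\mathbf M$ is equivalent to a $k$-multiplicative model. 2. Some greedy nose cycle of $\mathbf S^k$ having $\mathrm{ext}<0$ shares a vertex with a greedy hollow cycle of $\mathbf S^k$ having $\mathrm{ext}>0$. 3. Some $\gamma\in\mathbb N$ is a twisting bound of $\mathbf S^k$.
   Context: **PCA models.** All arcs are open arcs of a circle. A circle $C$ of length $|C|$ has a distinguished point $0$ and each point is identified with its clockwise distance from $0$, so points are compared as numbers in $[0,|C|)$. For points $s\ne t$, $(s,t)$ is the open arc going clockwise from $s$ to $t$; an arc $A=(s,t)$ has beginning point $s(A)=s$ and ending point $t(A)=t$, its extremes. $A<B$ means $s(A)<s(B)$. A proper circular-arc (PCA) model is a pair $\mathbf M=(C,\mathcal A)$ where $\mathcal A=\mathcal A(\mathbf M)$ is a finite family of arcs of $C$, none included in another and no two sharing an extreme. Its arcs are $A_0<\dots<A_{n-1}$; $A_0$ is the initial arc. $\mathbf M$ is PIG if no arc $A$ satisfies $0\in A\cup\{t(A)\}$; by convention, if the arcs of $\mathbf M$ do not cover $C$, then $0$ is placed so that $\mathbf M$ is PIG. $\mathbf M$ is strict PCA (SPCA) if it is not PIG. Two PCA models are equivalent if there is a bijection between their arcs under which the sequences of extremes, read clockwise starting at the beginning point of the initial arc, coincide. **Functions on arcs** (indices mod $n$). $L(A_i)=A_{i-1}$, $R(A_i)=A_{i+1}$. $F_r(A_i)$ is the last arc of the contiguous sequence $A_i,A_{i+1},\dots$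 of arcs whose beginning points lie in $A_i\cup\{s(A_i)\}$; $F_l(A_i)$ is the first arc of the contiguous sequence $\dots,A_{i-1},A_i$ of arcs whose ending points lie in $A_i\cup\{t(A_i)\}$. $H_l(A_i)$ is the unique arc $A$ with $F_r(A)=A_i$ and $F_r(R(A))\ne A_i$; $H_r(A_i)$ is the unique arc $A$ with $F_l(A)=A_i$ and $F_l(L(A))\neq A_i$; each is $\bot$ if no such arc exists. $f^j$ denotes the $j$-th iterate of $f$ ($f^0$ is the identity, $\bot$ is mapped to $\bot$). **Powers.** For $j\ge 0$, $A^j=(s(A),\,s(F_r^j(A))+\varepsilon(x+1))$, where $x$ is the number of arcs $B\ne A$ with $F_r^j(B)=F_r^j(A)$ such that, walking clockwise from $s(B)$, $s(A)$ is met no later than $s(F_r^j(A))$ (the latter being met at once if $B=F_r^j(A)$), and $\varepsilon>0$ is so small that no extreme of $\mathbf M$ lies in $(s(F_r^j(A)),t(A^j)]$. $\mathbf M^j=(C,\{A^j: A\in\mathcal A\})$. $\omega(\mathbf M)$ is $n$ if $\mathbf M$ is PIG, and otherwise the minimum integer $\omega>1$ such that $A^\omega\subset A$ for some arc $A$. **Multiplicative models.** A UCA model is a PCA model all of whose arcs have the same length. A $(c,\ell+1)$-CA model is a UCA model whose circle has integer length $c$, whose arcs have integer length $\ell+1$, and whose extremes are integers. For such a model $\mathbf U$ and $i\ge0$, $i\times\mathbf U$ has the same circle and the arcs $(s(A),\,s(A)+i\ell+1 \bmod c)$. $\mathbf U$ is $k$-multiplicative when $i\times\mathbf U$ is a UCA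 model equivalent to $\mathbf U^i$ for every $0\le i\le k$. ''A $k$-multiplicative model'' means a $k$-multiplicative $(c,\ell+1)$-CA model for some $c,\ell$. **Synthetic graph.** A $1$-hollow is an edge $B\to A$ for arcs $A,B$ with $s(B)\in A$, $B=F_r(A)$ and $A=F_l(B)$. An $i$-nose ($i\ge 0$) is an edge $A\to B$ for arcs with $s(B)\notin A^i$ and $A=H_l^i(L(B))$. $\mathbf S_*^k=\mathbf S^k_*(\mathbf M)$ is the directed multigraph (loops allowed) with vertex set $\mathcal A(\mathbf M)$ whose edges are the $1$-hollows and the $i$-noses for $0\le i\le k$. An $i$-nose $A\to B$ is short if $i<k$ and ($H_l(A)\ne\bot$ or $H_r(B)\neq\bot$). $\mathbf S^k=\mathbf S^k(\mathbf M)$ is obtained from $\mathbf S_*^k$ by deleting the short noses. A nose $A\to B$ is internal if $A<B$, a hollow $A\to B$ is internal if $B<A$; other edges are external. For a walk $W$, $\mathrm{ext}(W)$ is its number of external hollows minus its number of external noses (with multiplicity). A cycle is a closed walk $v_0,\dots,v_j=v_0$ ($j\ge1$) with $v_0,\dots,v_{j-1}$ distinct. A walk $B_0,\dots,B_j$ of $\mathbf S^k$ is greedy hollow (resp. greedy nose) when, for every $0\le i<j$ such that $B_i\to B_{i+1}$ is a nose (resp. hollow) of the walk, $\mathbf S^k$ has no hollow (resp. nose) starting at $B_i$. **Rows.** $\mathrm{row}(A)=0$ if $A$ is the initial arc; $\mathrm{row}(A)=\mathrm{row}(B)+1$ if $A=H_r(B)$ for some $B<A$; $\mathrm{row}(A)=\mathrm{row}(L(A))$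 otherwise. An arc is rightmost if it is the greatest arc (w.r.t. $<$) of its row. A nose $A\to B$ is backward if it is internal and $A$ is rightmost. All other internal edges are forward. A walk is internal (forward) if all its edges are internal (forward). The jump of an internal edge $A\to B$ is $\mathrm{jmp}(A\to B)=\mathrm{row}(B)-\mathrm{row}(A)$, and the jump of an internal walk is the sum of the jumps of its edges. **Unrolling.** For $\lambda\in\mathbb N$, $\lambda\cdot\mathbf M$ is the PCA model on a circle of length $\lambda |C|$ that has, for each $A\in\mathcal A(\mathbf M)$ and $0\le i<\lambda$, an arc $A_{(i)}$, called a copy of $A$, with $s(A_{(i)})=s(A)+i|C|$ and $t(A_{(i)})=t(A)+|C|(i+\beta)\bmod \lambda|C|$, where $\beta=1$ if $s(A)>t(A)$ and $\beta=0$ otherwise. $\lambda\cdot\mathbf S^k=\mathbf S^k(\lambda\cdot\mathbf M)$ (rows, jumps, internal, forward, etc. are those of the model $\lambda\cdot\mathbf M$). A hollow (nose) $A'\to B'$ of $\lambda\cdot \mathbf S^k$ is a copy of the hollow (nose) $A\to B$ of $\mathbf S^k$ if $A'$ is a copy of $A$ and $B'$ is a copy of $B$; a walk of $\lambda\cdot\mathbf S^k$ is a copy of a walk $W$ of $\mathbf S^k$ if its $i$-th edge is a copy of the $i$-th edge of $W$ for all $i$. **Twisting bounds.** $\gamma\in\mathbb N$ is a twisting bound of $\mathbf S^k$ if, for every $\lambda\ge\gamma$, no walk $W$ of $\mathbf S^k$ has a forward copy $T$ in $\lambda\cdot\mathbf S^k$ with $\mathrm{jmp}(T)\ge\gamma$.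 *)

(* Defs.v *)
(* Mathematical Components world; the real line is an arbitrary R : realType. *)
From mathcomp Require Export all_boot all_order all_algebra.
From mathcomp Require Export classical_sets reals.

Set Implicit Arguments.
Unset Strict Implicit.
Unset Printing Implicit Defensive.
Import Order.TTheory GRing.Theory Num.Theory.
Local Open Scope ring_scope.

Section Models.
Variable R : realType.

(* A circle of length [clen] is the interval [0, clen), a point being its     *)
(* clockwise distance from 0.  Arc number i of a model goes clockwise from    *)
(* [beg i] to [fin i]; [pca] below forces the numbering to be A_0 < A_1 < ... *)
Record model := Model {
  clen : R;
  narc : nat;
  beg : 'I_narc -> R;
  fin : 'I_narc -> R }.

Definition in_arc (s t x : R) : bool :=
  if s < t then (s < x) && (x < t) else (s < x) || (x < t).

Definition cwdist (c x y : R) : R := if x <= y then y - x else y - x + c.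

Definition modr (x c : R) : R := x - c * (Num.floor (x / c))%:~R.

Definition on_circle (M : model) (x : R) : bool := (0 <= x) && (x < clen M).

Definition arc_incl (M : model) (s t s' t' : R) : Prop :=
  forall x, on_circle M x -> in_arc s t x -> in_arc s' t' x.

Record pca (M : model) : Prop := Pca {
  pca_clen : 0 < clen M;
  pca_beg_point : forall i : 'I_(narc M), on_circle M (beg i);
  pca_fin_point : forall i : 'I_(narc M), on_circle M (fin i);
  pca_sorted : forall i j : 'I_(narc M), (i < j)%N -> beg i < beg j;
  pca_fin_inj : injective (@fin M);
  pca_beg_fin : forall i j : 'I_(narc M), beg i <> fin j;
  pca_proper : forall i j : 'I_(narc M), i <> j ->
    ~ arc_incl M (beg i) (fin i) (beg j) (fin j) }.

Definition pig (M : model) : bool :=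
  [forall i : 'I_(narc M), ~~ (in_arc (beg i) (fin i) 0 || (fin i == 0))].

Definition covers (M : model) : Prop :=
  forall x, on_circle M x -> exists i : 'I_(narc M), in_arc (beg i) (fin i) x.

(* The convention that the point 0 of a non-covering model is placed so that  *)
(* the model is PIG. *)
Definition well_placed (M : model) : Prop := ~ covers M -> pig M.

Record spca (M : model) : Prop := Spca {
  spca_pca : pca M;
  spca_placed : well_placed M;
  spca_npig : ~~ pig M }.

(* An extreme is (false, i) for the beginning point of arc i and (true, i)    *)
(* for its ending point. *)
Definition expos (M : model) (e : bool * 'I_(narc M)) : R :=
  if e.1 then fin e.2 else beg e.2.

(* Clockwise distance from the beginning point of the initial arc. *)
Definition from_init (M : model) (x : R) : R :=
  if (insub 0%N : option 'I_(narc M)) is Some i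
  then cwdist (clen M) (beg i) x else x.

Definition extreme_seq (M : model) : seq (bool * 'I_(narc M)) :=
  sort (fun e e' => from_init M (expos e) <= from_init M (expos e'))
       (enum {: bool * 'I_(narc M)}).

Definition equivalent (M N : model) : Prop :=
  exists2 f : 'I_(narc M) -> 'I_(narc N), bijective f &
    map (fun e => (e.1, f e.2)) (extreme_seq M) = extreme_seq N.

Section Functions.
Variable M : model.
Notation arc := 'I_(narc M).

Definition Lf (a : arc) : arc := ord_pred a.
Definition Rf (a : arc) : arc := ordS a.

(* The last element of the maximal run a, f a, f (f a), ... (of at most       *)
(* narc M elements) all of which satisfy P. *)
Definition run_end (P : pred arc) (f : arc -> arc) (a : arc) : arc :=
  iter (\max_(m < narc M | all P (traject f a m.+1)) m) f a.

Definition Fr (a : arc) : arc :=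
  run_end (fun b => in_arc (beg a) (fin a) (beg b) || (beg b == beg a)) Rf a.
Definition Fl (a : arc) : arc :=
  run_end (fun b => in_arc (beg a) (fin a) (fin b) || (fin b == fin a)) Lf a.

(* None is the undefined value. *)
Definition Hl (a : arc) : option arc :=
  [pick b | (Fr b == a) && (Fr (Rf b) != a)].
Definition Hr (a : arc) : option arc :=
  [pick b | (Fl b == a) && (Fl (Lf b) != a)].

Definition Frj (j : nat) (a : arc) : arc := iter j Fr a.
Definition Hlj (j : nat) (a : arc) : option arc := iter j (obind Hl) (Some a).

(* The number x in t(a^j) = s(F_r^j(a)) + eps * (x + 1): s(b) is at clockwise *)
(* distance 0 from itself, so b = F_r^j(a) never counts. *)
Definition power_shift (j : nat) (a : arc) : nat :=
  #|[set b | [&& b != a, Frj j b == Frj j a &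
      cwdist (clen M) (beg b) (beg a)
        <= cwdist (clen M) (beg b) (beg (Frj j a))]]|.

(* No extreme lies in (s(F_r^j(a)), t(a^j)], for any arc a. *)
Definition small_eps (j : nat) (e : R) : Prop :=
  0 < e /\
  forall (a : arc) (x : bool * arc),
    ~~ (0 < cwdist (clen M) (beg (Frj j a)) (expos x)
          <= e * (power_shift j a).+1%:R).

Definition eps (j : nat) : R := xget 0 [set e | small_eps j e]%classic.

Definition power : nat -> model := fun j =>
  @Model (clen M) (narc M) (@beg M)
    (fun a => modr (beg (Frj j a) + eps j * (power_shift j a).+1%:R) (clen M)).

Definition in_power (j : nat) (a : arc) (x : R) : bool :=
  in_arc (beg a) (@fin (power j) a) x.

Definition power_wraps (w : nat) : Prop :=
  exists a : arc, arc_incl M (beg a) (@fin (power w) a) (beg a) (fin a).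

Definition omega : nat :=
  if pig M then narc M
  else xget 0%N [set w | [/\ (1 < w)%N, power_wraps w &
         forall v, (1 < v)%N -> power_wraps v -> (w <= v)%N]]%classic.

Definition is_hollow (b a : arc) : bool :=
  [&& in_arc (beg a) (fin a) (beg b), b == Fr a & a == Fl b].

Definition is_nose (i : nat) (a b : arc) : bool :=
  ~~ in_power i a (beg b) && (Some a == Hlj i (Lf b)).

Definition is_short (k i : nat) (a b : arc) : bool :=
  (i < k)%N && ((Hl a != None) || (Hr b != None)).

Inductive edge_kind := Hollow | Nose of nat.

Record edge := Edge { src : arc; kind : edge_kind; dst : arc }.

Definition hollow_edge (e : edge) : bool :=
  if kind e is Hollow then true else false.
Definition nose_edge (e : edge) : bool := ~~ hollow_edge e.

Definition synth_star (k : nat) (e : edge) : bool :=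
  match kind e with
  | Hollow => is_hollow (src e) (dst e)
  | Nose i => (i <= k)%N && is_nose i (src e) (dst e)
  end.

Definition synth (k : nat) (e : edge) : bool :=
  synth_star k e &&
  (if kind e is Nose i then ~~ is_short k i (src e) (dst e) else true).

Definition internal (e : edge) : bool :=
  if hollow_edge e then (dst e < src e)%N else (src e < dst e)%N.

Definition consecutive (e f : edge) : bool := dst e == src f.

(* A walk is given by its sequence of edges; trivial walks are all [::]. *)
Definition walk (k : nat) (W : seq edge) : bool :=
  all (synth k) W && sorted consecutive W.

Definition cycle_walk (k : nat) (W : seq edge) : bool :=
  [&& (0 < size W)%N, all (synth k) W, cycle consecutive W & uniq (map src W)].

Definition ext (W : seq edge) : int :=
  (count (fun e => hollow_edge e && ~~ internal e) W)%:Z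
  - (count (fun e => nose_edge e && ~~ internal e) W)%:Z.

Definition starts_hollow (k : nat) (a : arc) : bool :=
  [exists b, synth k (Edge a Hollow b)].
Definition starts_nose (k : nat) (a : arc) : bool :=
  [exists i : 'I_k.+1, [exists b, synth k (Edge a (Nose i) b)]].

Definition greedy_hollow (k : nat) (W : seq edge) : bool :=
  all (fun e => nose_edge e ==> ~~ starts_hollow k (src e)) W.
Definition greedy_nose (k : nat) (W : seq edge) : bool :=
  all (fun e => hollow_edge e ==> ~~ starts_nose k (src e)) W.

(* The row of an arc.  The fuel d only makes the recursion structural;     *)
(* arowE below is the defining recursion. *)
Fixpoint arow_rec (d : nat) (a : arc) : nat :=
  if d is d'.+1 then
    if (a : nat) == 0%N then 0%N
    else if [pick b : arc | (b < a)%N && (Hr b == Some a)] is Some b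
         then (arow_rec d' b).+1
         else arow_rec d' (Lf a)
  else 0%N.

Definition arow (a : arc) : nat := arow_rec a.+1 a.

Lemma Lf_lt (a : arc) : (a : nat) != 0%N -> (Lf a < a)%N.
Proof.
move=> a0; have a_gt0 : (0 < a)%N by rewrite lt0n.
rewrite /= -subn1 addnC -addnBA // modnDl subn1 modn_small ?prednK //.
exact: ltnW.
Qed.

Lemma arow_rec_fuel (d : nat) (a : arc) : (a < d)%N -> arow_rec d a = arow a.
Proof.
have fuel : forall d1 d2 (b : arc), (b < d1)%N -> (b < d2)%N ->
    arow_rec d1 b = arow_rec d2 b.
  elim=> [|d1 IH] [|d2] b //; rewrite !ltnS => b1 b2 /=.
  case: (eqVneq (b : nat) 0%N) => // b0.
  case: pickP => [b' /andP[lt_b' _]|_].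
    by congr _.+1; apply: IH; apply: leq_trans lt_b' _.
  by apply: IH; apply: leq_trans (Lf_lt b0) _.
by move=> ltad; apply: fuel.
Qed.

Lemma arowE (a : arc) : arow a =
  if (a : nat) == 0%N then 0%N
  else if [pick b : arc | (b < a)%N && (Hr b == Some a)] is Some b
       then (arow b).+1
       else arow (Lf a).
Proof.
rewrite {1}/arow /=; case: eqVneq => // a0.
case: pickP => [b /andP[ltba _]|_]; first by rewrite arow_rec_fuel.
by rewrite arow_rec_fuel // Lf_lt.
Qed.

Definition rightmost (a : arc) : bool :=
  [forall b, (arow b == arow a) ==> (b <= a)%N].

Definition backward (e : edge) : bool :=
  [&& nose_edge e, internal e & rightmost (src e)].

Definition forward (e : edge) : bool := internal e && ~~ backward e.

Definition jump (e : edge) : int := (arow (dst e))%:Z - (arow (src e))%:Z.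

Definition walk_jump (W : seq edge) : int := \sum_(e <- W) jump e.

End Functions.

Definition uca (M : model) : Prop :=
  pca M /\ exists d, forall i : 'I_(narc M),
    cwdist (clen M) (beg i) (fin i) = d.

Definition ca_model (c l : nat) (U : model) : Prop :=
  [/\ uca U, clen U = c%:R,
      forall i : 'I_(narc U), cwdist (clen U) (beg i) (fin i) = l.+1%:R &
      forall x : bool * 'I_(narc U), expos x \is a Num.int].

(* [times l i U] is i x U for a (c, l+1)-CA model U. *)
Definition times (l i : nat) (U : model) : model :=
  @Model (clen U) (narc U) (@beg U)
    (fun a => modr (beg a + (i * l + 1)%:R) (clen U)).

Definition k_multiplicative (k : nat) (U : model) : Prop :=
  exists c l : nat, ca_model c l U /\
    forall i, (i <= k)%N ->
      uca (times l i U) /\ equivalent (times l i U) (power U i).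

Lemma base_subproof (lam n : nat) (m : 'I_(lam * n)) : (m %% n < n)%N.
Proof. by rewrite ltn_mod; case: n m => // -[m]; rewrite muln0. Qed.

(* The arc A_(i) of lam . M, for A arc number a of M, has number i * n + a. *)
Definition base (lam n : nat) (m : 'I_(lam * n)) : 'I_n :=
  Ordinal (base_subproof m).

Definition unroll (lam : nat) (M : model) : model :=
  @Model (lam%:R * clen M) (lam * narc M)
    (fun m => beg (base m) + (m %/ narc M)%:R * clen M)
    (fun m =>
       modr (fin (base m)
             + clen M * (m %/ narc M + (fin (base m) < beg (base m))%R)%:R)
            (lam%:R * clen M)).

(* The index i of an i-nose need not be preserved. *)
Definition edge_copy (lam : nat) (M : model)
    (e' : edge (unroll lam M)) (e : edge M) : bool :=
  [&& base (src e') == src e, base (dst e') == dst e &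
      hollow_edge e' == hollow_edge e].

Definition walk_copy (lam : nat) (M : model)
    (T : seq (edge (unroll lam M))) (W : seq (edge M)) : bool :=
  all2 (@edge_copy lam M) T W.

Definition twisting_bound (k : nat) (M : model) (g : nat) : Prop :=
  forall lam : nat, (g <= lam)%N ->
    ~ exists (W : seq (edge M)) (T : seq (edge (unroll lam M))),
        [/\ walk k W, walk k T, walk_copy T W,
            all (@forward (unroll lam M)) T & g%:Z <= walk_jump T].

End Models.

(* Main.v *)
(* On the universal cover of the circle the arcs become the integers, F_r a
   monotone map f with f (a + n) = f a + n, and every edge of S^k leads from a
   vertex b at level t either to f^i b + 1 at level t + i (a nose; only the
   longest one survives) or to the least a with f a = b, at level t - 1 (a
   hollow).  A k-multiplicative model equivalent to M amounts to integers c,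
   l > 0 and u with u (a + n) = u a + c, u (f a) <= u a + l and
   u (f^i a + 1) >= u a + i l + 2 for i <= k; call f feasible in this case.
   Compare the slope p / L of f with the slope p' / L' of the fastest curve
   that no edge crosses from right to left.  If p / L < p' / L', then counting
   the translates of both curves to the left of a point, with a correction that
   makes the inequalities strict, gives u.  Otherwise the slopes agree; then
   that curve carries a greedy nose path climbing at slope p / L and meeting no
   periodic point of f at a nose.  Its copies in large unrollings are forward
   and have unbounded jump, and no greedy nose cycle with ext < 0 can share a
   vertex with a greedy hollow cycle with ext > 0, since together they would
   close a path from a vertex to its own left.  If f is feasible, u b - t l never
   decreases along edges and increases by 2 along noses.  This bounds the jump
   of forward walks by k l, and makes greedy nose cycles go around clockwise and
   greedy hollow cycles counterclockwise; in the plane of pairs (b, t) two such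
   cycles cross, hence meet. *)
Require Import Defs.
From mathcomp Require Import zify ring lra boolp.

Set Implicit Arguments.
Unset Strict Implicit.
Unset Printing Implicit Defensive.
Import Order.TTheory GRing.Theory Num.Theory.
Local Open Scope ring_scope.

(** [feasible] is the hub: each of the three conditions is compared with it alone. An orbit of f is
    also a curve that no edge crosses from right to left, the slowest one. Either count of
    translates satisfies the required inequalities weakly. A displacement of w turns and e levels
    that leaves both counts tied solves two linear equations, and different slopes make w = e = 0
    the only solution; so ties can be broken by comparing n residues, which is the correction. When
    the slopes agree, the obstacle is the deletion of short noses: a vertex in the image of f may
    have lost its longest nose. A greedy nose path still arrives at the end of that nose, by a
    detour down to the fibre of f over the vertex and through this fibre, unless there are
    arbitrarily long backward orbits of such vertices; modulo n, this makes the vertex periodic.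
    Periodic points also decide what is forward: except in the last row, the rightmost arcs are
    iterates of f at -1, which become periodic, so far enough from 0 a nose that avoids periodic
    points is not backward. *)

Lemma shift_mulz (n : nat) (h : int -> int) (a w : int) :
  (forall b : int, h (b + n%:Z) = h b + n%:Z) -> h (a + w * n%:Z) = h a + w * n%:Z.
Proof.
move=> hn; have hN (b : int) (m : nat) : h (b + m%:Z * n%:Z) = h b + m%:Z * n%:Z.
  elim: m => [|m IH]; first by rewrite mul0r !addr0.
  by rewrite -addn1 PoszD mulrDl mul1r !addrA hn IH.
case: w => m; first exact: hN.
have := hN (a + Negz m * n%:Z) m.+1.
by rewrite NegzE mulNr -!addrA addNr addr0 => ->; rewrite -addrA subrr addr0.
Qed.

Lemma seq_iter (T : Type) (F : T -> T) (Y : int -> T) (t : int) (j : nat) :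
  (forall t : int, Y (t + 1) = F (Y t)) -> Y (t + j%:Z) = iter j F (Y t).
Proof.
move=> YS; elim: j => [|j IH]; first by rewrite addr0.
by rewrite /= -IH -YS -addrA -PoszD addn1.
Qed.

(** * Residues modulo n as arc numbers *)

Section Residues.
Variable n : nat.
Hypothesis n_gt0 : (0 < n)%N.

Lemma ar_subproof (i : int) : (`|(i %% n%:Z)%Z|%N < n)%N.
Proof.
have n0 : n%:Z != 0 by lia.
by have := ltz_mod i n0; have := modz_ge0 i n0; lia.
Qed.

Definition ar (i : int) : 'I_n := Ordinal (ar_subproof i).

Lemma ar_val (i : int) : ((ar i : nat) : int) = (i %% n%:Z)%Z.
Proof. by rewrite /= gez0_abs // modz_ge0 //; lia. Qed.

Lemma ar_decomp (i : int) : exists w : int, i = (ar i : nat)%:Z + w * n%:Z.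
Proof. by exists (i %/ n%:Z)%Z; rewrite ar_val {1}(divz_eq i n%:Z) addrC. Qed.

Lemma ar_eqP (i j : int) : reflect (exists w : int, j = i + w * n%:Z) (ar i == ar j).
Proof.
apply: (iffP eqP) => [e|[w ->]].
  have [w ->] := ar_decomp j; have [w' e'] := ar_decomp i.
  by rewrite -e {2}e'; exists (w - w'); rewrite mulrBl; lia.
apply: val_inj; apply/eqP; rewrite -eqz_nat; apply/eqP.
by rewrite !ar_val addrC modzMDl.
Qed.

Lemma ar_shift (i w : int) : ar (i + w * n%:Z) = ar i.
Proof. by apply/esym/eqP/ar_eqP; exists w. Qed.

Lemma ar_ord (a : 'I_n) : ar (a : nat)%:Z = a.
Proof.
apply: val_inj; apply/eqP; rewrite -eqz_nat; apply/eqP; rewrite ar_val.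
by rewrite modz_small // ltz_nat ltn_ord andbT.
Qed.

End Residues.

(** * Monotone maps of the circle *)

(* On the universal cover; the intended f is the lift of F_r. *)
Record circle_lift (n : nat) (f : int -> int) : Prop := CircleLift {
  circle_n : (0 < n)%N;
  circle_mono : forall a b : int, a <= b -> f a <= f b;
  circle_per : forall a : int, f (a + n%:Z) = f a + n%:Z;
  circle_gt : forall a : int, a < f a }.

Section Lifted.
Variables (n : nat) (f : int -> int).
Hypothesis fL : circle_lift n f.
Let n_gt0 := circle_n fL.
Let f_mono := circle_mono fL.
Let f_per := circle_per fL.
Let f_gt := circle_gt fL.

Lemma f_shift (a w : int) : f (a + w * n%:Z) = f a + w * n%:Z.
Proof. exact: shift_mulz. Qed.

Lemma iter_mono (j : nat) (a b : int) : a <= b -> iter j f a <= iter j f b.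
Proof. by move=> ab; elim: j => //= j; apply: f_mono. Qed.

Lemma iter_per (j : nat) (a : int) :
  iter j f (a + n%:Z) = iter j f a + n%:Z.
Proof. by elim: j => //= j ->. Qed.

Lemma iter_shift (j : nat) (a w : int) :
  iter j f (a + w * n%:Z) = iter j f a + w * n%:Z.
Proof. by apply: shift_mulz => b; apply: iter_per. Qed.

Lemma iter_ge (j : nat) (a : int) : a + j%:Z <= iter j f a.
Proof. by elim: j => [|j IH] /=; [lia|have := f_gt (iter j f a); lia]. Qed.

Lemma f_lt_inv (a b : int) : f a < f b -> a < b.
Proof. by move=> fab; rewrite ltNge; apply/negP => /f_mono; lia. Qed.

Lemma preim_ex (b : int) : exists a, b <= f a /\ f (a - 1) < b.
Proof.
have key (m : nat) (a : int) : b <= f a -> f (a - m%:Z) < b ->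
    exists a, b <= f a /\ f (a - 1) < b.
  elim: m a => [|m IH] a fa fam; first by move: fam; rewrite subr0; lia.
  have [fa1|fa1] := leP b (f (a - 1)); last by exists a.
  by apply: (IH (a - 1)) => //; rewrite -addrA -opprD -PoszD.
(* Going back d + 1 turns lowers the value f b = b + d by at least d + 1, hence below b. *)
have gt := f_gt b; set d : int := f b - b.
have fd : f (b + (- (d + 1)) * n%:Z) < b.
  rewrite f_shift.
  have : d + 1 <= (d + 1) * n%:Z by rewrite -{1}[d + 1]mulr1; apply: ler_wpM2l; lia.
  by rewrite /d; lia.
set e : int := (d + 1) * n%:Z.
apply: (key `|e|%N b (ltW gt)).
have -> : b - `|e|%N%:Z = b + (- (d + 1)) * n%:Z by rewrite /e /d; lia.
exact: fd.
Qed.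

(* The lift of F_l: the least [a] with [b <= f a]. *)
Definition g (b : int) : int := xget 0 [set a | b <= f a /\ f (a - 1) < b]%classic.

(** The Galois connection between [f] and [g]; the facts about hollows are read off from it. *)
Lemma le_f (a b : int) : (b <= f a) = (g b <= a).
Proof.
have /= := xgetPex 0 (preim_ex b); rewrite -/(g b); set y := g b => -[y1 y2].
apply/idP/idP => [ba|/f_mono yb]; last first.
  exact: le_trans y1 yb.
rewrite leNgt; apply/negP => ay; have ay1 : a <= y - 1 by lia.
by have := f_mono ay1; lia.
Qed.

Lemma lt_f (a b : int) : (f a < b) = (a < g b).
Proof. by rewrite ltNge le_f -ltNge. Qed.

Lemma f_g (b : int) : b <= f (g b).
Proof. by rewrite le_f. Qed.

Lemma g_lt (b : int) : g b < b.
Proof. by have := f_gt (b - 1); have := le_f (b - 1) b; lia. Qed.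

Lemma g_mono (a b : int) : a <= b -> g a <= g b.
Proof. by move=> ab; rewrite -le_f; apply: le_trans (f_g b). Qed.

Lemma g_per (a : int) : g (a + n%:Z) = g a + n%:Z.
Proof.
apply/eqP; rewrite eq_le -le_f f_per lerD2r f_g /=.
rewrite -lerBrDr -le_f -(lerD2r n%:Z) -f_per subrK; exact: f_g.
Qed.

Definition inim (b : int) : bool := f (g b) == b.

Lemma inimP (b : int) : reflect (exists a, f a = b) (inim b).
Proof.
apply: (iffP eqP) => [|[a fa]]; first by exists (g b).
by apply/eqP; rewrite eq_le f_g andbT -[X in _ <= X]fa; apply: f_mono; rewrite -le_f fa.
Qed.

Lemma inim_f (a : int) : inim (f a).
Proof. by apply/inimP; exists a. Qed.

Lemma f_gK (b : int) : inim b -> f (g b) = b.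
Proof. by move/eqP. Qed.

Lemma inim_shift (b w : int) : inim (b + w * n%:Z) = inim b.
Proof. by rewrite /inim (shift_mulz _ _ g_per) f_shift (inj_eq (addIr _)). Qed.

(** The last point of a fibre of [f]; on arcs, a = H_l(f a). *)
Definition top (a : int) : bool := f a < f (a + 1).

Lemma top_shift (a w : int) : top (a + w * n%:Z) = top a.
Proof. by rewrite /top addrAC !f_shift ltrD2r. Qed.

Lemma ntop (a : int) : ~~ top a -> f (a + 1) = f a.
Proof.
have : f a <= f (a + 1) by apply: f_mono; lia.
by rewrite /top; lia.
Qed.

Definition tops (j : nat) (a : int) : Prop := forall s, (s < j)%N -> top (iter s f a).

Lemma topsS (j : nat) (a : int) : top a -> tops j (f a) -> tops j.+1 a.
Proof. by move=> ta tj [|s] //=; rewrite ltnS => /tj; rewrite -iterSr. Qed.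

(** At the last point of a fibre, [f] separates the point strictly from everything to its right. So
    a nose leaving [a] does not overtake an orbit that passes to the right of [a]. *)
Lemma tops_lt (j : nat) (a b : int) : tops j a -> a < b -> iter j f a < iter j f b.
Proof.
elim: j => [|j IH] //= tj ab.
have := IH (fun s sj => tj s (ltnW sj)) ab.
have := tj j (ltnSn j); rewrite /top => t1 t2.
apply: (lt_le_trans t1); apply: f_mono; lia.
Qed.

(* (b, t) lies strictly to the right of the orbit of f through (b', t'); f need
   not be invertible, so the lower of the two points is the one iterated. *)
Definition right_of (b' t' b t : int) : bool :=
  if t' <= t then iter `|t - t'|%N f b' < b else b' < iter `|t' - t|%N f b.

Lemma right_of_up (b' t' b : int) (m : nat) :
  right_of b' t' b (t' + m%:Z) = (iter m f b' < b).
Proof. by rewrite /right_of lerDl lez_nat leq0n addrAC subrr add0r absz_nat. Qed.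

Lemma right_of_down (b' t b : int) (m : nat) :
  right_of b' (t + m%:Z) b t = (b' < iter m f b).
Proof.
rewrite /right_of; case: m => [|m].
  by rewrite addr0 lexx subrr.
rewrite -[X in if X then _ else _]negbK -ltNge ltrDl ltz_nat ltn0Sn /=.
by rewrite addrAC subrr add0r absz_nat.
Qed.

Lemma level_cases (t t' : int) :
  (exists m : nat, t = t' + m%:Z) \/ (exists m : nat, t' = t + m.+1%:Z).
Proof.
have [tt'|tt'] := leP t' t; [left; exists `|t - t'|%N|right; exists `|t' - t|.-1%N]; lia.
Qed.

Lemma right_of_hollow (b' t' a t : int) :
  right_of b' t' (f a) t -> right_of b' t' a (t - 1).
Proof.
case: (level_cases (t - 1) t') => [[m]|[m]] e.
  have {1}-> : t = t' + m.+1%:Z by lia.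
  by rewrite e !right_of_up => /f_lt_inv.
have {1}-> : t' = t + m%:Z by lia.
by rewrite e !right_of_down -iterSr.
Qed.

Lemma right_of_nose (b' t' b t : int) (j : nat) :
  right_of b' t' b t -> right_of b' t' (iter j f b + 1) (t + j%:Z).
Proof.
case: (level_cases t t') => [[m ->]|[m ->]].
  rewrite right_of_up -addrA -PoszD right_of_up => bb.
  by rewrite addnC iterD; have := iter_mono j (ltW bb); lia.
rewrite right_of_down; have [jm|jm] := leqP j m.+1.
  have -> : t + m.+1%:Z = t + j%:Z + (m.+1 - j)%N%:Z by lia.
  rewrite right_of_down => bb; apply: (lt_le_trans bb).
  by rewrite -{1}(subnK jm) iterD; apply: iter_mono; lia.
have -> : t + j%:Z = t + m.+1%:Z + (j - m.+1)%N%:Z by lia.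
rewrite right_of_up => bb.
rewrite -{2}(subnK (ltnW jm)) iterD.
by have := iter_mono (j - m.+1) (ltW bb); lia.
Qed.

Lemma right_of_self (b t : int) (j : nat) :
  right_of b t (iter j f b + 1) (t + j%:Z).
Proof. by rewrite right_of_up ltzD1. Qed.

(** Orbits of [f] move right as the level rises, so none passes left of its origin later on. This
    refutes paths that return, after a nose, to the source of the nose at a level not lower. *)
Lemma right_of_irr (b t : int) (e : int) : 0 <= e -> ~ right_of b t b (t + e).
Proof.
move=> e0; have -> : e = `|e|%N%:Z by lia.
by rewrite right_of_up; have := iter_ge `|e| b; lia.
Qed.

(** The largest index i <= j of a nose leaving [a]. At a smaller index i, [top (iter i f a)] holds,
    so H_r of the end is defined and the nose is short. *)
Fixpoint nidx (j : nat) (a : int) : nat :=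
  if j is j'.+1 then if top a then (nidx j' (f a)).+1 else 0%N else 0%N.

Lemma nidx_le (j : nat) (a : int) : (nidx j a <= j)%N.
Proof. by elim: j a => //= j IH a; case: ifP => // _; apply: IH. Qed.

Lemma nidx_tops (j : nat) (a : int) : tops (nidx j a) a.
Proof.
elim: j a => [|j IH] a /=; first by move=> s.
by case: ifP => ta; [apply: topsS => //; apply: IH|move=> s].
Qed.

Lemma nidx_ntop (j : nat) (a : int) :
  (nidx j a < j)%N -> ~~ top (iter (nidx j a) f a).
Proof.
elim: j a => //= j IH a; case: ifP => [_|/negbT //].
by rewrite ltnS => /IH; rewrite -iterSr.
Qed.

Lemma nidx_uniq (k j : nat) (a : int) : (j <= k)%N -> tops j a ->
  (j < k)%N ==> ~~ top (iter j f a) -> j = nidx k a.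
Proof.
elim: k j a => [|k IH] [|j] a //=; first by move=> _ _ /negPf ->.
rewrite !ltnS -iterS iterSr => jk tj nt.
rewrite (tj 0%N isT); congr _.+1; apply: IH => // s sj.
by have := tj s.+1 sj; rewrite iterSr.
Qed.

Lemma nidx_shift (j : nat) (a w : int) : nidx j (a + w * n%:Z) = nidx j a.
Proof. by elim: j a => //= j IH a; rewrite top_shift f_shift IH. Qed.

(** * Greedy steps on the universal cover *)

Variable k : nat.

(* [mnose a] is the end of the longest nose of index at most k leaving a. *)
Definition mnose (a : int) : int := iter (nidx k a) f a + 1.
(** The longest nose is short only if its index is below k and H_l of its source is defined, that
    is, the source lies in the image of [f]. *)
Definition has_nose (a : int) : bool := (nidx k a == k) || ~~ inim a.

(* States are pairs (b, t) of a vertex of the universal cover and a level. *)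
Definition nstep (p : int * int) : int * int :=
  if has_nose p.1 then (mnose p.1, p.2 + (nidx k p.1)%:Z) else (g p.1, p.2 - 1).
Definition hstep (p : int * int) : int * int :=
  if inim p.1 then (g p.1, p.2 - 1) else (mnose p.1, p.2 + (nidx k p.1)%:Z).
(** Follows the longest nose even where it is short and so no edge of S^k. *)
Definition mstep (p : int * int) : int * int :=
  (mnose p.1, p.2 + (nidx k p.1)%:Z).

Definition sh (w e : int) (p : int * int) : int * int := (p.1 + w * n%:Z, p.2 + e).

Lemma mnose_gt (a : int) : a < mnose a.
Proof. by rewrite /mnose; have := iter_ge (nidx k a) a; lia. Qed.

Lemma mnose_shift (a w : int) : mnose (a + w * n%:Z) = mnose a + w * n%:Z.
Proof. by rewrite /mnose nidx_shift iter_shift addrAC. Qed.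

Lemma nstep_sh (w e : int) (p : int * int) : nstep (sh w e p) = sh w e (nstep p).
Proof.
rewrite /nstep /sh /= /has_nose nidx_shift inim_shift; case: ifP => _ /=.
  by rewrite mnose_shift; congr pair; lia.
by rewrite (shift_mulz _ _ g_per); congr pair; lia.
Qed.

Lemma hstep_sh (w e : int) (p : int * int) : hstep (sh w e p) = sh w e (hstep p).
Proof.
rewrite /hstep /sh /= nidx_shift inim_shift; case: ifP => _ /=.
  by rewrite (shift_mulz _ _ g_per); congr pair; lia.
by rewrite mnose_shift; congr pair; lia.
Qed.

Lemma mstep_sh (w e : int) (p : int * int) : mstep (sh w e p) = sh w e (mstep p).
Proof. by rewrite /mstep /sh /= nidx_shift mnose_shift; congr pair; lia. Qed.

Lemma sh_add (w e w' e' : int) (p : int * int) :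
  sh w e (sh w' e' p) = sh (w + w') (e + e') p.
Proof. by rewrite /sh /=; congr pair; lia. Qed.

Section IterShift.
Variable F : int * int -> int * int.
Hypothesis F_sh : forall (w e : int) (p : int * int), F (sh w e p) = sh w e (F p).

Lemma iter_sh (i : nat) (w e : int) (p : int * int) : iter i F (sh w e p) = sh w e (iter i F p).
Proof. by elim: i => //= i ->; rewrite F_sh. Qed.

Lemma iter_cycle (s m : nat) (w e : int) (p : int * int) : iter s F p = sh w e p ->
  iter (m * s) F p = sh (m%:Z * w) (m%:Z * e) p.
Proof.
move=> Fs; elim: m => [|m IH].
  by rewrite mul0n /= /sh !mul0r !addr0; case: p {Fs}.
by rewrite mulSn iterD IH iter_sh Fs sh_add; congr sh; lia.
Qed.
End IterShift.

Definition right (q p : int * int) : bool := right_of q.1 q.2 p.1 p.2.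

Lemma right_nstep (q p : int * int) : right q p -> right q (nstep p).
Proof.
rewrite /right /nstep; case: ifP => [_|nn] /= r; first exact: right_of_nose.
apply: right_of_hollow; rewrite f_gK //.
by move: nn; rewrite /has_nose; case: (inim _); rewrite ?orbT.
Qed.

Lemma right_hstep (q p : int * int) : right q p -> right q (hstep p).
Proof.
rewrite /right /hstep; case: ifP => [im|_] /= r; last exact: right_of_nose.
by apply: right_of_hollow; rewrite f_gK.
Qed.

Lemma right_mstep (q p : int * int) : right q p -> right q (mstep p).
Proof. exact: right_of_nose. Qed.

Lemma right_mstep_self (p : int * int) : right p (mstep p).
Proof. exact: right_of_self. Qed.

Lemma right_iter (F : int * int -> int * int) (i : nat) q p :
  (forall p : int * int, right q p -> right q (F p)) -> right q p -> right q (iter i F p).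
Proof. by move=> Fr r; elim: i => //= i; apply: Fr. Qed.

(** * Rotation numbers *)

Definition rot (L : nat) (p : int) : Prop := exists x : int, iter L f x = x + p * n%:Z.

Lemma iter_mul (L m : nat) (x p : int) : iter L f x = x + p * n%:Z ->
  iter (m * L) f x = x + m%:Z * p * n%:Z.
Proof.
move=> fx; elim: m => [|m IH]; first by rewrite /= !mul0r addr0.
by rewrite mulSn iterD IH iter_shift fx; ring.
Qed.

Lemma window (x b : int) : exists j : int, x + j * n%:Z <= b < x + j * n%:Z + n%:Z.
Proof.
exists ((b - x) %/ n%:Z)%Z.
have n0 : n%:Z != 0 by lia.
have := divz_eq (b - x) n%:Z; have := ltz_mod (b - x) n0; have := modz_ge0 (b - x) n0.
lia.
Qed.

(** A gain of w turns in i steps repeats, giving L w turns in L i steps, while the closed orbit of x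
    allows i p turns up to an error. Taking the window at b - 1 keeps this error strictly below one
    turn. *)
Lemma rot_le (L : nat) (p b w : int) (i : nat) : rot L p ->
  b + w * n%:Z <= iter i f b -> w * L%:Z <= i%:Z * p.
Proof.
move=> [x fx] fib; have [j /andP[j1 j2]] := window x (b - 1).
have lo : forall m, b + m%:Z * w * n%:Z <= iter (m * i) f b.
  elim=> [|m IH]; first by rewrite /= !mul0r addr0.
  rewrite mulSn iterD.
  have := iter_mono i IH; rewrite iter_shift.
  have -> : b + m.+1%:Z * w * n%:Z = b + w * n%:Z + m%:Z * w * n%:Z by ring.
  by apply: le_trans; rewrite lerD2r.
have hi : iter (L * i) f b <= x + i%:Z * p * n%:Z + (j + 1) * n%:Z.
  rewrite mulnC -(iter_mul i fx) -iter_shift; apply: iter_mono; lia.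
have h : (L%:Z * w) * n%:Z < (i%:Z * p + 1) * n%:Z.
  by have := lo L; rewrite !mulrDl in hi *; lia.
by rewrite ltr_pM2r in h; [rewrite mulrC -ltzD1|lia].
Qed.

Lemma rot_ge (L : nat) (p b w : int) (i : nat) : rot L p ->
  iter i f b <= b + w * n%:Z -> i%:Z * p <= w * L%:Z.
Proof.
move=> [x fx] fib; have [j /andP[j1 j2]] := window x b.
have hi : forall m, iter (m * i) f b <= b + m%:Z * w * n%:Z.
  elim=> [|m IH]; first by rewrite /= !mul0r addr0.
  rewrite mulSn iterD.
  have := iter_mono i IH; rewrite iter_shift.
  have -> : b + m.+1%:Z * w * n%:Z = b + w * n%:Z + m%:Z * w * n%:Z by ring.
  by move=> h; apply: (le_trans h); rewrite lerD2r.
have lo : x + i%:Z * p * n%:Z + j * n%:Z <= iter (L * i) f b.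
  by rewrite mulnC -(iter_mul i fx) -iter_shift; apply: iter_mono.
have h : (i%:Z * p) * n%:Z < (L%:Z * w + 1) * n%:Z.
  by have := hi L; rewrite !mulrDl in lo *; lia.
by rewrite ltr_pM2r in h; [rewrite [w * _]mulrC -ltzD1|lia].
Qed.

(** * Closed orbits of equivariant maps with a counter, and curves *)

Definition shs (w : int) (s : int * nat) : int * nat := (s.1 + w * n%:Z, s.2).

Lemma shs_add (w w' : int) (s : int * nat) : shs w (shs w' s) = shs (w + w') s.
Proof. by rewrite /shs /= mulrDl; congr pair; lia. Qed.

Section Periodic.
Variable F : int * nat -> int * nat.
Hypothesis F_shs : forall (w : int) (s : int * nat), F (shs w s) = shs w (F s).
Hypothesis F_bound : forall s : int * nat, (s.2 <= k)%N -> ((F s).2 <= k)%N.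

Lemma iter_shs (i : nat) (w : int) (s : int * nat) : iter i F (shs w s) = shs w (iter i F s).
Proof. by elim: i => //= i ->; rewrite F_shs. Qed.

Lemma iter_bound (i : nat) (s : int * nat) : (s.2 <= k)%N -> ((iter i F s).2 <= k)%N.
Proof. by move=> s2; elim: i => //= i; apply: F_bound. Qed.

Lemma cycle_ex (s : int * nat) : (s.2 <= k)%N -> exists i (L : nat) (p : int),
  (0 < L)%N /\ iter L F (iter i F s) = shs p (iter i F s).
Proof.
move=> s2; pose h (i : 'I_(n * k.+1).+1) : 'I_n * 'I_k.+1 :=
  (ar n_gt0 (iter i F s).1, inord (iter i F s).2).
have /injectivePn[i [j ij hij]] : ~~ injectiveb h.
  apply/negP => /injectiveP /leq_card.
  by rewrite card_prod !card_ord ltnn.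
wlog lij : i j ij hij / (i < j)%N => [th|].
  have [|ji|e] := ltngtP i j; first exact: th.
    by apply: (th j i) => //; rewrite eq_sym.
  by rewrite (val_inj e) eqxx in ij.
have /eqP/ar_eqP[w e1] : ar n_gt0 (iter i F s).1 = ar n_gt0 (iter j F s).1 := congr1 fst hij.
have /(congr1 val) : inord (iter i F s).2 = inord (iter j F s).2 :> 'I_k.+1 := congr1 snd hij.
rewrite /= !inordK ?ltnS ?iter_bound // => e2.
exists i, (j - i)%N, w; rewrite subn_gt0 lij -iterD subnK 1?ltnW //; split=> //.
by rewrite /shs -e1 e2; case: (iter j F s).
Qed.

(** Periodicity prolongs the forward orbit to negative times: [val t m] is the orbit at time t + m L
    moved back by m p turns, which does not depend on m once that time is nonnegative. *)
Lemma curve_ex s (L : nat) (p : int) : (0 < L)%N -> iter L F s = shs p s ->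
  exists Y : int -> int * nat, [/\ Y 0 = s, forall t : int, Y (t + 1) = F (Y t) &
    forall t : int, Y (t + L%:Z) = shs p (Y t)].
Proof.
move=> L0 FL; pose val (t m : int) := shs (- (m * p)) (iter (absz (t + m * L%:Z)%R) F s).
pose Y t := val t (absz t)%:Z.
have valS (t m : int) : 0 <= t + m * L%:Z -> val t (m + 1) = val t m.
  move=> tm; rewrite /val; have -> : (absz (t + (m + 1) * L%:Z)%R) = ((absz (t + m * L%:Z)%R) + L)%N.
    by rewrite mulrDl mul1r addrA; lia.
  by rewrite iterD FL iter_shs shs_add; congr shs; ring.
have valY (t : int) (m : nat) : (absz t <= m)%N -> Y t = val t m%:Z.
  move=> tm; rewrite -(subnK tm) addnC; elim: (m - absz t)%N => [|j IH]; first by rewrite addn0.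
  rewrite addnS -addn1 PoszD valS //.
  have : (absz t + j)%N%:Z * 1 <= (absz t + j)%N%:Z * L%:Z by apply: ler_wpM2l; lia.
  lia.
have Yge (t : int) (m : nat) : (absz t <= m)%N -> 0 <= t + m%:Z * L%:Z.
  move=> tm; have : m%:Z * 1 <= m%:Z * L%:Z by apply: ler_wpM2l; lia.
  lia.
exists Y; split=> [|t|t].
- by rewrite /Y /val mul0r !mul0r oppr0 /shs mul0r addr0; case: (s).
- rewrite (valY (t + 1) (absz t).+1) ?(valY t (absz t).+1) //; last by lia.
  rewrite /val F_shs -iterS; congr shs; congr (iter _ F s).
  by have := Yge t (absz t).+1 (leqnSn _); lia.
- pose m := (absz t + L)%N; rewrite (valY _ m); last by lia.
  rewrite (valY t m.+1); last by lia.
  rewrite /val shs_add -[(m.+1)]addn1 PoszD; have -> : t + L%:Z + m%:Z * L%:Z = t + (m%:Z + 1) * L%:Z by ring.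
  by congr shs; ring.
Qed.
End Periodic.

(* The fastest curve that no edge crosses from right to left: it follows f and
   gains one step, from f z to f (z + 1), every k levels, as well as wherever
   f z = f (z + 1); [s.2] counts the levels since the last gain. *)
Definition phi (s : int * nat) : int * nat :=
  if s.2 == k then (f (s.1 + 1), 1%N)
  else if top s.1 then (f s.1, s.2.+1) else (f s.1, 1%N).

Lemma phi_shs (w : int) (s : int * nat) : phi (shs w s) = shs w (phi s).
Proof.
rewrite /phi /shs /= top_shift addrAC !f_shift.
by case: ifP => // _; case: ifP.
Qed.

Hypothesis k_gt0 : (0 < k)%N.

Lemma phi_bound (s : int * nat) : (s.2 <= k)%N -> ((phi s).2 <= k)%N.
Proof. by rewrite /phi; case: eqP => //= sk s2; case: ifP => //= _; lia. Qed.

Lemma f_le_phi (s : int * nat) : f s.1 <= (phi s).1.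
Proof. by rewrite /phi; case: eqP => _ /=; [apply: f_mono; lia|case: ifP]. Qed.

Lemma phi_gt (j : nat) (s : int * nat) : s.1 + j%:Z <= (iter j phi s).1.
Proof.
elim: j => [|j IH] /=; first by rewrite addr0.
by have := f_le_phi (iter j phi s); have := f_gt (iter j phi s).1; lia.
Qed.

Lemma phi_inim (s : int * nat) : inim (phi s).1.
Proof. by rewrite /phi; case: eqP => _ /=; [|case: ifP => _]; apply: inim_f. Qed.

(** The orbit of [f] through b has a lead of one step over [phi], or has spent it. A gain of [phi],
    or a collapse f z = f (z + 1), costs the lead and resets the counter. From then on
    [r + s.2 <= k] excludes a gain by the counter in the r steps left, and at a collapse [phi]
    merely follows [f]. *)
Lemma phi_le (r : nat) (b : int) (s : int * nat) : (s.2 <= k)%N ->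
  (s.1 + 1 <= b /\ (r <= k)%N) \/ (s.1 <= b /\ (r + s.2 <= k)%N) ->
  (iter r phi s).1 <= iter r f b.
Proof.
elim: r b s => [|r IH] b s s2 /=; first by case=> -[]; [lia|].
rewrite -!iterS !iterSr => h; apply: IH; first exact: phi_bound.
rewrite /phi; case: eqP => [sk|sk] /=.
  right; case: h => -[sb rk]; last by lia.
  by split; [apply: f_mono|lia].
case: ifP => [t|/negbT/ntop t] /=.
  case: h => -[sb rk]; [left|right]; split; try lia.
    by have := f_mono sb; rewrite /top in t; lia.
  exact: f_mono.
right; case: h => -[sb rk]; split; try lia; last exact: f_mono.
by rewrite -t; apply: f_mono.
Qed.

(* No edge leads from the right of such a curve to a point on it or to its left. *)
Definition kcurve (y : int -> int) : Prop :=
  (forall t : int, f (y t) <= y (t + 1)) /\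
  (forall (t : int) (j : nat), (j <= k)%N -> y (t + j%:Z) <= iter j f (y t + 1)).

Lemma phi_curve (Y : int -> int * nat) :
  (forall t : int, Y (t + 1) = phi (Y t)) -> (forall t : int, ((Y t).2 <= k)%N) ->
  kcurve (fun t => (Y t).1).
Proof.
move=> YS Yk; split=> [t|t j jk]; first by rewrite YS f_le_phi.
rewrite (seq_iter _ _ YS).
by apply: phi_le => //; left.
Qed.

Lemma orbit_curve (x : int -> int) :
  (forall t : int, x (t + 1) = f (x t)) -> kcurve x.
Proof.
move=> xS; split=> [t|t j jk]; first by rewrite xS.
rewrite (seq_iter _ _ xS).
by apply: iter_mono; lia.
Qed.

(** * Counting potentials and feasibility *)

Section Potential.
Variables (y : int -> int) (L : nat) (p : int).
Hypothesis y_curve : kcurve y.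
Hypothesis y_per : forall t : int, y (t + L%:Z) = y t + p * n%:Z.

(* The number of translates of the points of the curve lying to the left of b. *)
Definition pot (b : int) : int := \sum_(t < L) ((b - 1 - y t%:Z) %/ n%:Z)%Z.

Lemma n_pos : 0 < n%:Z. Proof. by lia. Qed.

Lemma divn_shift (a w : int) : ((a + w * n%:Z) %/ n%:Z)%Z = (a %/ n%:Z)%Z + w.
Proof.
have n0 : n%:Z != 0 by lia.
by rewrite [a + _]addrC divzMDl // addrC.
Qed.

Lemma le_divn (a b w : int) : (forall j : int, j * n%:Z <= a -> (j - w) * n%:Z <= b) ->
  (a %/ n%:Z)%Z <= (b %/ n%:Z)%Z + w.
Proof.
move=> h; rewrite -lerBlDr lez_divRL ?n_pos //; apply: h.
by rewrite -lez_divRL ?n_pos.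
Qed.

Lemma pot_shift (b w : int) : pot (b + w * n%:Z) = pot b + w * L%:Z.
Proof.
rewrite /pot; have -> : w * L%:Z = \sum_(t < L) w.
  by rewrite sumr_const card_ord -mulr_natr natz.
by rewrite -big_split; apply: eq_bigr => t _; rewrite /= -divn_shift; congr (_ %/ _)%Z; ring.
Qed.

(** Moving the window up one level trades a term for the one a period later, which is smaller by
    p. *)
Lemma sum_window (G : int -> int) (j : nat) : (forall t : int, G (t + L%:Z) = G t - p) ->
  \sum_(t < L) G (t%:Z + j%:Z) = \sum_(t < L) G t%:Z - j%:Z * p.
Proof.
move=> GL; elim: j => [|j IH].
  by rewrite mul0r subr0; apply: eq_bigr => t _; rewrite addr0.
suff -> : \sum_(t < L) G (t%:Z + j.+1%:Z) = \sum_(t < L) G (t%:Z + j%:Z) - p.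
  by rewrite IH -addn1 PoszD; ring.
case: L GL => [|L'] GL; last first.
  rewrite big_ord_recr /= [in RHS]big_ord_recl /=.
  have -> : L'%:Z + j.+1%:Z = 0%N%:Z + j%:Z + L'.+1%:Z by lia.
  rewrite GL addrA; congr (_ - _); rewrite addrC; congr (_ + _).
  by apply: eq_bigr => t _; congr G; rewrite /bump /=; lia.
by rewrite !big_ord0; have := GL 0; rewrite addr0; lia.
Qed.

(** Read the curve one level higher at f a, at the price p of [sum_window]: if a translate at level
    t + 1 is left of f a, then the same translate at level t is left of a. *)
Lemma pot_hollow (a : int) : pot (f a) <= pot a + p.
Proof.
pose G b (t : int) := ((b - 1 - y t) %/ n%:Z)%Z.
have GL b t : G b (t + L%:Z) = G b t - p.
  by rewrite /G y_per -divn_shift; congr (_ %/ _)%Z; ring.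
have := sum_window 1 (GL (f a)); rewrite mul1r => e.
have -> : pot (f a) = \sum_(t < L) G (f a) (t%:Z + 1%:Z) + p by rewrite e subrK.
rewrite lerD2r; apply: ler_sum => t _; rewrite -[X in _ <= X]addr0.
apply: le_divn => j h; rewrite subr0 in h *.
have : y t%:Z + j * n%:Z < a; last by lia.
have yt : f (y t%:Z) <= y (t%:Z + 1%:Z) by exact: y_curve.1.
by apply: f_lt_inv; rewrite f_shift; lia.
Qed.

Lemma pot_nose (a : int) (j : nat) : (j <= k)%N ->
  pot a + j%:Z * p <= pot (iter j f a + 1).
Proof.
move=> jk; pose G b (t : int) := ((b - 1 - y t) %/ n%:Z)%Z.
have GL b t : G b (t + L%:Z) = G b t - p.
  by rewrite /G y_per -divn_shift; congr (_ %/ _)%Z; ring.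
have e := sum_window j (GL (iter j f a + 1)).
have -> : pot (iter j f a + 1) = \sum_(t < L) G (iter j f a + 1) (t%:Z + j%:Z) + j%:Z * p.
  by rewrite e subrK.
rewrite lerD2r; apply: ler_sum => t _; rewrite -[X in _ <= X]addr0.
apply: le_divn => i h; rewrite subr0 in h *.
have := y_curve.2 t%:Z j jk.
have : iter j f (y t%:Z + 1 + i * n%:Z) <= iter j f a by apply: iter_mono; lia.
by rewrite iter_shift; lia.
Qed.
End Potential.

(* The constraints on the beginning points [u] of a k-multiplicative
   (c, l + 1)-CA model. *)
Definition feasible : Prop := exists (c l : int) (u : int -> int),
  [/\ 0 < l, forall a : int, u (a + n%:Z) = u a + c, forall a : int, u (f a) <= u a + l &
      forall (a : int) (j : nat), (j <= k)%N ->
        u a + j%:Z * l + 2 <= u (iter j f a + 1)].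

(** Both counts obey the constraints weakly, and [v] makes noses strict. [P z b] says that some copy
    of b, at some level, ties with (z, 0) in both counts and is strictly right of the orbit through
    z. Such z persist along tight edges. Along a tight nose the residue of the source is new:
    otherwise, the slopes being different, the source would be right of its own orbit. *)
Lemma strict_feasible (x y : int -> int) (L L' : nat) (p p' : int) :
  kcurve x -> (forall t : int, x (t + L%:Z) = x t + p * n%:Z) ->
  kcurve y -> (forall t : int, y (t + L'%:Z) = y t + p' * n%:Z) ->
  0 < p -> 0 < p' -> L'%:Z * p < L%:Z * p' -> feasible.
Proof.
move=> xc xp yc yp p0 p'0 strict.
pose U b := pot x L b + pot y L' b.
pose P (z : 'I_n) (b : int) : bool := `[< exists w e : int,
  [/\ pot x L (b + w * n%:Z) - e * p = pot x L z%:Z,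
      pot y L' (b + w * n%:Z) - e * p' = pot y L' z%:Z &
      right_of z%:Z 0 (b + w * n%:Z) e] >].
pose v b : int := #|[set z | P z b]|%:Z.
have P_shift z b w : P z (b + w * n%:Z) = P z b.
  apply/asboolP/asboolP => -[w' [e h]]; [exists (w + w')|exists (w' - w)]; exists e.
    by rewrite mulrDl addrA.
  by rewrite (_ : b + w * n%:Z + _ = b + w' * n%:Z) //; ring.
have v_le b : 0 <= v b <= n%:Z.
  by rewrite /v !lez_nat /= -[X in (_ <= X)%N]card_ord max_card.
(* As 0 <= v <= n, the weight n + 1 lets any change of [U] outweigh [v]; the factor 2 turns a strict
   increase into one by 2. *)
pose K : int := n%:Z + 1.
exists (2 * K * (L%:Z + L'%:Z)), (2 * K * (p + p')), (fun b => 2 * (K * U b + v b)).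
split.
- by apply: mulr_gt0; lia.
- move=> a; have an : a + n%:Z = a + 1 * n%:Z by rewrite mul1r.
  have -> : v (a + n%:Z) = v a.
    rewrite an.
    by rewrite /v; congr Posz; apply: eq_card => z; rewrite !inE P_shift.
  by rewrite /U an !pot_shift; ring.
- move=> a; have h1 := pot_hollow xc xp a; have h2 := pot_hollow yc yp a.
  have [e|d] : U (f a) = U a + (p + p') \/ U (f a) <= U a + (p + p') - 1.
    by rewrite /U; lia.
    have : v (f a) <= v a.
      rewrite /v lez_nat subset_leq_card //; apply/fintype.subsetP => z; rewrite !finset.in_set.
      move=> /asboolP[w [e' [k1 k2 k3]]]; apply/asboolP; exists w, (e' - 1).
      rewrite !pot_shift in k1 k2 *; split; rewrite ?mulrBl ?mul1r.
      + by move: e; rewrite /U; lia.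
      + by move: e; rewrite /U; lia.
      + by move: k3; rewrite -f_shift; apply: right_of_hollow.
    by rewrite e; lia.
  have := v_le a; have := v_le (f a).
  have : K * U (f a) <= K * (U a + (p + p') - 1) by apply: ler_wpM2l => //; lia.
  by rewrite /K; lia.
- move=> a j jk; have h1 := pot_nose xc xp a jk; have h2 := pot_nose yc yp a jk.
  set b := iter j f a + 1.
  have [e|d] : U b = U a + j%:Z * (p + p') \/ U a + j%:Z * (p + p') + 1 <= U b.
    by rewrite /U /b mulrDr; lia.
    have : v a < v b.
      rewrite /v ltz_nat; apply/proper_card/properP; split.
        apply/fintype.subsetP => z; rewrite !finset.in_set.
        move=> /asboolP[w [e' [k1 k2 k3]]]; apply/asboolP; exists w, (e' + j%:Z).
        rewrite !pot_shift in k1 k2 *; split; rewrite ?mulrDl.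
        + by move: e; rewrite /U /b mulrDr; lia.
        + by move: e; rewrite /U /b mulrDr; lia.
        + rewrite /b addrAC -iter_shift; exact: right_of_nose.
      have [w0 aw0] := ar_decomp n_gt0 a.
      exists (ar n_gt0 a); rewrite finset.in_set.
        apply/asboolP; exists (- w0), j%:Z.
        have aw : ((ar n_gt0 a : nat) : int) = a + - w0 * n%:Z by rewrite {2}aw0; ring.
        rewrite aw !pot_shift; split.
        + by move: e; rewrite /U /b mulrDr; lia.
        + by move: e; rewrite /U /b mulrDr; lia.
        + by rewrite /b addrAC -iter_shift -[j%:Z]add0r; exact: right_of_self.
      apply/asboolP => -[w [e' []]].
      set z : int := (ar n_gt0 a : nat) in aw0 *.
      have -> : a + w * n%:Z = z + (w0 + w) * n%:Z by rewrite {1}aw0; ring.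
      rewrite !pot_shift; set W := w0 + w => k1 k2.
      have k1' : W * L%:Z = e' * p by lia.
      have k2' : W * L'%:Z = e' * p' by lia.
      (* Eliminating e' from the two ties leaves W (L p' - L' p) = 0. *)
      have W0 : W = 0.
        have : W * (L%:Z * p' - L'%:Z * p) = 0.
          by rewrite mulrBr !mulrA k1' k2'; ring.
        by move/eqP; rewrite mulf_eq0 subr_eq0 => /orP[/eqP //|/eqP]; lia.
      have e0 : e' = 0.
        by move/eqP: k1'; rewrite W0 mul0r eq_sym mulf_eq0 => /orP[/eqP //|/eqP]; lia.
      rewrite W0 mul0r addr0 e0 => r.
      by apply: (@right_of_irr z 0 0) => //; rewrite addr0.
    by rewrite e; lia.
  have := v_le a; have := v_le b.
  have : K * (U a + j%:Z * (p + p') + 1) <= K * U b by apply: ler_wpM2l => //; lia.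
  by rewrite /K; lia.
Qed.

(** * Closed curves, slopes and detours of greedy nose paths *)

Lemma orbit_ex : exists (x : int -> int) (L : nat) (p : int),
  [/\ (0 < L)%N, 0 < p, forall t : int, x (t + 1) = f (x t) &
      forall t : int, x (t + L%:Z) = x t + p * n%:Z].
Proof.
(* The counter stays idle, so that [cycle_ex] and [curve_ex] also serve for orbits of [f]. *)
pose F (s : int * nat) := (f s.1, s.2).
have F_shs (w : int) (s : int * nat) : F (shs w s) = shs w (F s).
  by rewrite /F /shs /= f_shift.
have F_bound (s : int * nat) : (s.2 <= k)%N -> ((F s).2 <= k)%N by [].
have [i [L [p [L0 FL]]]] := cycle_ex (F := F) F_bound (leq0n k : (((0 : int), 0%N).2 <= k)%N).
have [Y [Y0 YS YL]] := curve_ex F_shs L0 FL.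
have xS t : (Y (t + 1)).1 = f (Y t).1 by rewrite YS.
exists (fun t => (Y t).1), L, p; split=> //; last by move=> t; rewrite YL.
have : (Y (0 + L%:Z)).1 = iter L f (Y 0).1.
  exact: (seq_iter (Y := fun t => (Y t).1) 0 L xS).
rewrite YL /= => e; have := iter_ge L (Y 0).1; rewrite -e.
case: (ltrP 0 p) => // p0; have : p * n%:Z <= 0 by rewrite mulr_le0_ge0; lia.
lia.
Qed.

Lemma phi_ex : exists (Y : int -> int * nat) (L : nat) (p : int),
  [/\ (0 < L)%N, 0 < p, forall t : int, Y (t + 1) = phi (Y t),
      forall t : int, Y (t + L%:Z) = shs p (Y t) & forall t : int, (1 <= (Y t).2 <= k)%N].
Proof.
have [i [L [p [L0 FL]]]] := cycle_ex phi_bound (leq0n k : (((0 : int), 0%N).2 <= k)%N).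
have [Y [Y0 YS YL]] := curve_ex phi_shs L0 FL.
exists Y, L, p; split=> // [|t].
  have := phi_gt L (Y 0); rewrite -(seq_iter 0 L YS).
  rewrite YL /=; case: (ltrP 0 p) => // p0.
  have : p * n%:Z <= 0 by rewrite mulr_le0_ge0; lia.
  lia.
apply/andP; split.
  rewrite -[t](subrK 1) YS /phi; case: eqP => //= _; case: ifP => //.
have base (j : nat) : ((Y (0 + j%:Z)%R).2 <= k)%N.
  rewrite (seq_iter _ _ YS) Y0 -iterD; apply: iter_bound => //; exact: phi_bound.
have per (m : nat) : (Y (t + m%:Z * L%:Z)).2 = (Y t).2.
  elim: m => [|m IH]; first by rewrite mul0r addr0.
  by rewrite -addn1 PoszD mulrDl mul1r addrA YL /= IH.
rewrite -(per (absz t)); set e := t + _.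
have -> : e = 0 + (absz e)%:Z; last exact: base.
have : (absz t)%:Z * 1 <= (absz t)%:Z * L%:Z by apply: ler_wpM2l; lia.
rewrite /e; lia.
Qed.

(** A monotone periodic curve stays at bounded distance from a line; both sides are multiplied by L
    to remain among the integers. *)
Lemma curve_growth (y : int -> int) (L : nat) (p : int) : (0 < L)%N -> 0 < p ->
  (forall t : int, y t <= y (t + 1)) -> (forall t : int, y (t + L%:Z) = y t + p * n%:Z) ->
  exists C : int, forall t : int,
    y t * L%:Z <= t * (p * n%:Z) + C /\ t * (p * n%:Z) - C <= y t * L%:Z.
Proof.
move=> L0 p0 ymono yL.
have yD (t : int) (j : nat) : y t <= y (t + j%:Z).
  elim: j => [|j IH]; first by rewrite addr0.
  by rewrite -addn1 PoszD addrA; apply: le_trans (ymono _).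
have yN (t : int) (m : nat) : y (t + m%:Z * L%:Z) = y t + m%:Z * (p * n%:Z).
  elim: m => [|m IH]; first by rewrite !mul0r !addr0.
  by rewrite -addn1 PoszD !mulrDl !mul1r !addrA yL IH.
have yZ (t : int) (w : int) : y (t + w * L%:Z) = y t + w * (p * n%:Z).
  case: w => m; first exact: yN.
  have := yN (t + Negz m * L%:Z) m.+1.
  by rewrite NegzE !mulNr -!addrA addNr addr0 => ->; rewrite -addrA subrr addr0.
pose C : int := `|y 0 * L%:Z| + `|y L%:Z * L%:Z| + L%:Z * (p * n%:Z).
exists C => t.
have L0' : L%:Z != 0 by lia.
have := divz_eq t L%:Z; have := ltz_mod t L0'; have := modz_ge0 t L0'.
set q := (t %/ _)%Z; set r := (t %% _)%Z => r0 rL e.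
have y1 : y 0 <= y r.
  by have := yD 0 (absz r); have -> : 0 + (absz r)%:Z = r by lia.
have y2 : y r <= y L%:Z.
  by have := yD r (absz (L%:Z - r)); have -> : r + (absz (L%:Z - r))%:Z = L%:Z by lia.
have -> : y t = y r + q * (p * n%:Z) by rewrite -yZ addrC -e.
rewrite e !mulrDl.
have -> : q * (p * n%:Z) * L%:Z = q * L%:Z * (p * n%:Z) by ring.
have pn0 : 0 < p * n%:Z by apply: mulr_gt0; lia.
have : 0 <= r * (p * n%:Z) by apply: mulr_ge0; lia.
have : r * (p * n%:Z) <= L%:Z * (p * n%:Z) by apply: ler_wpM2r; lia.
have : y r * L%:Z <= y L%:Z * L%:Z by apply: ler_wpM2r; lia.
have : y 0 * L%:Z <= y r * L%:Z by apply: ler_wpM2r; lia.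
by rewrite /C; lia.
Qed.

(** The comparisons of [rot_le] and [rot_ge] detached from a closed orbit, so that they transfer to
    any other fraction of the same value. *)
Definition slope (L : nat) (p : int) : Prop := [/\ (0 < L)%N, 0 < p,
  forall (b w : int) (i : nat), b + w * n%:Z <= iter i f b -> w * L%:Z <= i%:Z * p &
  forall (b w : int) (i : nat), iter i f b <= b + w * n%:Z -> i%:Z * p <= w * L%:Z].

Lemma slope_orbit (x : int -> int) (L : nat) (p : int) : (0 < L)%N -> 0 < p ->
  (forall t : int, x (t + 1) = f (x t)) -> (forall t : int, x (t + L%:Z) = x t + p * n%:Z) ->
  slope L p.
Proof.
move=> L0 p0 xS xL.
have r : rot L p.
  by exists (x 0); rewrite -xL (seq_iter _ _ xS).
by split=> // b w i; [exact: rot_le|exact: rot_ge].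
Qed.

Lemma slope_eq (L L' : nat) (p p' : int) : slope L p -> (0 < L')%N -> 0 < p' ->
  L%:Z * p' = L'%:Z * p -> slope L' p'.
Proof.
move=> [L0 p0 s1 s2] L'0 p'0 e; split=> // b w i h.
  have := s1 _ _ _ h; rewrite -(ler_pM2r p'0) -(ler_pM2r p0 (w * _)).
  by rewrite -[w * _ * p']mulrA e mulrA [i%:Z * p * p']mulrAC.
have := s2 _ _ _ h; rewrite -(ler_pM2r p'0) -(ler_pM2r p0 _ (w * _)).
by rewrite -[w * _ * p']mulrA e mulrA [i%:Z * p * p']mulrAC.
Qed.

(* [nhits b] says that the greedy nose path from [b] follows the longest nose
   leaving [b], possibly after a detour through lower levels. *)
Definition nhits (b : int) : Prop := exists i, iter i nstep (b, 0) = mstep (b, 0).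

Lemma nhits_level (b t : int) : nhits b -> exists i, iter i nstep (b, t) = mstep (b, t).
Proof.
move=> [i e]; exists i.
have -> : (b, t) = sh 0 t (b, 0) by rewrite /sh /= mul0r addr0 add0r.
by rewrite iter_sh ?e ?mstep_sh //; exact: nstep_sh.
Qed.

(** At b the greedy path takes the hollow to [g b], the first point of the fibre over b. If every
    point of the fibre hits, the path advances through it by noses of index 0 up to the last point
    e. The nose from e has index one more than that from b, which makes up for the level lost by the
    hollow, and ends at the same point. *)
Lemma not_nhits (b : int) : ~ nhits b ->
  ~~ has_nose b /\ exists y, f y = b /\ ~ nhits y.
Proof.
move=> nb; have hb : ~~ has_nose b.
  by apply/negP => hb; apply: nb; exists 1%N; rewrite /= /nstep /= hb.
split=> //; apply: contrapT => all_hit.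
have {all_hit} hit y : f y = b -> nhits y.
  by move=> fy; apply: contrapT => ny; apply: all_hit; exists y.
apply: nb; move: (hb); rewrite negb_or negbK => /andP[nk im].
have fg := f_gK im.
pose e := g (b + 1) - 1.
have ge : g b <= e by have : g b < g (b + 1); [rewrite -lt_f fg|rewrite /e]; lia.
have fe y : g b <= y -> y <= e -> f y = b.
  by rewrite -le_f => y1 y2; have : f y < b + 1; [rewrite lt_f; move: y2; rewrite /e|]; lia.
have te : top e by rewrite /top fe // /e subrK; have := f_g (b + 1); lia.
have walk (j : nat) : (j <= absz (e - g b))%N ->
    exists i, iter i nstep (b, 0) = (g b + j%:Z, -1).
  elim: j => [_|j IH je].
    by exists 1%N; rewrite /= /nstep /= (negPf hb) addr0.
  have [i ei] := IH (ltnW je).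
  have y1 : f (g b + j%:Z) = b by apply: fe; lia.
  have y2 : f (g b + j%:Z + 1) = b by apply: fe; lia.
  have [i' ei'] := nhits_level (-1) (hit _ y1).
  exists (i' + i)%N; rewrite iterD ei ei' /mstep /mnose /=.
  have -> : nidx k (g b + j%:Z) = 0%N.
    by case: (k) => //= k'; rewrite /top y1 y2 ltxx.
  by rewrite /= addr0 -addn1 PoszD addrA.
have [i] := walk _ (leqnn _).
have -> : g b + (absz (e - g b))%:Z = e by lia.
have [i' ei'] := nhits_level (-1) (hit e (fe _ ge (lexx _))).
move=> ei; exists (i' + i)%N; rewrite iterD ei ei' /mstep /mnose /=.
have -> : nidx k e = (nidx k b).+1.
  apply/esym/nidx_uniq; first by have := nidx_le k b; lia.
    by apply: topsS => //; rewrite fe //; exact: nidx_tops.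
  by apply/implyP => _; rewrite iterSr fe //; apply: nidx_ntop; have := nidx_le k b; lia.
by rewrite iterSr fe //; congr pair; lia.
Qed.

Lemma not_nhits_chain (b : int) (m : nat) : ~ nhits b -> exists y,
  iter m f y = b /\ forall s, (s <= m)%N -> ~ nhits (iter s f y) /\ ~~ has_nose (iter s f y).
Proof.
move=> nb; elim: m => [|m [y [yb h]]].
  by exists b; split=> // s; rewrite leqn0 => /eqP ->; split=> //; case: (not_nhits nb).
have [_ [z [fz nz]]] := not_nhits (h 0%N isT).1.
exists z; split=> [|[|s] sm]; first by rewrite iterSr fz.
  by split=> //; case: (not_nhits nz).
by rewrite iterSr fz; apply: h.
Qed.

Definition periodic (b : int) : Prop :=
  exists (q : nat) (w : int), (0 < q)%N /\ iter q f b = b + w * n%:Z.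

Lemma periodic_iter (j : nat) (b : int) : periodic b -> periodic (iter j f b).
Proof.
move=> [q [w [q0 e]]]; exists q, w; split=> //.
by rewrite -iterD addnC iterD e iter_shift.
Qed.

Lemma orbit_periodic (b : int) : exists j, periodic (iter j f b).
Proof.
pose h (i : 'I_n.+1) : 'I_n := ar n_gt0 (iter i f b).
have /injectivePn[i [j ij hij]] : ~~ injectiveb h.
  by apply/negP => /injectiveP /leq_card; rewrite !card_ord ltnn.
wlog lij : i j ij hij / (i < j)%N => [th|].
  have [|ji|e] := ltngtP i j; first exact: th.
    by apply: (th j i) => //; rewrite eq_sym.
  by rewrite (val_inj e) eqxx in ij.
move/eqP: hij => /ar_eqP[w e].
exists i, (j - i)%N, w; rewrite subn_gt0 lij; split=> //.
by rewrite -iterD subnK 1?ltnW.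
Qed.

(** Among n + 1 successive points of a backward orbit two agree modulo n, so b, an iterate of the
    first of them, is periodic. *)
Lemma not_nhits_periodic (b : int) : ~ nhits b -> periodic b.
Proof.
move=> nb; have [y [yb _]] := not_nhits_chain n nb.
pose h (i : 'I_n.+1) : 'I_n := ar n_gt0 (iter i f y).
have /injectivePn[i [j ij hij]] : ~~ injectiveb h.
  by apply/negP => /injectiveP /leq_card; rewrite !card_ord ltnn.
wlog lij : i j ij hij / (i < j)%N => [th|].
  have [|ji|e] := ltngtP i j; first exact: th.
    by apply: (th j i) => //; rewrite eq_sym.
  by rewrite (val_inj e) eqxx in ij.
move/eqP: hij => /ar_eqP[w e].
rewrite -yb -(subnK (leq_ord i)) iterD; apply: periodic_iter.
exists (j - i)%N, w; rewrite subn_gt0 lij; split=> //.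
by rewrite -iterD subnK 1?ltnW.
Qed.

(** A deficit of f^L b against b + p n would persist under iteration. But [slope] forces w L = q p
    on the closed orbit of b, so f^(q L) b shows no deficit. *)
Lemma periodic_not_right (L : nat) (p : int) (q : int * int) : slope L p ->
  periodic q.1 -> ~~ right q (sh p L%:Z q).
Proof.
case: q => b t [L0 p0 s1 s2] [q [w [q0 e]]]; rewrite /right /sh /= right_of_up.
apply/negP => fb.
have lt (m : nat) : iter (m.+1 * L) f b < b + m.+1%:Z * p * n%:Z.
  elim: m => [|m IH]; first by rewrite mul1n mul1r.
  rewrite mulSn iterD; apply: le_lt_trans (iter_mono L (ltW IH)) _.
  by rewrite iter_shift -[m.+2]addn1 PoszD; lia.
have e1 : w * L%:Z <= q%:Z * p by apply: (s1 b); rewrite e.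
have e2 : q%:Z * p <= w * L%:Z by apply: (s2 b); rewrite e.
have := iter_mul L e; rewrite mulnC; have := lt q.-1; rewrite prednK // => h1 h2.
have : L%:Z * w = q%:Z * p by lia.
by move=> h; rewrite h2 h ltxx in h1.
Qed.

(** By [strict_feasible] the orbit is not slower than the curve of [phi], and it is not faster
    because [phi] dominates [f]. *)
Lemma infeasible_curves : ~ feasible ->
  exists (x : int -> int) (Lx : nat) (px : int) (Y : int -> int * nat) (L : nat) (p : int),
  [/\ slope Lx px, slope L p, px * L%:Z = p * Lx%:Z &
   [/\ forall t : int, x (t + 1) = f (x t), forall t : int, x (t + Lx%:Z) = x t + px * n%:Z,
      forall t : int, Y (t + 1) = phi (Y t), forall t : int, Y (t + L%:Z) = shs p (Y t) &
      forall t : int, (1 <= (Y t).2 <= k)%N]].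
Proof.
move=> nF; have [x [Lx [px [Lx0 px0 xS xL]]]] := orbit_ex.
have [Y [L [p [L0 p0 YS YL Yk]]]] := phi_ex.
have sx := slope_orbit Lx0 px0 xS xL.
have Yk' t : ((Y t).2 <= k)%N by case/andP: (Yk t).
have le : Lx%:Z * p <= L%:Z * px.
  rewrite leNgt; apply/negP => lt; apply: nF.
  apply: (strict_feasible (orbit_curve xS) xL (phi_curve YS Yk') _ px0 p0 lt).
  by move=> t; rewrite YL.
have ge : L%:Z * px <= Lx%:Z * p.
  have [_ _ _ s2] := sx; rewrite [Lx%:Z * p]mulrC; apply: (s2 (Y 0).1).
  have -> : (Y 0).1 + p * n%:Z = (Y (0 + L%:Z)).1 by rewrite YL.
  rewrite (seq_iter _ _ YS); elim: (L) => //= j IH.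
  by apply: le_trans (f_le_phi _); apply: f_mono.
have e : Lx%:Z * p = L%:Z * px by lia.
exists x, Lx, px, Y, L, p; split=> //; first exact: slope_eq sx L0 p0 e.
by rewrite mulrC -e mulrC.
Qed.

(** * Infeasible maps *)

Section Infeasible.
Variables (Y : int -> int * nat) (L : nat) (p : int).
Hypothesis Lp : slope L p.
Hypothesis YS : forall t : int, Y (t + 1) = phi (Y t).
Hypothesis YL : forall t : int, Y (t + L%:Z) = shs p (Y t).
Hypothesis Yk : forall t : int, (1 <= (Y t).2 <= k)%N.

(** The levels at which the curve is about to gain a step: it goes on at f (z + 1) with the counter
    reset to 1. *)
Definition landing (t : int) : bool := ((Y t).2 == k) || ~~ top (Y t).1.
Definition lpoint (t : int) : int * int := ((Y t).1 + 1, t).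

Lemma landing_phi (t : int) : landing t -> Y (t + 1) = (f ((Y t).1 + 1), 1%N).
Proof.
rewrite /landing YS /phi; case: eqP => //= _ nt.
by rewrite (negPf nt) ntop.
Qed.

(** Noses of index 0 walk through the fibre over c = f (z + 1) up to its last point e. The nose from
    e then runs along the curve, as Y (t + s) is at f^s e, and stops one step right of it where the
    curve is next ready to gain. *)
Lemma landing_next (t : int) : landing t -> exists (m i : nat),
  [/\ (0 < m)%N, landing (t + m%:Z),
      forall s : nat, (0 < s < m)%N -> ~~ landing (t + s%:Z),
      (0 < i)%N & iter i mstep (lpoint t) = lpoint (t + m%:Z)].
Proof.
move=> lt; set z := (Y t).1; set c := f (z + 1).
pose e := g (c + 1) - 1.
have ze : z + 1 <= e by have : z + 1 < g (c + 1); [rewrite -lt_f|rewrite /e]; lia.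
have fe (y : int) : z + 1 <= y -> y <= e -> f y = c.
  move=> y1 y2; have := f_mono y1.
  by have : f y < c + 1; [rewrite lt_f; move: y2; rewrite /e|rewrite -/c]; lia.
have te : top e by rewrite /top fe // /e subrK; have := f_g (c + 1); lia.
have walk (j : nat) : (j <= absz (e - (z + 1))%R)%N ->
    iter j mstep (lpoint t) = (z + 1 + j%:Z, t).
  elim: j => [_|j IH je]; first by rewrite addr0.
  rewrite iterS IH; last exact: ltnW.
  have y1 : f (z + 1 + j%:Z) = c by apply: fe; lia.
  have y2 : f (z + 1 + j%:Z + 1) = c by apply: fe; lia.
  rewrite /mstep /mnose /=; have -> : nidx k (z + 1 + j%:Z) = 0%N.
    by case: (k) => //= k'; rewrite /top y1 y2 ltxx.
  by rewrite /=; congr pair; lia.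
have := walk _ (leqnn _); have -> : z + 1 + (absz (e - (z + 1))%R)%:Z = e by lia.
set m := nidx k e; set j := absz _ => we.
have m0 : (0 < m)%N by rewrite /m; case: (k) k_gt0 => //= k' _; rewrite te.
have Ym (s : nat) : (0 < s <= m)%N -> Y (t + s%:Z) = (iter s f e, s).
  elim: s => // -[|s] IH /andP[_ sm]; first by rewrite landing_phi //= -/z -/c fe.
  rewrite -[s.+2]addn1 PoszD addrA YS IH; last by rewrite /= ltnW.
  rewrite /phi /=; case: eqP => [sk|_].
    by have := nidx_le k e; rewrite -/m; lia.
  by rewrite (nidx_tops (j := k) sm) !addn1.
exists m, j.+1; split=> //.
- rewrite /landing Ym ?m0 ?leqnn //=; case: eqP => //= mk.
  by apply: nidx_ntop; have := nidx_le k e; rewrite -/m; lia.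
- move=> s /andP[s0 sm]; rewrite /landing Ym ?s0 ?(ltnW sm) //= negb_or negbK.
  rewrite (nidx_tops (j := k) sm) andbT; apply/eqP => sk.
  by have := nidx_le k e; rewrite -/m; lia.
- by rewrite iterS we /mstep /mnose -/m /lpoint Ym ?m0 ?leqnn.
Qed.

Lemma landing_path (t : int) (d : nat) : landing t -> landing (t + d%:Z) ->
  exists i, ((0 < d) ==> (0 < i))%N /\ iter i mstep (lpoint t) = lpoint (t + d%:Z).
Proof.
elim/ltn_ind: d t => -[|d] IH t lt ld; first by exists 0%N; rewrite addr0.
have [m [i [m0 lm nm i0 ei]]] := landing_next lt.
have md : (m <= d.+1)%N.
  by rewrite leqNgt; apply/negP => h; have /negP := nm d.+1 h; apply.
have e : t + d.+1%:Z = t + m%:Z + (d.+1 - m)%N%:Z by lia.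
have dm : (d.+1 - m < d.+1)%N by lia.
have [|i' [_ ei']] := IH _ dm (t + m%:Z) lm; first by rewrite -e.
by exists (i' + i)%N; rewrite iterD ei ei' -e; split=> //; lia.
Qed.

Lemma landing_ex (t : int) : exists m : nat, landing (t + m%:Z).
Proof.
have [j] := ubnP (k - (Y t).2)%N; elim: j t => // j IH t; rewrite ltnS => jk.
have [lt|nl] := boolP (landing t); first by exists 0%N; rewrite addr0.
move: (nl); rewrite /landing negb_or negbK => /andP[nk tp].
have [|m lm] := IH (t + 1).
  rewrite YS /phi (negPf nk) tp /=.
  by have := Yk t; lia.
by exists m.+1; rewrite -addn1 PoszD [m%:Z + _]addrC addrA.
Qed.

Lemma landing_per (t : int) : landing (t + L%:Z) = landing t.
Proof. by rewrite /landing YL /= top_shift. Qed.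

Lemma lpoint_per (t : int) : lpoint (t + L%:Z) = sh p L%:Z (lpoint t).
Proof. by rewrite /lpoint YL /sh /=; congr pair; lia. Qed.

(* A greedy path that closes up along the slope of f meets no periodic point. *)
Lemma landing_nhits (t : int) (j : nat) : landing t -> nhits (iter j mstep (lpoint t)).1.
Proof.
move=> lt; have lL : landing (t + L%:Z) by rewrite landing_per.
have [i [i0 ei]] := landing_path lt lL; have [L0 _ _ _] := Lp.
rewrite L0 /= in i0; set q := iter j mstep (lpoint t).
have eq : iter i mstep q = sh p L%:Z q.
  rewrite /q -iterD addnC iterD ei lpoint_per iter_sh //; exact: mstep_sh.
apply: contrapT => /not_nhits_periodic /(periodic_not_right Lp) /negP; apply.
rewrite -eq -(prednK i0) iterSr; apply: right_iter; first exact: right_mstep.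
exact: right_mstep_self.
Qed.

Lemma landing_nstep (t : int) (j : nat) : landing t ->
  exists i, ((0 < j) ==> (0 < i))%N /\ iter i nstep (lpoint t) = iter j mstep (lpoint t).
Proof.
move=> lt; elim: j => [|j [i [_ ei]]]; first by exists 0%N.
have := landing_nhits j lt => /nhits_level hit.
have [i' ei'] := hit (iter j mstep (lpoint t)).2.
exists (i' + i)%N; rewrite iterD ei; move: ei'.
rewrite -surjective_pairing => ei'; split=> //.
rewrite addn_gt0; case: (posnP i') => // i'0; exfalso.
by move: ei'; rewrite i'0 /= => /(congr1 fst) /=; have := mnose_gt (iter j mstep (lpoint t)).1; lia.
Qed.

Lemma landing_nstep_next (t : int) : landing t -> exists (m i : nat),
  [/\ (0 < i)%N, landing (t + m%:Z) & iter i nstep (lpoint t) = lpoint (t + m%:Z)].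
Proof.
move=> lt; have [m [j [m0 lm _ j0 ej]]] := landing_next lt.
have [i [i0 ei]] := landing_nstep j lt; rewrite j0 in i0.
by exists m, i; split=> //; rewrite ei.
Qed.

Lemma nstep_up : exists (q : int * int) (i : nat),
  [/\ (0 < i)%N, iter i nstep q = sh p L%:Z q &
      forall j : nat, has_nose (iter j nstep q).1 -> ~ periodic (iter j nstep q).1].
Proof.
have [m lm] := landing_ex 0; set t := 0 + m%:Z in lm.
have lL : landing (t + L%:Z) by rewrite landing_per.
have [j [j0 ej]] := landing_path lm lL; have [L0 _ _ _] := Lp.
rewrite L0 /= in j0; have [i [i0 ei]] := landing_nstep j lm; rewrite j0 /= in i0.
have e : iter i nstep (lpoint t) = sh p L%:Z (lpoint t) by rewrite ei ej lpoint_per.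
exists (lpoint t), i; split=> // s hn per.
have /negP := periodic_not_right Lp per; apply.
have <- : iter i nstep (iter s nstep (lpoint t)) = sh p L%:Z (iter s nstep (lpoint t)).
  by rewrite -iterD addnC iterD e iter_sh //; exact: nstep_sh.
rewrite -(prednK i0) iterSr; apply: right_iter; first exact: right_nstep.
by rewrite /nstep hn; exact: right_mstep_self.
Qed.

Definition left_of (q : int * int) : Prop := q.1 <= (Y q.2).1.
Definition on_landing (q : int * int) : Prop := exists2 t, landing t & q = lpoint t.

Lemma Y_ge_iter (t : int) (j : nat) : iter j f (Y t).1 <= (Y (t + j%:Z)).1.
Proof.
rewrite (seq_iter _ _ YS); elim: j => //= j IH.
by apply: le_trans (f_le_phi _); apply: f_mono.
Qed.

(** The counter triggers a gain within k levels, and the step won is kept because the orbit of [f]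
    consists of last points of fibres. *)
Lemma Y_jump (t : int) : tops k (Y t).1 -> iter k f (Y t).1 < (Y (t + k%:Z)).1.
Proof.
move=> tk; set z := (Y t).1; set c := (Y t).2.
have /andP[c1 ck] : (1 <= c <= k)%N by exact: Yk.
have Yj (j : nat) : (j + c <= k)%N -> Y (t + j%:Z) = (iter j f z, (j + c)%N).
  elim: j => [|j IH] jc; first by rewrite addr0 /z /c add0n -surjective_pairing.
  rewrite -addn1 PoszD addrA YS IH; last by lia.
  rewrite /phi /=; case: eqP => [|_]; first by lia.
  by rewrite tk; [rewrite addn1 addSn|lia].
have jump : iter (k - c).+1 f z < (Y (t + (k - c).+1%:Z)).1.
  rewrite -[(k - c).+1]addn1 PoszD addrA YS Yj; last by lia.
  rewrite subnK // /phi /= eqxx /= addn1 /=; apply: tk; lia.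
have later (j : nat) : (j + (k - c).+1 <= k)%N ->
    iter (j + (k - c).+1) f z < (Y (t + (j + (k - c).+1)%N%:Z)).1.
  elim: j => [|j IH] jk //; rewrite addSn -[(_ + _).+1]addn1 PoszD addrA YS addn1 /=.
  apply: lt_le_trans (f_le_phi _); apply: lt_le_trans (f_mono (_ : iter (j + (k - c).+1) f z + 1 <= _)).
    by apply: tk; lia.
  by rewrite lezD1; apply: IH; lia.
have := later (c - 1)%N; have -> : (c - 1 + (k - c).+1)%N = k by lia.
by apply.
Qed.

(** Points of the curve lie in the image of [f], so a nose surviving there has index k and [Y_jump]
    applies; noses from further left are handled by [tops_lt]. A hollow starting on the curve right
    after a gain may end one step right of it, but only at a landing point. *)
Lemma left_nstep (q : int * int) : left_of q -> left_of (nstep q) \/ on_landing (nstep q).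
Proof.
case: q => b t; rewrite /left_of /nstep /= => bt.
have YT : Y t = phi (Y (t - 1)) by rewrite -YS subrK.
case: ifP => [hn|hn] /=.
  left; rewrite /mnose; set m := nidx k b.
  have tm : tops m b by exact: nidx_tops.
  have [lt|ge] := ltP b (Y t).1.
    by have := tops_lt tm lt; have := Y_ge_iter t m; lia.
  have e : b = (Y t).1 by lia.
  have im : inim b by rewrite e YT phi_inim.
  have mk : m = k by move: hn; rewrite /has_nose im orbF => /eqP.
  by have := @Y_jump t; rewrite -e -mk => /(_ tm); lia.
have im : inim b by move: hn; rewrite /has_nose; case: (inim b); rewrite ?orbT.
move: bt; rewrite YT /phi; case: eqP => /= [ck|_].
  rewrite le_eqVlt => /orP[/eqP be|lt]; last first.
    by left; rewrite -ltzD1; apply: f_lt_inv; rewrite f_gK.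
  have [gb|gb] := ltP (g b) ((Y (t - 1)).1 + 1); first by left; lia.
  right; exists (t - 1); first by rewrite /landing ck eqxx.
  rewrite /lpoint; congr pair; apply/eqP; rewrite eq_le gb andbT -le_f be //.
by move=> h; left; rewrite -le_f; move: h; case: ifP.
Qed.

Lemma left_often (q : int * int) (m : nat) : left_of q -> exists i,
  (m <= i)%N /\ (iter i nstep q).1 <= (Y (iter i nstep q).2).1 + 1.
Proof.
move=> lq; suff [i [mi [h|[t _ h]]]] : exists i, (m <= i)%N /\
    (left_of (iter i nstep q) \/ on_landing (iter i nstep q)).
- by exists i; split=> //; move: h; rewrite /left_of; lia.
- by exists i; split=> //; rewrite h.
elim: m => [|m [i [mi [h|[t lt h]]]]]; first by exists 0%N; split=> //; left.
  by exists i.+1; split=> //; apply: left_nstep.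
have [d [j [j0 ld ej]]] := landing_nstep_next lt.
exists (j + i)%N; split; first by lia.
by right; exists (t + d%:Z) => //; rewrite iterD h.
Qed.

Lemma bounded_range (F : nat -> int) (s : nat) : exists C : int,
  forall r, (r < s)%N -> `|F r| <= C.
Proof.
elim: s => [|s [C h]]; first by exists 0.
exists (`|C| + `|F s|) => r; rewrite ltnS leq_eqVlt => /orP[/eqP ->|/h]; lia.
Qed.

(** By [left_often] the path keeps returning to at most one step right of the curve. A closed path
    with displacement right of the slope would leave the curve behind; [D] collects the bounded
    errors. *)
Lemma nstep_cycle_slope (q : int * int) (s : nat) (w e : int) : (0 < s)%N ->
  iter s nstep q = sh w e q -> w * L%:Z <= e * p.
Proof.
move=> s0 qs; have [L0 p0 _ _] := Lp.
wlog lq : q qs / left_of q => [th|].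
  have [j /andP[_ j2]] := window (Y q.2).1 q.1.
  apply: (th (sh (- (j + 1)) 0 q)).
    by rewrite iter_sh ?qs ?sh_add 1?addrC ?[0 + _]addrC //; exact: nstep_sh.
  by rewrite /left_of /sh /= addr0 mulNr mulrDl; lia.
have Y1 t : (Y t).1 <= (Y (t + 1)).1.
  by rewrite YS; have := phi_gt 1 (Y t); rewrite /=; lia.
have [|C hC] := @curve_growth (fun t => (Y t).1) L p L0 p0 Y1; first by move=> t; rewrite YL.
have [C1 hC1] := bounded_range (fun r => (iter r nstep q).1 * L%:Z) s.
have [C2 hC2] := bounded_range (fun r => (iter r nstep q).2 * (p * n%:Z)) s.
rewrite leNgt; apply/negP => lt.
pose D := `|C| + `|C1| + `|C2| + L%:Z + 1.
have [i [iD hi]] := left_often ((absz D).+1 * s) lq.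
move: hi; rewrite (divn_eq i s) addnC iterD (iter_cycle nstep_sh _ qs) iter_sh; last exact: nstep_sh.
set a := (i %/ s)%N; set r := (i %% s)%N; rewrite /sh /=.
have rs : (r < s)%N by rewrite ltn_mod.
have aD : (absz D < a)%N by rewrite /a leq_divRL.
have := hC1 r rs; have := hC2 r rs; set b := iter r nstep q => h2 h1 h.
have [h3 _] := hC (b.2 + a%:Z * e).
have h4 : (b.1 + a%:Z * w * n%:Z) * L%:Z <= ((Y (b.2 + a%:Z * e)).1 + 1) * L%:Z.
  by apply: ler_wpM2r; lia.
have : a%:Z * n%:Z * (w * L%:Z - e * p) <= D - 1.
  have -> : a%:Z * n%:Z * (w * L%:Z - e * p) =
    (b.1 + a%:Z * w * n%:Z) * L%:Z - b.1 * L%:Z - (b.2 + a%:Z * e) * (p * n%:Z) + b.2 * (p * n%:Z) by ring.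
  rewrite /D; rewrite [X in _ <= X]mulrDl mul1r in h4; lia.
have : a%:Z * 1 <= a%:Z * n%:Z * (w * L%:Z - e * p).
  rewrite -mulrA; apply: ler_wpM2l => //.
  by rewrite -[1]mulr1; apply: ler_pM; lia.
lia.
Qed.
End Infeasible.

(** A greedy hollow path takes noses only outside the image of [f], hence strictly left of the orbit
    x, where [tops_lt] keeps their ends left of x. *)
Lemma left_hstep (x : int -> int) (q : int * int) :
  (forall t : int, x (t + 1) = f (x t)) -> q.1 <= x q.2 -> (hstep q).1 <= x (hstep q).2.
Proof.
case: q => b t xS; rewrite /hstep /= => bx.
have xt : x t = f (x (t - 1)) by rewrite -xS subrK.
case: ifP => /= im; first by rewrite -le_f -xt.
have {bx} lt : b < x t.
  rewrite lt_neqAle bx andbT; apply/eqP => e.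
  by rewrite e xt inim_f in im.
have := tops_lt (nidx_tops (j := k) (a := b)) lt.
by rewrite /mnose (seq_iter _ _ xS); lia.
Qed.

Lemma hstep_cycle_slope (x : int -> int) (L : nat) (p : int) (q : int * int) (s : nat) (w e : int) :
  slope L p -> (forall t : int, x (t + 1) = f (x t)) ->
  (forall t : int, x (t + L%:Z) = x t + p * n%:Z) ->
  iter s hstep q = sh w e q -> w * L%:Z <= e * p.
Proof.
move=> [L0 p0 _ _] xS xL qs.
wlog lq : q qs / q.1 <= x q.2 => [th|].
  have [j /andP[_ j2]] := window (x q.2) q.1.
  apply: (th (sh (- (j + 1)) 0 q)).
    by rewrite iter_sh ?qs ?sh_add 1?addrC ?[0 + _]addrC //; exact: hstep_sh.
  by rewrite /sh /= addr0 mulNr mulrDl; lia.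
have x1 t : x t <= x (t + 1) by rewrite xS; have := f_gt (x t); lia.
have [C hC] := curve_growth L0 p0 x1 xL.
rewrite leNgt; apply/negP => lt.
pose D := `|C| + `|q.1 * L%:Z| + `|q.2 * (p * n%:Z)| + 1.
have lA a : (iter a hstep q).1 <= x (iter a hstep q).2.
  by elim: a => //= a; apply: left_hstep.
set a := (absz D).+1.
have := lA (a * s)%N; rewrite (iter_cycle hstep_sh _ qs) /sh /= => h.
have [h3 _] := hC (q.2 + a%:Z * e).
have h4 : (q.1 + a%:Z * w * n%:Z) * L%:Z <= x (q.2 + a%:Z * e) * L%:Z.
  by apply: ler_wpM2r; lia.
have : a%:Z * n%:Z * (w * L%:Z - e * p) <= D - 1.
  have -> : a%:Z * n%:Z * (w * L%:Z - e * p) =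
    (q.1 + a%:Z * w * n%:Z) * L%:Z - q.1 * L%:Z - (q.2 + a%:Z * e) * (p * n%:Z) + q.2 * (p * n%:Z) by ring.
  rewrite /D; lia.
have : a%:Z * 1 <= a%:Z * n%:Z * (w * L%:Z - e * p).
  rewrite -mulrA; apply: ler_wpM2l => //.
  by rewrite -[1]mulr1; apply: ler_pM; lia.
rewrite /a; lia.
Qed.

(** If w' e >= w e', then w' rounds of the first cycle and w rounds of the second return to the same
    column at a level not lower. Yet everything after a nose stays strictly right of the orbit
    through its source. *)
Lemma no_shared_cycle (q : int * int) (s s' : nat) (w e w' e' : int) :
  0 < w -> 0 < w' -> iter s nstep q = sh w e q ->
  iter s' hstep q = sh (- w') (- e') q -> w' * e < w * e'.
Proof.
move=> w0 w'0 qs qs'; rewrite ltNge; apply/negP => le.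
have [i hi] : exists i, has_nose (iter i nstep q).1.
  apply: contrapT => no.
  have : (iter s nstep q).1 <= q.1.
    elim: (s) => //= i IH; apply: le_trans IH.
    rewrite {1}/nstep; case: ifP => [h|_]; first by case: no; exists i.
    by rewrite /=; have := g_lt (iter i nstep q).1; lia.
  rewrite qs /sh /=; have : 0 < w * n%:Z by apply: mulr_gt0; lia.
  lia.
set a := iter i nstep q in hi.
have ra : right a (nstep a) by rewrite /nstep hi; exact: right_mstep_self.
have h (j : nat) b : right a b -> right a (iter j nstep b).
  by apply: right_iter; exact: right_nstep.
have h' (j : nat) b : right a b -> right a (iter j hstep b).
  by apply: right_iter; exact: right_hstep.
have s0 : (0 < s)%N.
  case: (s) qs => // /(congr1 fst) /= /esym /eqP; rewrite -subr_eq0 addrAC subrr add0r.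
  by rewrite mulf_eq0 => /orP[/eqP|/eqP]; lia.
(* The factor i + 1 makes the first stretch go past the nose found at step i. *)
pose M := (absz w' * (i.+1 * s))%N.
have w'E : (absz w')%:Z = w' by lia.
have wE : (absz w)%:Z = w by lia.
have i1 : (i.+1 <= i.+1 * s)%N by rewrite leq_pmulr.
have i2 : (i.+1 <= M)%N by rewrite /M; apply: leq_trans i1 _; rewrite leq_pmull; lia.
have r1 : right a (iter M nstep q).
  rewrite -(subnK i2) iterD iterS -/a; exact: h.
have r2 : right a (iter ((i.+1 * absz w) * s') hstep (iter M nstep q)) by exact: h'.
have r3 := h i _ r2; move: r3.
rewrite /M mulnA (iter_cycle nstep_sh _ qs) iter_sh; last exact: hstep_sh.
rewrite (iter_cycle hstep_sh _ qs') sh_add iter_sh; last exact: nstep_sh.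
rewrite -/a !PoszM w'E wE.
have -> : w' * i.+1%:Z * w + i.+1%:Z * w * - w' = 0 by ring.
have -> : w' * i.+1%:Z * e + i.+1%:Z * w * - e' = i.+1%:Z * (w' * e - w * e') by ring.
rewrite /right /sh /= mul0r addr0; apply: right_of_irr; apply: mulr_ge0; lia.
Qed.

(** The cycle condition on the cover: a closed greedy path that gains w turns projects to a cycle
    whose ext has the sign of -w. *)
Definition shared_cycles : Prop := exists (b : int) (s s' : nat) (w w' e e' : int),
  [/\ [/\ (0 < s)%N, 0 < w & iter s nstep (b, 0) = sh w e (b, 0)] &
      [/\ (0 < s')%N, w' < 0 & iter s' hstep (b, 0) = sh w' e' (b, 0)]].

(** Both displacements lie on the same side of the slope p / L; with w > 0 > w' this contradicts
    [no_shared_cycle]. *)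
Lemma infeasible_not_shared : ~ feasible -> ~ shared_cycles.
Proof.
move=> nF [b [s [s' [w [w' [e [e' [[s0 w0 h] [s'0 w'0 h']]]]]]]]].
have [x [Lx [px [Y [L [p [slx sl eqs [xS xL YS YL Yk]]]]]]]] := infeasible_curves nF.
have h1 := nstep_cycle_slope sl YS YL Yk s0 h.
have h2 := hstep_cycle_slope slx xS xL h'.
have h3 : (- w') * e < w * (- e').
  apply: no_shared_cycle w0 _ h _; first by lia.
  by rewrite !opprK; exact: h'.
have [L0 p0 _ _] := sl; have [Lx0 px0 _ _] := slx.
have h2' : w' * L%:Z <= e' * p.
  rewrite -(ler_pM2r px0) -(ler_pM2r (_ : 0 < Lx%:Z)); last by lia.
  have : w' * Lx%:Z * (L%:Z * px) <= e' * px * (L%:Z * px).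
    by apply: ler_wpM2r => //; apply: mulr_ge0; lia.
  have -> : e' * px * (L%:Z * px) = e' * px * (px * L%:Z) by ring.
  by rewrite eqs; congr (_ <= _); ring.
have h4 : (- w') * e * p < w * (- e') * p by rewrite ltr_pM2r.
have h5 : (- w') * (w * L%:Z) <= (- w') * (e * p) by apply: ler_wpM2l; lia.
have h6 : w * (w' * L%:Z) <= w * (e' * p) by apply: ler_wpM2l; lia.
lia.
Qed.

Lemma sh_shift (F : int * int -> int * int) (s i : nat) (w e : int) (q : int * int) :
  (forall (w e : int) (p : int * int), F (sh w e p) = sh w e (F p)) ->
  iter s F q = sh w e q -> iter s F (iter i F q) = sh w e (iter i F q).
Proof. by move=> Fsh e1; rewrite -iterD addnC iterD e1 iter_sh. Qed.

Lemma orbit_cycle (F : int * int -> int * int) (q : int * int) :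
  (forall (w e : int) (p : int * int), F (sh w e p) = sh w e (F p)) ->
  exists (i s : nat) (w e : int), (0 < s)%N /\
    iter s F (iter i F q) = sh w e (iter i F q).
Proof.
move=> Fsh; pose h (i : 'I_n.+1) : 'I_n := ar n_gt0 (iter i F q).1.
have /injectivePn[i [j ij hij]] : ~~ injectiveb h.
  by apply/negP => /injectiveP /leq_card; rewrite !card_ord ltnn.
wlog lij : i j ij hij / (i < j)%N => [th|].
  have [|ji|e] := ltngtP i j; first exact: th.
    by apply: (th j i) => //; rewrite eq_sym.
  by rewrite (val_inj e) eqxx in ij.
move/eqP: hij => /ar_eqP[w e].
exists i, (j - i)%N, w, ((iter j F q).2 - (iter i F q).2); rewrite subn_gt0 lij; split=> //.
rewrite -iterD subnK 1?ltnW // /sh -e addrC subrK; exact: surjective_pairing.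
Qed.

Lemma right_of_hollow_l (a t b t' : int) :
  right_of (f a) t b t' -> right_of a (t - 1) b t'.
Proof.
case: (level_cases t' t) => [[m e]|[m e]].
  have e2 : t' = t - 1 + m.+1%:Z by lia.
  by rewrite {1}e right_of_up e2 right_of_up -iterSr.
have e2 : t - 1 = t' + m%:Z by lia.
by rewrite e2 e !right_of_down => /f_lt_inv.
Qed.

(** * Feasible maps *)

Section Feasible.
Variables (c l : int) (u : int -> int).
Hypothesis l0 : 0 < l.
Hypothesis u_per : forall a : int, u (a + n%:Z) = u a + c.
Hypothesis u_f : forall a : int, u (f a) <= u a + l.
Hypothesis u_nose : forall (a : int) (j : nat), (j <= k)%N ->
  u a + j%:Z * l + 2 <= u (iter j f a + 1).

Lemma u_addn (a : int) (j : nat) : u a + 2 * j%:Z <= u (a + j%:Z).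
Proof.
elim: j => [|j IH]; first by rewrite mulr0 !addr0.
have := u_nose (a + j%:Z) (leq0n k); rewrite /= mul0r addr0.
have -> : a + j.+1%:Z = a + j%:Z + 1 by lia.
by lia.
Qed.

Lemma u_le (a b : int) : a <= b -> u a <= u b.
Proof.
move=> ab; have := u_addn a (absz (b - a)).
have -> : a + (absz (b - a))%:Z = b by lia.
by lia.
Qed.

Lemma u_shift (a w : int) : u (a + w * n%:Z) = u a + w * c.
Proof.
have uN (b : int) (m : nat) : u (b + m%:Z * n%:Z) = u b + m%:Z * c.
  elim: m => [|m IH]; first by rewrite !mul0r !addr0.
  by rewrite -addn1 PoszD !mulrDl !mul1r !addrA u_per IH.
case: w => m; first exact: uN.
have := uN (a + Negz m * n%:Z) m.+1.
by rewrite NegzE !mulNr -!addrA addNr addr0 => ->; rewrite -addrA subrr addr0.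
Qed.

Lemma u_iter (a : int) (j : nat) : u (iter j f a) <= u a + j%:Z * l.
Proof.
elim: j => [|j IH]; first by rewrite mul0r addr0.
by have := u_f (iter j f a); rewrite /= -addn1 PoszD mulrDl mul1r; lia.
Qed.

Lemma c_gt0 : 0 < c.
Proof. by have := u_addn 0 n; rewrite u_per; lia. Qed.

(* Along a backward orbit of vertices without long noses, the curve just to
   the right of it would go up at the slope of f, using noses. *)
Lemma feasible_nhits (b : int) : nhits b.
Proof.
apply: contrapT => nb; have c0 := c_gt0.
(* Each gain of 2 over the slope [l] takes at most k + 1 levels, and I + 1 = c + 1 gains exceed [c],
   the worth of a full turn. *)
pose I := absz c; pose K := (I.+2 * k.+1)%N.
have [y [_ hy]] := not_nhits_chain K nb.
have mk (s : nat) : (s <= K)%N -> (nidx k (iter s f y) < k)%N.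
  move=> /hy[_]; rewrite negb_or => /andP[nk _].
  by rewrite ltn_neqAle nk nidx_le.
have climb (i : nat) : (i < I.+2)%N -> exists e : nat, [/\ (e <= i.+1 * k.+1)%N,
    ~~ top (iter e f y) & u y + e%:Z * l + 2 * i.+1%:Z <= u (iter e f y + 1)].
  elim: i => [_|i IH iI].
    have m0 : (nidx k y < k)%N := mk 0%N isT; exists (nidx k y); split; last 1 first.
    - by have := u_nose y (ltnW m0); rewrite /= mulr1.
    - by lia.
    - exact: nidx_ntop.
  have [e [eK nt ue]] := IH (ltnW iI).
  have eK1 : (e.+1 <= K)%N by rewrite /K; nia.
  have m1 := mk _ eK1; set m := nidx k _ in m1.
  exists (m + e.+1)%N; split; first by nia.
    by rewrite iterD; apply: nidx_ntop.
  (* Since f^e y is not last in its fibre, [f] merges it with its right neighbour: the nose from f^e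
     y + 1, of index m + 1 <= k, follows the orbit of y. *)
  have := u_nose (iter e f y + 1) m1; rewrite iterSr ntop // -iterS -iterD.
  have -> : (m + e.+1)%N%:Z * l = e%:Z * l + m.+1%:Z * l.
    by rewrite addnS -addSn PoszD; ring.
  by lia.
have [e [_ _ ue]] := climb I (leqnSn _).
have yn : iter e f y + 1 <= iter e f y + n%:Z by lia.
have := u_le yn; rewrite u_per; have := u_iter y e.
have : I%:Z = c by rewrite /I; lia.
lia.
Qed.

Lemma nstep_progress (q : int * int) (m : nat) : exists i, q.1 + m%:Z <= (iter i nstep q).1.
Proof.
elim: m => [|m [i h]]; first by exists 0%N; rewrite addr0.
have [j ej] := nhits_level (iter i nstep q).2 (feasible_nhits (iter i nstep q).1).
exists (j + i)%N; rewrite iterD [iter i nstep q]surjective_pairing ej /=.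
by have := mnose_gt (iter i nstep q).1; lia.
Qed.

Lemma nstep_cycle_pos (q : int * int) (s : nat) (w e : int) : (0 < s)%N ->
  iter s nstep q = sh w e q -> 0 < w.
Proof.
move=> s0 qs; rewrite ltNge; apply/negP => w0.
have [C hC] := bounded_range (fun r => (iter r nstep q).1) s.
have [i] := nstep_progress q (absz (`|C| + `|q.1| + 1)).
rewrite (divn_eq i s) addnC iterD (iter_cycle nstep_sh _ qs) iter_sh; last exact: nstep_sh.
have := hC (i %% s)%N (ltn_pmod i s0); rewrite /sh /= => h.
have : (i %/ s)%:Z * w * n%:Z <= 0.
  by rewrite -mulrA mulr_ge0_le0 // mulr_le0_ge0.
lia.
Qed.

Definition height (q : int * int) : int := u q.1 - q.2 * l.

Lemma height_sh (w e : int) (q : int * int) :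
  height (sh w e q) = height q + w * c - e * l.
Proof. by rewrite /height /sh /= u_shift mulrDl; ring. Qed.

Lemma height_mnose (q : int * int) : height q + 2 <= height (mstep q).
Proof.
by have := u_nose q.1 (nidx_le k q.1); rewrite /height /mstep /mnose /= mulrDl; lia.
Qed.

Lemma height_hollow (b t : int) : inim b -> height (b, t) <= height (g b, t - 1).
Proof. by move=> im; have := u_f (g b); rewrite f_gK // /height /= mulrBl mul1r; lia. Qed.

Lemma height_nstep (q : int * int) : height q <= height (nstep q) /\
  (has_nose q.1 -> height q + 2 <= height (nstep q)).
Proof.
rewrite /nstep; case: ifP => hn; first by have := height_mnose q; rewrite /mstep; split; lia.
split=> //; case: q hn => b t /= hn; apply: height_hollow.
by move: hn; rewrite /has_nose; case: (inim b); rewrite ?orbT.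
Qed.

Lemma height_hstep (q : int * int) : height q <= height (hstep q) /\
  (~~ inim q.1 -> height q + 2 <= height (hstep q)).
Proof.
rewrite /hstep; case: ifP => hn; last by have := height_mnose q; rewrite /mstep => h; split=> [|_]; lia.
by split=> //; case: q hn => b t /= hn; apply: height_hollow.
Qed.

(** Without a nose the path consists of hollows and moves left, while each nose adds 2 to the
    height. This makes the slope bound on cycles strict. *)
Lemma nstep_run (q : int * int) (i : nat) : height q <= height (iter i nstep q) /\
  ((iter i nstep q).1 <= q.1 \/ height q + 2 <= height (iter i nstep q)).
Proof.
elim: i => [|i [IH1 IH2]] /=; first by split; [|left].
have [h1 h2] := height_nstep (iter i nstep q); split; first by lia.
case: IH2 => [IH2|]; last by right; lia.
have [/h2|hn] := boolP (has_nose (iter i nstep q).1); first by right; lia.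
left; rewrite /nstep (negPf hn) /=; apply: le_trans IH2; apply: ltW; exact: g_lt.
Qed.

Lemma hstep_run (q : int * int) (i : nat) : height q <= height (iter i hstep q) /\
  ((iter i hstep q).2 = q.2 - i%:Z \/ height q + 2 <= height (iter i hstep q)).
Proof.
elim: i => [|i [IH1 IH2]] /=; first by split; [|left; rewrite subr0].
have [h1 h2] := height_hstep (iter i hstep q); split; first by lia.
case: IH2 => [IH2|]; last by right; lia.
have [im|/h2] := boolP (inim (iter i hstep q).1); last by right; lia.
by left; rewrite /hstep im /= IH2; lia.
Qed.

Section Orbit.
Variables (x : int -> int) (L : nat) (p : int).
Hypothesis Lp : slope L p.
Hypothesis xS : forall t : int, x (t + 1) = f (x t).
Hypothesis xL : forall t : int, x (t + L%:Z) = x t + p * n%:Z.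

Lemma slope_u : p * c <= L%:Z * l.
Proof. by have := u_iter (x 0) L; rewrite -(seq_iter 0 L xS) xL u_shift; lia. Qed.

Lemma nstep_cycle_strict (q : int * int) (s : nat) (w e : int) :
  0 < w -> iter s nstep q = sh w e q -> e * p < w * L%:Z.
Proof.
move=> w0 qs; have [L0 p0 _ _] := Lp; have [_] := nstep_run q s; rewrite qs height_sh.
case=> [|h]; first by rewrite /sh /=; have : 0 < w * n%:Z; [apply: mulr_gt0|]; lia.
rewrite -(ltr_pM2r l0).
have h1 : e * l * p < w * c * p by rewrite ltr_pM2r //; lia.
have h2 : w * (p * c) <= w * (L%:Z * l) by apply: ler_wpM2l; [lia|exact: slope_u].
lia.
Qed.

(** If w >= 0, then [hstep_cycle_slope] gives e >= 0, so the cycle contains a nose; its gain in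
    height contradicts the same slope bound. *)
Lemma hstep_cycle_neg (q : int * int) (s : nat) (w e : int) : (0 < s)%N ->
  iter s hstep q = sh w e q -> w < 0 /\ e < 0.
Proof.
move=> s0 qs; have [L0 p0 _ _] := Lp; have c0 := c_gt0.
have h1 := hstep_cycle_slope Lp xS xL qs.
have [h2] := hstep_run q s; rewrite qs height_sh /sh /= => h3.
have wn : w < 0.
  rewrite ltNge; apply/negP => w0.
  have e0 : 0 <= e.
    by rewrite -(pmulr_lge0 _ p0); apply: le_trans h1; apply: mulr_ge0; lia.
  case: h3 => [|h3]; first by lia.
  have h4 : e * l * p < w * c * p by rewrite ltr_pM2r //; lia.
  have h5 : w * (p * c) <= w * (L%:Z * l) by apply: ler_wpM2l; [lia|exact: slope_u].
  have h6 : w * L%:Z * l <= e * p * l by rewrite ler_pM2r.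
  lia.
split=> //; rewrite -(pmulr_llt0 _ l0).
by have : w * c < 0; [rewrite nmulr_rlt0|lia].
Qed.

(* A path crossing a greedy hollow path from left to right meets it. *)
Lemma cycles_meet (b d : int) (s s' : nat) (w e w' e' : int) :
  0 < w -> iter s nstep (b, 0) = sh w e (b, 0) ->
  w' < 0 -> e' < 0 -> iter s' hstep (d, 0) = sh w' e' (d, 0) ->
  exists i j : nat, ar n_gt0 (iter i nstep (b, 0)).1 = ar n_gt0 (iter j hstep (d, 0)).1.
Proof.
move=> w0 bs w'0 e'0 ds; apply: contrapT => no.
have disj i j (v t : int) : (iter i nstep (b, 0)).1 <> (iter j hstep (sh v t (d, 0))).1.
  rewrite iter_sh; last exact: hstep_sh.
  by move=> h; apply: no; exists i, j; rewrite h /sh /= ar_shift.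
have [L0 p0 s1 s2] := Lp.
have hs := hstep_cycle_slope Lp xS xL ds.
pose K4 : int := `|b - d|; pose K := K4 + 1.
(* The [Q i] lie on one greedy hollow path traced back to ever higher levels; [K] places them right
   of the orbit of [f] through (b, 0). [J q] says that they are all right of the orbit through q. *)
pose Q (i : nat) := sh (i%:Z * - w' + K) (i%:Z * - e') (d, 0).
have QS (i j : nat) : iter (j * s') hstep (Q (j + i)%N) = Q i.
  rewrite /Q iter_sh; last exact: hstep_sh.
  by rewrite (iter_cycle hstep_sh _ ds) sh_add PoszD; congr sh; ring.
pose J q := forall i : nat, right q (Q i).
have K4d : d + K4 * n%:Z >= b.
  have : K4 * 1 <= K4 * n%:Z by apply: ler_wpM2l; lia.
  rewrite /K4; lia.
have K4d' : b + K4 * n%:Z >= d.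
  have : K4 * 1 <= K4 * n%:Z by apply: ler_wpM2l; lia.
  rewrite /K4; lia.
have J0 : J (b, 0).
  move=> i; rewrite /right /Q /sh /=.
  have -> : i%:Z * - e' = (i * absz e')%N%:Z by rewrite PoszM; lia.
  rewrite right_of_up ltNge; apply/negP => h.
  have h' : b + (i%:Z * - w' + 1) * n%:Z <= iter (i * absz e') f b.
    by apply: le_trans h; rewrite /K !mulrDl in K4d *; lia.
  have := s1 _ _ _ h'.
  have -> : (i * absz e')%N%:Z * p = i%:Z * (- e' * p) by rewrite PoszM; lia.
  have : i%:Z * (- e' * p) <= i%:Z * (- w' * L%:Z) by apply: ler_wpM2l; lia.
  lia.
have JS (i : nat) : J (iter i nstep (b, 0)) -> J (iter i.+1 nstep (b, 0)).
  have := disj i.+1; rewrite iterS; set q := iter i nstep (b, 0) => dq Jq.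
  rewrite /nstep in dq *; case: ifP dq => [hn|hn] dq; last first.
    move=> m; apply: right_of_hollow_l; rewrite f_gK; first exact: Jq.
    by move: hn; rewrite /has_nose; case: (inim _); rewrite ?orbT.
  move=> m; apply: contrapT => nr.
  set b1 := mnose q.1 in dq nr; set t1 := q.2 + _ in nr.
  (* Start the hollow path above level t1. Before it first drops below t1, it stays weakly left of
     the orbit through the end (b1, t1) of the nose. It drops from level t1 itself, where being
     right of the orbit through q leaves only the point b1, a meeting. *)
  pose M := absz t1; have nrM : ~ right (b1, t1) (Q (M + m)%N).
    move=> r; apply: nr; rewrite -(QS m M); apply: right_iter r; exact: right_hstep.
  set z := Q (M + m)%N in nrM.
  have zt : t1 <= z.2.
    rewrite /z /Q /sh /= add0r; have : (M + m)%N%:Z * 1 <= (M + m)%N%:Z * - e'.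
      by apply: ler_wpM2l; lia.
    by rewrite /M; lia.
  have run (j : nat) : (forall j' : nat, (j' <= j)%N -> t1 <= (iter j' hstep z).2) ->
      ~ right (b1, t1) (iter j hstep z).
    elim: j => [|j IH] hj //=.
    have := IH (fun j' h => hj j' (leqW h)); have := hj j (leqnSn j); have := hj j.+1 (leqnn _).
    rewrite iterS; have : (iter j hstep z).1 <> b1 by move=> h; apply: (dq j _ _ (esym h)).
    case: (iter j hstep z) => d' t' /= dne.
    case: (level_cases t' t1) => [[r ->]|[r ->]]; last by lia.
    rewrite /hstep /right /=; case: ifP => im /= tr _; rewrite right_of_up.
      case: r tr => [|r tr]; first by lia.
      have -> : t1 + r.+1%:Z - 1 = t1 + r%:Z by lia.
      by rewrite right_of_up => /negP; rewrite -leNgt => h; apply/negP; rewrite -leNgt -le_f.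
    have -> : t1 + r%:Z + (nidx k d')%:Z = t1 + (nidx k d' + r)%N%:Z by lia.
    rewrite right_of_up => /negP; rewrite -leNgt => h; apply/negP; rewrite -leNgt.
    have lt : d' < iter r f b1.
      rewrite lt_neqAle h andbT; apply/eqP => eb; case: r {tr} eb h => [|r] //= eb _.
      by move: im; rewrite eb inim_f.
    by rewrite iterD /mnose; have := tops_lt (nidx_tops (j := k) (a := d')) lt; lia.
  have [j hj] : exists j, (iter j hstep z).2 < t1.
    have ez : iter s' hstep z = sh w' e' z.
      by rewrite /z /Q iter_sh ?ds ?sh_add 1?addrC 1?[e' + _]addrC //; exact: hstep_sh.
    exists ((absz (z.2 - t1)).+1 * s')%N; rewrite (iter_cycle hstep_sh _ ez).
    rewrite -[_.2]/(z.2 + (absz (z.2 - t1)).+1%:Z * e').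
    have : (absz (z.2 - t1)).+1%:Z * e' <= (absz (z.2 - t1)).+1%:Z * - 1.
      by apply: ler_wpM2l; lia.
    lia.
  have exj : exists j, (iter j hstep z).2 < t1 by exists j.
  case: (ex_minnP exj) => {hj}{}j hj jmin; case: j hj jmin => [|j] hj jmin.
    by have zt0 : t1 <= (iter 0 hstep z).2 := zt; lia.
  have lo (j' : nat) : (j' <= j)%N -> t1 <= (iter j' hstep z).2.
    by move=> h; rewrite leNgt; apply/negP => /jmin; lia.
  have nrj := run j lo; have loj := lo j (leqnn j).
  have rq : right q (iter j hstep z) by apply: right_iter (Jq _); exact: right_hstep.
  have dne : (iter j hstep z).1 <> b1 by move=> h; apply: (dq j _ _ (esym h)).
  move: hj nrj loj rq dne; rewrite iterS; case: (iter j hstep z) => d' t' /=.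
  rewrite /hstep; case: ifP => _ /=; last by lia.
  move=> h1 nrj h2; have tt : t' = t1 by lia.
  rewrite tt /right /= in nrj *; rewrite /t1 right_of_up => rq dne.
  move: nrj; have {2}-> : t1 = t1 + 0%N%:Z by rewrite addr0.
  rewrite right_of_up /= => nrj; apply: dne.
  by rewrite /b1 /mnose in nrj *; lia.
have Jall (i : nat) : J (iter i nstep (b, 0)) by elim: i => // i; apply: JS.
have strict := nstep_cycle_strict w0 bs.
(* By [strict], m laps of the nose cycle gain at least m over the slope, more than the initial
   separation allows. *)
pose m := (absz ((K + K4) * L%:Z)).+1; pose i := absz (m%:Z * e).
have := Jall (m * s)%N 0%N; rewrite (iter_cycle nstep_sh _ bs).
move=> r0; have {r0} := right_iter (i * s') (fun z => right_hstep (p := z)) r0.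
rewrite /Q iter_sh; last exact: hstep_sh.
rewrite (iter_cycle hstep_sh _ ds) sh_add /right /sh /= !mul0r !add0r.
have ie : 0 <= m%:Z * e - i%:Z * e'.
  have : i%:Z * 1 <= i%:Z * - e' by apply: ler_wpM2l; lia.
  rewrite /i; lia.
set r := absz (m%:Z * e - i%:Z * e')%R.
have -> : m%:Z * e = i%:Z * e' + r%:Z by rewrite /r; lia.
rewrite right_of_down iter_shift => h.
have h' : d + (m%:Z * w - i%:Z * w' - K - K4) * n%:Z <= iter r f d.
  rewrite !mulrBl; rewrite mulrDl in h; lia.
have := s1 _ _ _ h'.
have -> : r%:Z * p = m%:Z * (e * p) - i%:Z * (e' * p) by rewrite /r; lia.
have : i%:Z * (w' * L%:Z) <= i%:Z * (e' * p) by apply: ler_wpM2l.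
have : m%:Z * 1 <= m%:Z * (w * L%:Z - e * p) by apply: ler_wpM2l; lia.
rewrite !mulrBl mulrBr => h1 h2 h3.
have : m%:Z <= (K + K4) * L%:Z by rewrite mulrDl; lia.
rewrite /m; lia.
Qed.
End Orbit.
End Feasible.

Lemma feasible_shared : feasible -> shared_cycles.
Proof.
move=> [c [l [u [l0 u_per u_f u_nose]]]].
have [x [L [p [L0 p0 xS xL]]]] := orbit_ex.
have Lp := slope_orbit L0 p0 xS xL.
have [i [s [w [e [s0]]]]] := orbit_cycle (0, 0) nstep_sh.
have [j [s' [w' [e' [s'0]]]]] := orbit_cycle (0, 0) hstep_sh.
have base (F : int * int -> int * int) (r : nat) (v t : int) (q : int * int) :
    (forall (w e : int) (p : int * int), F (sh w e p) = sh w e (F p)) ->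
    iter r F q = sh v t q -> iter r F (q.1, 0) = sh v t (q.1, 0).
  move=> Fsh eq; have -> : (q.1, 0) = sh 0 (- q.2) q.
    by rewrite /sh mul0r addr0 subrr.
  by rewrite iter_sh // eq !sh_add 1?addrC 1?[t + _]addrC.
move=> /(base _ _ _ _ _ hstep_sh) hd /(base _ _ _ _ _ nstep_sh) hb.
set b := (iter i _ _).1 in hb; set d := (iter j _ _).1 in hd.
have w0 := nstep_cycle_pos l0 u_per u_f u_nose s0 hb.
have [w'0 e'0] := hstep_cycle_neg l0 u_per u_f u_nose Lp xS xL s'0 hd.
have [a [a' /eqP/ar_eqP[v ev]]] := cycles_meet l0 u_per u_f u_nose Lp xS xL w0 hb w'0 e'0 hd.
exists (iter a nstep (b, 0)).1, s, s', w, w', e, e'; split; split=> //.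
  by apply: base => //; [exact: nstep_sh|apply: sh_shift => //; exact: nstep_sh].
apply: (base _ _ _ _ (iter a nstep (b, 0))); first exact: hstep_sh.
set q := iter a nstep (b, 0) in ev *.
have -> : q = sh (- v) (q.2 - (iter a' hstep (d, 0)).2) (iter a' hstep (d, 0)).
  by rewrite /sh ev mulNr addrK addrC subrK -surjective_pairing.
rewrite iter_sh; last exact: hstep_sh.
rewrite (sh_shift a' hstep_sh hd) !sh_add; congr sh; lia.
Qed.

Lemma infeasible_up : ~ feasible ->
  exists (L : nat) (p : int) (q : int * int) (i : nat),
  [/\ (0 < L)%N, 0 < p, (0 < i)%N, iter i nstep q = sh p L%:Z q &
      forall j : nat, has_nose (iter j nstep q).1 -> ~ periodic (iter j nstep q).1].
Proof.
move=> /infeasible_curves [x [Lx [px [Y [L [p [_ sl _ [_ _ YS YL Yk]]]]]]]].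
have [q [i [i0 e h]]] := nstep_up sl YS YL Yk.
by have [L0 p0 _ _] := sl; exists L, p, q, i.
Qed.
End Lifted.

(** * Models on the universal cover *)

Section Circle.
Variable R : realType.
Implicit Types (C x S T : R).

Lemma modr_bounds x C : 0 < C -> 0 <= modr x C < C.
Proof.
move=> C0; have := @floor_itv R (x / C); rewrite /modr => /andP[h1 h2].
have e : x / C * C = x by rewrite divfK // gt_eqF.
have h3 : (Num.floor (x / C))%:~R * C <= x by rewrite -{2}e ler_pM2r.
have h4 : x < (Num.floor (x / C) + 1)%:~R * C by rewrite -{1}e ltr_pM2r.
by move: h4; rewrite intrD mulrDl mul1r [C * _]mulrC; lra.
Qed.

Lemma modr_shift x C (w : int) : 0 < C -> modr (x + w%:~R * C) C = modr x C.
Proof.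
move=> C0; rewrite /modr mulrDl mulfK ?gt_eqF // floorDrz ?intr_int //.
by rewrite intrKfloor intrD; ring.
Qed.

Lemma modr_id x C : 0 <= x < C -> modr x C = x.
Proof.
move=> /andP[x0 xC]; have C0 : 0 < C by lra.
rewrite /modr; have -> : Num.floor (x / C) = 0; last by rewrite mulr0 subr0.
apply: floor_def; rewrite add0r; apply/andP; split; first by apply: divr_ge0 => //; exact: ltW.
by rewrite ltr_pdivrMr // mul1r.
Qed.

Lemma modr_ex x C : exists w : int, modr x C = x + w%:~R * C.
Proof. by exists (- Num.floor (x / C)); rewrite /modr mulrC intrN; ring. Qed.

Lemma modr_inj x y C : modr x C = modr y C -> exists w : int, y = x + w%:~R * C.
Proof.
have [w ->] := modr_ex x C; have [w' ->] := modr_ex y C => e.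
by exists (w - w'); rewrite intrD intrN; lra.
Qed.

Lemma le_turns C (w w' : int) : 0 < C -> w <= w' -> w%:~R * C <= w'%:~R * C.
Proof. by move=> C0 ww; rewrite ler_pM2r // ler_int. Qed.

Lemma turn_cases C (w : int) : 0 < C ->
  [\/ w = 0, w%:~R * C <= - C, w = 1 | 2 * C <= w%:~R * C].
Proof.
move=> C0; have [w0|w0|->] := ltgtP w 0; last by constructor 1.
  constructor 2; rewrite -mulN1r -(intrN _ 1); apply: le_turns => //; lia.
have [w1|w1|->] := ltgtP w 1; last by constructor 3.
  by lia.
by constructor 4; apply: (@le_turns _ 2) => //; lia.
Qed.

(** Once S is moved into [0, C), the arc ends before C or wraps once, so only the turns 0 and 1
    matter; [turn_cases] isolates them. *)
Lemma in_arc_modr C S T x : 0 < C -> S < T < S + C ->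
  in_arc (modr S C) (modr T C) (modr x C) <-> exists w : int, S < x + w%:~R * C < T.
Proof.
move=> C0 ST; have [v ev] := modr_ex S C.
have /andP[s0 s1] := modr_bounds S C0; set s := modr S C in ev s0 s1 *.
have [v' ev'] := modr_ex x C.
have /andP[y0 y1] := modr_bounds x C0; set y := modr x C in ev' y0 y1 *.
pose T' := T + v%:~R * C.
suff h : in_arc s (modr T C) y <-> exists w : int, s < y + w%:~R * C < T'.
  rewrite h; split=> -[w hw]; [exists (w + v' - v)|exists (w - v' + v)];
    move: hw; rewrite ev ev' /T' !intrD !intrN; lra.
have e : modr T C = modr T' C by rewrite /T' modr_shift.
have T's : s < T' < s + C by rewrite ev /T'; lra.
rewrite e; case: (ltP T' C) => T'C.
  rewrite modr_id; last by lra.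
  rewrite /in_arc; have -> : s < T' by lra.
  split=> [h|[w hw]]; first by exists 0; rewrite mul0r addr0.
  by have [w0|w0|w0|w0] := turn_cases w C0; rewrite ?w0 ?mul0r ?mul1r in hw; lra.
have -> : modr T' C = T' - C.
  rewrite -[RHS](@modr_id _ C); last by lra.
  by rewrite -(modr_shift _ (- 1) C0) intrN mulN1r.
rewrite /in_arc; have -> : s < T' - C = false by apply/negbTE; rewrite -leNgt; lra.
split=> [/orP[h|h]|[w hw]].
- by exists 0; rewrite mul0r addr0; lra.
- by exists 1; rewrite mul1r; lra.
- by apply/orP; have [w0|w0|w0|w0] := turn_cases w C0; rewrite ?w0 ?mul0r ?mul1r in hw;
    [left|left|right|left]; lra.
Qed.

Lemma cwdist_modr C S T : 0 < C -> S <= T < S + C ->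
  cwdist C (modr S C) (modr T C) = T - S.
Proof.
move=> C0 ST; have [v ev] := modr_ex S C.
have /andP[s0 s1] := modr_bounds S C0; set s := modr S C in ev s0 s1 *.
have -> : modr T C = modr (T + v%:~R * C) C by rewrite modr_shift.
have T's : s <= T + v%:~R * C < s + C by rewrite ev; lra.
have -> : T - S = T + v%:~R * C - s by rewrite ev; lra.
set T' := T + _ in T's *; case: (ltP T' C) => T'C.
  by rewrite modr_id /cwdist; [have -> : s <= T' by lra|lra].
have -> : modr T' C = T' - C.
  rewrite -[RHS](@modr_id _ C); last by lra.
  by rewrite -(modr_shift _ (- 1) C0) intrN mulN1r.
rewrite /cwdist; have -> : s <= T' - C = false by apply/negbTE; rewrite -ltNge; lra.
by lra.
Qed.

Lemma modr_int (x C : R) : x \is a Num.int -> C \is a Num.int -> modr x C \is a Num.int.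
Proof. by move=> xi Ci; rewrite /modr rpredB ?rpredM ?intr_int. Qed.
End Circle.

Section Lift.
Variable R : realType.

(* [B] and [E] list the beginning and ending points of a model along the
   universal cover of its circle, and [f] lifts the function F_r. *)
Record lift (N : model R) (B E : int -> R) (f : int -> int) : Prop := Lift {
  lift_n : (0 < narc N)%N;
  lift_c : 0 < clen N;
  lift_Bper : forall i : int, B (i + (narc N)%:Z) = B i + clen N;
  lift_Eper : forall i : int, E (i + (narc N)%:Z) = E i + clen N;
  lift_Bmono : forall i j : int, i < j -> B i < B j;
  lift_Emono : forall i j : int, i < j -> E i < E j;
  lift_B0 : 0 <= B 0;
  lift_B1 : B (-1) < 0;
  lift_beg : forall a : 'I_(narc N), beg a = B (a : nat)%:Z;
  lift_fin : forall a : 'I_(narc N), fin a = modr (E (a : nat)%:Z) (clen N);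
  lift_f : forall i : int, B (f i) < E i < B (f i + 1);
  lift_range : forall i : int, i <= f i < i + (narc N)%:Z }.

Lemma shift_real (h : int -> R) (n : nat) (C : R) (i w : int) :
  (forall j : int, h (j + n%:Z) = h j + C) -> h (i + w * n%:Z) = h i + w%:~R * C.
Proof.
move=> hp; have hN (j : int) (m : nat) : h (j + m%:Z * n%:Z) = h j + m%:~R * C.
  elim: m => [|m IH]; first by rewrite !mul0r !addr0.
  by rewrite -addn1 PoszD intrD !mulrDl !mul1r !addrA hp IH.
case: w => m; first exact: hN.
have := hN (i + Negz m * n%:Z) m.+1.
by rewrite NegzE intrN !mulNr -!addrA addNr addr0 => ->; rewrite -addrA subrr addr0.
Qed.

Lemma step_mono (h : int -> R) : (forall i : int, h i < h (i + 1)) ->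
  forall i j : int, i < j -> h i < h j.
Proof.
move=> hs i j ij; have -> : j = i + (absz (j - i - 1)%R).+1%:Z by lia.
move: (absz _) => m; elim: m => [|m IH]; first exact: hs.
apply: lt_trans IH _.
by have -> : i + m.+2%:Z = i + m.+1%:Z + 1 by lia; exact: hs.
Qed.

Section Theory.
Variables (N : model R) (B E : int -> R) (f : int -> int).
Hypothesis H : lift N B E f.
Notation n := (narc N).
Notation C := (clen N).
Let n0 : (0 < n)%N := lift_n H.
Let C0 : 0 < C := lift_c H.
Notation ar := (ar n0).

Lemma lift_Bshift (i w : int) : B (i + w * n%:Z) = B i + w%:~R * C.
Proof. exact: shift_real (lift_Bper H). Qed.

Lemma lift_Eshift (i w : int) : E (i + w * n%:Z) = E i + w%:~R * C.
Proof. exact: shift_real (lift_Eper H). Qed.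

Lemma lift_ltB (i j : int) : (B i < B j) = (i < j).
Proof.
apply/idP/idP => [|/(lift_Bmono H)//]; rewrite !ltNge; apply: contra.
by rewrite le_eqVlt => /orP[/eqP -> //|/(lift_Bmono H) /ltW].
Qed.

Lemma lift_leB (i j : int) : (B i <= B j) = (i <= j).
Proof. by rewrite !leNgt lift_ltB. Qed.

Lemma lift_ltE (i j : int) : (E i < E j) = (i < j).
Proof.
apply/idP/idP => [|/(lift_Emono H)//]; rewrite !ltNge; apply: contra.
by rewrite le_eqVlt => /orP[/eqP -> //|/(lift_Emono H) /ltW].
Qed.

Lemma lift_leE (i j : int) : (E i <= E j) = (i <= j).
Proof. by rewrite !leNgt lift_ltE. Qed.

Lemma lift_ltBE (i j : int) : (B j < E i) = (j <= f i).
Proof.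
have /andP[h1 h2] := lift_f H i; apply/idP/idP => h.
  by rewrite -ltzD1 -lift_ltB; apply: lt_trans h h2.
by apply: le_lt_trans h1; rewrite lift_leB.
Qed.

Lemma lift_ltEB (i j : int) : (E i < B j) = (f i < j).
Proof.
have /andP[h1 h2] := lift_f H i; apply/idP/idP => h.
  by rewrite -lift_ltB; apply: lt_trans h1 h.
by apply: lt_le_trans h2 _; rewrite lift_leB lezD1.
Qed.

Lemma lift_mono (a b : int) : a <= b -> f a <= f b.
Proof.
move=> ab; rewrite -lift_ltBE; have /andP[h _] := lift_f H a.
by apply: lt_le_trans h _; rewrite lift_leE.
Qed.

Lemma lift_per (a : int) : f (a + n%:Z) = f a + n%:Z.
Proof.
apply/eqP; rewrite eq_le -ltzD1 -lift_ltEB -lift_ltBE.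
rewrite addrAC !(lift_Bper H) (lift_Eper H) !ltrD2r.
by have /andP[-> ->] := lift_f H a.
Qed.

Lemma lift_arc (i : int) : B i < E i < B i + C.
Proof.
rewrite -(lift_Bper H) lift_ltBE lift_ltEB; exact: (lift_range H).
Qed.

Lemma lift_decomp (i : int) : exists w : int, i = (ar i : nat)%:Z + w * n%:Z.
Proof. exact: ar_decomp. Qed.

Lemma lift_B_circle (a : 'I_n) : 0 <= B (a : nat)%:Z < C.
Proof.
apply/andP; split.
  by apply: le_trans (lift_B0 H) _; rewrite lift_leB.
have h : B (n%:Z - 1) < C.
  have := lift_Bper H (-1); have := lift_B1 H.
  by rewrite addrC; lra.
by apply: le_lt_trans h; rewrite lift_leB; have := ltn_ord a; lia.
Qed.

Lemma lift_beg_ar (i : int) : beg (ar i) = modr (B i) C.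
Proof.
have [w {2}->] := lift_decomp i; rewrite lift_Bshift modr_shift // (lift_beg H) modr_id //.
exact: lift_B_circle.
Qed.

Lemma lift_fin_ar (i : int) : fin (ar i) = modr (E i) C.
Proof.
by have [w {2}->] := lift_decomp i; rewrite lift_Eshift modr_shift // (lift_fin H).
Qed.

Lemma lift_beg_inj : injective (@beg R N).
Proof.
move=> a b; rewrite !(lift_beg H) => e; apply/val_inj/eqP; rewrite -eqz_nat.
by rewrite eq_le -!lift_leB e lexx.
Qed.

Lemma lift_fin_inj : injective (@fin R N).
Proof.
move=> a b; rewrite !(lift_fin H) => /modr_inj [w].
rewrite -lift_Eshift => e.
have {}e : (b : nat)%:Z = (a : nat)%:Z + w * n%:Z.
  by apply/eqP; rewrite eq_le -!lift_leE e lexx.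
by rewrite -(ar_ord n0 a) -(ar_ord n0 b) e ar_shift.
Qed.

Lemma lift_beg_in (a b : int) : in_arc (beg (ar a)) (fin (ar a)) (beg (ar b)) <->
  exists w : int, a < b + w * n%:Z <= f a.
Proof.
rewrite !lift_beg_ar lift_fin_ar in_arc_modr //; last exact: lift_arc.
by split=> -[w h]; exists w; move: h; rewrite -lift_Bshift lift_ltB lift_ltBE.
Qed.

Lemma lift_fin_in (a b : int) : in_arc (beg (ar a)) (fin (ar a)) (fin (ar b)) <->
  exists w : int, b + w * n%:Z < a <= f (b + w * n%:Z).
Proof.
rewrite lift_beg_ar !lift_fin_ar in_arc_modr //; last exact: lift_arc.
by split=> -[w h]; exists w; move: h; rewrite -lift_Eshift lift_ltE lift_ltBE andbC.
Qed.

Lemma Rf_ar (i : int) : Rf (ar i) = ar (i + 1).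
Proof.
apply: val_inj => /=; apply/eqP; rewrite -eqz_nat -modz_nat.
have [w e] := lift_decomp i.
rewrite -addn1 PoszD; have := ar_val n0 i; rewrite /= => ->.
have := ar_val n0 (i + 1); rewrite /= => ->.
by rewrite modzDml.
Qed.

Lemma Lf_Rf (a : 'I_n) : Lf (Rf a) = a.
Proof. exact: ordSK. Qed.

Lemma Lf_ar (i : int) : Lf (ar i) = ar (i - 1).
Proof. by rewrite -[i in LHS](subrK 1) -Rf_ar Lf_Rf. Qed.

Lemma iter_Rf (j : nat) (i : int) : iter j (@Rf R N) (ar i) = ar (i + j%:Z).
Proof. by elim: j => [|j IH]; rewrite ?addr0 //= IH Rf_ar -addrA -PoszD addn1. Qed.

Lemma iter_Lf (j : nat) (i : int) : iter j (@Lf R N) (ar i) = ar (i - j%:Z).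
Proof.
elim: j => [|j IH]; rewrite ?subr0 //= IH Lf_ar -addrA -opprD -PoszD addn1 //.
Qed.

(** A run of n elements has gone all the way round and has no next element to test, hence the guard
    [m.+1 < n]. *)
Lemma run_endE (P : pred 'I_n) (F : 'I_n -> 'I_n) (a : 'I_n) (m : nat) : (m < n)%N ->
  (forall j, (j <= m)%N -> P (iter j F a)) ->
  ((m.+1 < n)%N -> ~~ P (iter m.+1 F a)) -> @run_end R N P F a = iter m F a.
Proof.
move=> mn Pm nP; rewrite /run_end; congr (iter _ F a).
apply/eqP; rewrite eqn_leq; apply/andP; split.
  apply/bigmax_leqP => j /allP h; rewrite leqNgt; apply/negP => mj.
  have mn1 : (m.+1 < n)%N by apply: leq_ltn_trans mj (ltn_ord j).
  have /negP := nP mn1; apply; apply: h; apply/trajectP.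
  by exists m.+1.
apply: (@leq_bigmax_cond _ (fun j : 'I_n => all P (traject F a j.+1)) _ (Ordinal mn)).
apply/allP => b /trajectP [j]; rewrite ltnS => jm ->; exact: Pm.
Qed.

Lemma Fr_ar (a : int) : Fr (ar a) = ar (f a).
Proof.
have /andP[r1 r2] := lift_range H a.
have -> : f a = a + (absz (f a - a)%R)%:Z by lia.
rewrite -iter_Rf; apply: run_endE => [|j ja|an]; first by lia.
  rewrite iter_Rf; case: j ja => [|j] ja; first by rewrite addr0 eqxx orbT.
  by apply/orP; left; apply/lift_beg_in; exists 0; lia.
rewrite iter_Rf; apply/negP => /orP[/lift_beg_in [w]|/eqP /lift_beg_inj /eqP /ar_eqP [w]].
  move: an; set d := absz _ => an.
  have [w0|w0] := leP 0 w.
    have : 0 <= w * n%:Z by apply: mulr_ge0; lia.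
    by rewrite /d; lia.
  have : w * n%:Z <= -1 * n%:Z by apply: ler_wpM2r; lia.
  by rewrite /d; lia.
move: an; set d := absz _ => an e.
have [w0|w0] := leP 0 w.
  have : 0 <= w * n%:Z by apply: mulr_ge0; lia.
  by rewrite /d; lia.
have : w * n%:Z <= -1 * n%:Z by apply: ler_wpM2r; lia.
by rewrite /d; lia.
Qed.

Lemma Frj_ar (j : nat) (a : int) : Frj j (ar a) = ar (iter j f a).
Proof. by rewrite /Frj; elim: j => //= j ->; rewrite Fr_ar. Qed.

(** * The synthetic graph of a covering model *)

Section Covering.
Hypothesis f_gt : forall a : int, a < f a.
Let fm := lift_mono.
Let fp := lift_per.
Let fL : circle_lift n f := CircleLift n0 fm fp f_gt.
Let leF := le_f fL.
Let ltF := lt_f fL.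
Notation g := (g f).

Lemma f_range (a : int) : f a < a + n%:Z.
Proof. by case/andP: (lift_range H a). Qed.

Lemma g_gt (a : int) : a - n%:Z < g a.
Proof. by rewrite -ltF; have := f_range (a - n%:Z); rewrite subrK. Qed.

Lemma ar_range (a b : int) : a <= b < a + n%:Z -> ar a = ar b -> a = b.
Proof.
move=> ab /eqP /ar_eqP [w e]; move: ab; rewrite e.
have [w0|w0|->] := ltgtP w 0; last by rewrite mul0r addr0.
  by have : w * n%:Z <= -1 * n%:Z; [apply: ler_wpM2r|]; lia.
by have : 1 * n%:Z <= w * n%:Z; [apply: ler_wpM2r|]; lia.
Qed.

Lemma Fl_ar (b : int) : Fl (ar b) = ar (g b).
Proof.
have g1 : g b < b := g_lt fL b; have g2 := g_gt b.
have e : g b = b - (absz (b - g b)%R)%:Z by lia.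
rewrite [in RHS]e -iter_Lf; apply: run_endE => [|j jb|an]; first by lia.
  rewrite iter_Lf; case: j jb => [|j] jb; first by rewrite subr0 eqxx orbT.
  by apply/orP; left; apply/lift_fin_in; exists 0; rewrite mul0r addr0 leF; lia.
rewrite iter_Lf; apply/negP => /orP[/lift_fin_in [w]|/eqP /lift_fin_inj arE].
  rewrite leF; move: an; set d := absz _ => an /andP[w1 w2].
  have [w0|w0] := leP w 0.
    have : w * n%:Z <= 0 by apply: mulr_le0_ge0; lia.
    by rewrite /d; lia.
  have : 1 * n%:Z <= w * n%:Z by apply: ler_wpM2r; lia.
  by rewrite /d; lia.
by have := ar_range _ arE; lia.
Qed.

Lemma is_hollow_ar (b : int) (a : 'I_n) :
  is_hollow (ar b) a <-> inim f b /\ a = ar (g b).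
Proof.
have g1 : g b < b := g_lt fL b.
split=> [/and3P[_ /eqP e1 /eqP e2]|[/eqP im ->]].
  rewrite Fl_ar in e2; split=> //; rewrite e2 Fr_ar in e1.
  apply/eqP/esym/ar_range; last exact: e1.
  have h1 : b <= f (g b) by rewrite leF.
  by have := f_range (g b); lia.
apply/and3P; split; last by rewrite Fl_ar.
- by apply/lift_beg_in; exists 0; rewrite mul0r addr0 im; lia.
- by rewrite Fr_ar im.
Qed.

Lemma top_uniq (x y : int) : f x = f y -> top f x -> top f y -> x = y.
Proof.
rewrite /top => e tx ty; have [xy|xy|//] := ltgtP x y.
  have h : f (x + 1) <= f y by apply: fm; lia.
  by lia.
have h : f (y + 1) <= f x by apply: fm; lia.
by lia.
Qed.

Lemma Hl_ar (c : int) (b : 'I_n) :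
  Hl (ar c) = Some b <-> exists y : int, [/\ b = ar y, f y = c & top f y].
Proof.
have spec (y : int) : (Fr (ar y) == ar c) && (Fr (Rf (ar y)) != ar c) <->
    exists2 w : int, f (y + w * n%:Z) = c & top f y.
  rewrite Rf_ar !Fr_ar; split.
    move=> /andP[/ar_eqP[w e] ne]; exists w; first by rewrite (f_shift fL) e.
    apply: contraNT ne => /(ntop fL) ->; apply/ar_eqP; by exists w.
  move=> [w e ty]; rewrite -e (f_shift fL) ar_shift eqxx /=.
  apply/eqP => /esym /ar_range h.
  have := f_range (y + 1); have := f_gt y; move: (ty); rewrite /top => ? ? ?.
  by have := h _; lia.
rewrite /Hl; case: pickP => [b' hb'|no]; last first.
  split=> // -[y [_ fy ty]].
  by have /negP := no (ar y); case; apply/spec; exists 0; rewrite ?mul0r ?addr0.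
have [w e ty] : exists2 w : int, f ((b' : nat)%:Z + w * n%:Z) = c & top f (b' : nat)%:Z.
  by apply/spec; rewrite ar_ord.
split=> [[<-]|[y [-> fy ty']]].
  by exists ((b' : nat)%:Z + w * n%:Z); rewrite ar_shift ar_ord top_shift.
congr Some; rewrite -(ar_ord n0 b') -(ar_shift n0 _ w); congr (ar _).
by apply: top_uniq; rewrite ?e ?fy // top_shift.
Qed.

Lemma Hr_ar (a : int) (b : 'I_n) :
  Hr (ar a) = Some b <-> exists y : int, [/\ b = ar y, g y = a & g (y - 1) < a].
Proof.
have gp (y w : int) : g (y + w * n%:Z) = g y + w * n%:Z.
  by apply: shift_mulz => z; exact: (g_per fL).
have gm (y z : int) : y <= z -> g y <= g z by exact: (g_mono fL).
have spec (y : int) : (Fl (ar y) == ar a) && (Fl (Lf (ar y)) != ar a) <->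
    exists2 w : int, g (y + w * n%:Z) = a & g (y - 1) < g y.
  rewrite Lf_ar !Fl_ar; split.
    move=> /andP[/ar_eqP[w e] ne]; exists w; first by rewrite gp e.
    rewrite lt_neqAle gm ?andbT; last by lia.
    by apply: contraNneq ne => ->; apply/ar_eqP; exists w.
  move=> [w e ty]; rewrite -e gp ar_shift eqxx /=.
  apply/eqP => /ar_range h.
  have := g_gt (y - 1); have : g y < y by exact: (g_lt fL).
  by have := h _; lia.
rewrite /Hr; case: pickP => [b' hb'|no]; last first.
  split=> // -[y [_ fy ty]].
  by have /negP := no (ar y); case; apply/spec; exists 0; rewrite ?mul0r ?addr0 ?fy.
have [w e ty] : exists2 w : int, g ((b' : nat)%:Z + w * n%:Z) = a &
    g ((b' : nat)%:Z - 1) < g (b' : nat)%:Z.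
  by apply/spec; rewrite ar_ord.
have e' : g ((b' : nat)%:Z + w * n%:Z - 1) < a.
  by rewrite addrAC gp -e gp ltrD2r.
split=> [[<-]|[y [-> gy gy']]].
  by exists ((b' : nat)%:Z + w * n%:Z); rewrite ar_shift ar_ord.
congr Some; rewrite -(ar_ord n0 b') -(ar_shift n0 _ w); congr (ar _).
set z := _ + _ in e e' *; have [zy|zy|//] := ltgtP z y.
  have h : g z <= g (y - 1) by apply: gm; lia.
  by lia.
have h : g y <= g (z - 1) by apply: gm; lia.
by lia.
Qed.

Lemma Hl_def (a : int) : (Hl (ar a) != None) = inim f a.
Proof.
apply/idP/idP; case e : (Hl (ar a)) => [b|] //.
  by have /Hl_ar [y [_ fy _]] := e => _; apply/(inimP fL); exists y.
move=> /eqP im; pose y := g (a + 1) - 1.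
have fy : f y = a.
  have : f y < a + 1 by rewrite ltF /y; lia.
  have : a <= f y.
    rewrite leF /y; have : g a < g (a + 1); last by lia.
    by rewrite -ltF im; lia.
  by lia.
have ty : top f y.
  by rewrite /top fy /y subrK; have := f_g fL (a + 1); lia.
by have /Hl_ar : exists y0 : int, [/\ ar y = ar y0, f y0 = a & top f y0];
  [exists y|rewrite e].
Qed.

(** H_r of arc a is the first arc within the reach of a but not of a - 1, which is f (a - 1) + 1
    when a - 1 is last in its fibre. *)
Lemma Hr_def (a : int) : (Hr (ar a) != None) = top f (a - 1).
Proof.
rewrite /top subrK; apply/idP/idP; case e : (Hr (ar a)) => [b|] //.
  have /Hr_ar [y [_ gy gy']] := e => _.
  have h1 : y <= f a by rewrite leF gy.
  by have h2 : f (a - 1) < y; [rewrite ltF gy|]; lia.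
move=> lt; pose y := f (a - 1) + 1.
have h : exists z : int, [/\ ar y = ar z, g z = a & g (z - 1) < a].
  exists y; split=> //.
    have : g y <= a by rewrite -leF /y; lia.
    have : a - 1 < g y by rewrite -ltF /y; lia.
    by lia.
  have : g (y - 1) <= a - 1; last by lia.
  by rewrite -leF /y; lia.
by have /Hr_ar := h; rewrite e.
Qed.

Lemma Hlj_ar (j : nat) (c : int) (b : 'I_n) :
  Hlj j (ar c) = Some b <-> exists y : int, [/\ b = ar y, iter j f y = c & tops f j y].
Proof.
elim: j b => [|j IH] b.
  rewrite /Hlj /=; split=> [[<-]|[y [-> <- _]]] //.
  by exists c; split=> // s.
rewrite /Hlj iterS -/(Hlj j (ar c)); split.
  case e : (Hlj j (ar c)) => [a|] //=.
  have /IH [y [-> fy ty]] := e; move=> /Hl_ar [z [-> fz tz]].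
  by exists z; split=> //; [rewrite -iterS iterSr fz|apply: topsS; rewrite ?fz].
move=> [y [-> fy ty]]; have -> : Hlj j (ar c) = Some (ar (f y)).
  apply/IH; exists (f y); split=> //; first by rewrite -iterSr.
  by move=> s sj; rewrite -iterSr; apply: ty.
by apply/Hl_ar; exists y; split=> //; apply: (ty 0%N).
Qed.

Lemma min_pos (T : finType) (h : T -> R) :
  exists2 d : R, 0 < d & forall t, 0 < h t -> d < h t.
Proof.
suff [d d0 hd] : exists2 d : R, 0 < d & forall t, t \in enum T -> 0 < h t -> d < h t.
  by exists d => // t; apply: hd; rewrite mem_enum.
elim: (enum T) => [|t s [d d0 IH]]; first by exists 1.
have [ht|ht] := ltP 0 (h t); last first.
  exists d => // t'; rewrite inE => /orP[/eqP -> ht'|/IH //].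
  by have := lt_le_trans ht' ht; rewrite ltxx.
exists (Num.min d (h t / 2)); first by rewrite lt_min d0; lra.
move=> t'; rewrite inE => /orP[/eqP -> _|ts ht']; rewrite gt_min.
  by apply/orP; right; lra.
by rewrite IH.
Qed.

(** Finitely many positive distances exceed some d > 0; dividing by n + 1 leaves room for all the
    shifts, which are at most n. *)
Lemma small_eps_ex (j : nat) : exists e, @small_eps R N j e.
Proof.
have [d d0 hd] := min_pos (fun p : 'I_n * (bool * 'I_n) =>
  cwdist C (beg (Frj j p.1)) (expos p.2)).
exists (d / n.+1%:R); split=> [|a x]; first by rewrite divr_gt0.
apply/negP => /andP[h1 h2]; have := hd (a, x) h1; apply/negP; rewrite -leNgt.
apply: le_trans h2 _; rewrite mulrAC ler_pdivrMr // ler_pM2l // ler_nat ltnS.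
by apply: leq_trans (max_card _) _; rewrite card_ord.
Qed.

Lemma eps_spec (j : nat) : @small_eps R N j (eps N j).
Proof. exact: xgetPex (small_eps_ex j). Qed.

(** * Powers of a model *)

Section Power.
Variable j : nat.
Hypothesis j_range : forall i : int, iter j f i < i + n%:Z.

Let Ej (i : int) : R := B (iter j f i) + eps N j * (power_shift j (ar i)).+1%:R.

Lemma n_gt1 : (1 < n)%N.
Proof. by have := f_gt 0; have := f_range 0; lia. Qed.

Lemma Ej_lt (i : int) : B (iter j f i) < Ej i < B (iter j f i + 1).
Proof.
have [e0 he] := eps_spec j; rewrite /Ej; set m := iter j f i; set s := _.+1%:R.
have s0 : 0 < s by rewrite ltr0n.
have es : 0 < eps N j * s by rewrite mulr_gt0.
apply/andP; split; first by lra.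
have := he (ar i) (false, ar (m + 1)); rewrite Frj_ar -/m /expos /=.
have hm : B m < B (m + 1) by apply: (lift_Bmono H); lia.
rewrite !lift_beg_ar cwdist_modr //; last first.
  by rewrite (ltW hm) -(lift_Bper H) lift_ltB; have := n_gt1; lia.
by rewrite -/s subr_gt0 hm /= -ltNge; lra.
Qed.

(** The count for an arc is its rank in its fibre of f^j: from an earlier arc of the fibre the walk
    meets s(A) before the common image, from a later one only after it. This orders the ending
    points within a fibre. *)
Lemma power_shift_lt (i : int) : iter j f i = iter j f (i + 1) ->
  (power_shift j (ar i) < power_shift j (ar (i + 1)))%N.
Proof.
move=> e.
pose S a := [set b0 | [&& b0 != ar a, Frj j b0 == Frj j (ar a) &
  cwdist C (beg b0) (beg (ar a)) <= cwdist C (beg b0) (beg (Frj j (ar a)))]].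
have spec (a y : int) : iter j f y = iter j f a -> (ar y \in S a) = (y < a).
  move=> e'; have am := iter_ge fL j a; have ja := j_range a.
  have := iter_ge fL j y; have := j_range y; rewrite e' => jy ym.
  rewrite finset.in_set !Frj_ar e' eqxx /=.
  have [ya|ay|->] := ltgtP y a; last by rewrite eqxx.
    rewrite !lift_beg_ar !cwdist_modr //; last 2 first.
    - by rewrite lift_leB -(lift_Bper H) lift_ltB; lia.
    - by rewrite lift_leB -(lift_Bper H) lift_ltB; lia.
    rewrite lerD2r lift_leB; have -> : a <= iter j f a by lia.
    by rewrite andbT; apply/eqP => /ar_range h; have := h _; lia.
  apply/negbTE; rewrite negb_and -ltNge; apply/orP; right.
  have -> : beg (ar a) = modr (B (a + n%:Z)) C.
    by rewrite -lift_beg_ar -[in RHS](mul1r n%:Z) ar_shift.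
  rewrite !lift_beg_ar !cwdist_modr //; last 2 first.
  - by rewrite lift_leB -(lift_Bper H) lift_ltB; lia.
  - by rewrite lift_leB -(lift_Bper H) lift_ltB; lia.
  by rewrite ltrD2r lift_ltB.
have lift_of (a : int) b : b \in S a -> exists2 y, b = ar y & iter j f y = iter j f a.
  rewrite finset.in_set => /and3P[_ + _].
  rewrite -{1}(ar_ord n0 b) !Frj_ar => /ar_eqP [w ew].
  by exists ((b : nat)%:Z + w * n%:Z); rewrite ?ar_shift ?ar_ord // (iter_shift fL).
rewrite /power_shift -/(S i) -/(S (i + 1)); apply/proper_card/properP; split.
  apply/fintype.subsetP => b bS; have [y by_ fy] := lift_of _ _ bS.
  by move: bS; rewrite by_ !spec -?e //; lia.
by exists (ar i); rewrite spec // ?ltrDl // -leNgt.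
Qed.

Lemma power_fin (a : int) : @fin R (power N j) (ar a) = modr (Ej a) C.
Proof.
rewrite /= Frj_ar lift_beg_ar /Ej; have [w ->] := modr_ex (B (iter j f a)) C.
by rewrite addrAC modr_shift.
Qed.

Lemma in_power_ar (a b : int) : in_power j (ar a) (beg (ar b)) <->
  exists w : int, a < b + w * n%:Z <= iter j f a.
Proof.
rewrite /in_power power_fin !lift_beg_ar in_arc_modr //.
  have /andP[h1 h2] := Ej_lt a.
  have lt (i : int) : (B i < Ej a) = (i <= iter j f a).
    apply/idP/idP => h; first by rewrite -ltzD1 -lift_ltB; apply: lt_trans h h2.
    by apply: le_lt_trans h1; rewrite lift_leB.
  by split=> -[w h]; exists w; move: h; rewrite -lift_Bshift lift_ltB lt.
have /andP[h1 h2] := Ej_lt a; apply/andP; split.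
  by apply: le_lt_trans h1; rewrite lift_leB; have := iter_ge fL j a; lia.
apply: lt_le_trans h2 _; rewrite -(lift_Bper H) lift_leB.
by have := j_range a; lia.
Qed.

Lemma lift_power : lift (power N j) B Ej (iter j f).
Proof.
have [e0 he] := eps_spec j.
have per (i : int) : Ej (i + n%:Z) = Ej i + C.
  rewrite /Ej (iter_per fL) (lift_Bper H) addrAC; congr (_ + _ * _%:R + _).
  by rewrite -[in LHS](mul1r n%:Z) ar_shift.
split=> //=; [exact: (lift_Bper H)|exact: (lift_Bmono H)| |exact: (lift_B0 H)|exact: (lift_B1 H)|
  exact: (lift_beg H)| |exact: Ej_lt|].
- apply: step_mono => i.
  have fi : iter j f i <= iter j f (i + 1) by apply: (iter_mono fL); lia.
  have [fe|fe] := eqVneq (iter j f i) (iter j f (i + 1)).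
    by rewrite /Ej -fe ltrD2l ltr_pM2l // ltr_nat ltnS power_shift_lt.
  have /andP[_ h1] := Ej_lt i; have /andP[h2 _] := Ej_lt (i + 1).
  apply: lt_trans h1 _; apply: le_lt_trans h2; rewrite lift_leB lezD1.
  by rewrite lt_neqAle fe.
- by move=> a; rewrite -{1 2}(ar_ord n0 a); have := power_fin (a : nat)%:Z; rewrite /= ar_ord.
- by move=> i; rewrite j_range andbT; have := iter_ge fL j i; lia.
Qed.
End Power.

Variable k : nat.
Hypothesis k_range : forall (j : nat) (i : int), (j <= k)%N -> iter j f i < i + n%:Z.

(** Iterating H_l backwards yields a chain of last points of fibres. The end is one past the reach
    f^j a of A^j, and f^j a < a + n keeps all its translates outside. *)
Lemma is_nose_ar (j : nat) (a : int) (b : 'I_n) : (j <= k)%N ->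
  is_nose j (ar a) b <-> tops f j a /\ b = ar (iter j f a + 1).
Proof.
move=> jk; have jr i := k_range i jk; split.
  move=> /andP[_ /eqP/esym]; rewrite -{1}(ar_ord n0 b) Lf_ar => /Hlj_ar[y [/eqP/ar_eqP[w ->] fy ty]].
  split; first by move=> s sj; have := ty s sj; rewrite (iter_shift fL) (top_shift fL).
  rewrite -(ar_ord n0 b); apply/eqP/ar_eqP; exists (- w).
  by move: fy; rewrite (iter_shift fL) mulNr; lia.
move=> [ta ->]; apply/andP; split; last first.
  apply/eqP/esym; rewrite Lf_ar addrK; apply/Hlj_ar; by exists a.
apply/negP => /(in_power_ar jr) [w]; have := iter_ge fL j a; have := jr a.
have [w0|w0] := leP 0 w.
  have : 0 <= w * n%:Z by apply: mulr_ge0; lia.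
  by lia.
have : w * n%:Z <= -1 * n%:Z by apply: ler_wpM2r; lia.
by lia.
Qed.

Definition hollow_at (a : int) : edge N := Edge (ar a) Hollow (ar (g a)).
Definition nose_at (a : int) : edge N :=
  Edge (ar a) (Nose (nidx f k a)) (ar (mnose f k a)).

Lemma synth_hollow (a : int) (b : 'I_n) :
  synth k (Edge (ar a) Hollow b) <-> inim f a /\ b = ar (g a).
Proof. by rewrite /synth /= andbT; exact: is_hollow_ar. Qed.

(** A nose is not short if j = k, or if H_l of its source and H_r of its end are both undefined. The
    latter means that f^j a is not last in its fibre, which singles out [nidx]. *)
Lemma synth_nose (a : int) (j : nat) (b : 'I_n) : synth k (Edge (ar a) (Nose j) b) <->
  [/\ has_nose f k a, j = nidx f k a & b = ar (mnose f k a)].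
Proof.
rewrite /synth /synth_star /is_short /= Hl_def; split.
  move=> /andP[/andP[jk /(is_nose_ar _ _ jk)[ta ->]]].
  rewrite Hr_def addrK negb_and negb_or -leqNgt => sh.
  have e : j = nidx f k a.
    by apply: nidx_uniq => //; apply/implyP; rewrite ltnNge; case/orP: sh => [->|/andP[]].
  rewrite /mnose -e; split=> //; rewrite /has_nose -e.
  case/orP: sh => [kj|/andP[-> _]]; last by rewrite orbT.
  by rewrite eqn_leq jk kj.
move=> [hn -> ->]; have mk := nidx_le f k a; have tm := @nidx_tops f k a.
apply/andP; split; first by rewrite mk; apply/is_nose_ar.
rewrite /mnose Hr_def addrK negb_and negb_or -leqNgt.
have [//|lt] := leqP k (nidx f k a); rewrite nidx_ntop // andbT /=.
by move: hn; rewrite /has_nose (ltn_eqF lt).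
Qed.

Lemma starts_hollow_ar (a : int) : starts_hollow k (ar a) = inim f a.
Proof.
apply/existsP/idP => [[b /synth_hollow[]] //|im].
by exists (ar (g a)); apply/synth_hollow.
Qed.

Lemma starts_nose_ar (a : int) : starts_nose k (ar a) = has_nose f k a.
Proof.
apply/existsP/idP => [[i /existsP[b /synth_nose[]]] //|hn].
exists (inord (nidx f k a)); apply/existsP; exists (ar (mnose f k a)).
by apply/synth_nose; split=> //; rewrite inordK // ltnS nidx_le.
Qed.

Definition nedge (a : int) : edge N := if has_nose f k a then nose_at a else hollow_at a.
Definition hedge (a : int) : edge N := if inim f a then hollow_at a else nose_at a.

Lemma has_nose_or (a : int) : ~~ has_nose f k a -> inim f a.
Proof. by rewrite /has_nose negb_or negbK => /andP[]. Qed.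

Lemma synth_nedge (a : int) : synth k (nedge a).
Proof.
rewrite /nedge; case: ifP => [hn|/negbT /has_nose_or im]; first exact/synth_nose.
exact/synth_hollow.
Qed.

Lemma synth_hedge (a : int) : synth k (hedge a).
Proof.
rewrite /hedge; case: ifP => [im|im]; first exact/synth_hollow.
by apply/synth_nose; rewrite /has_nose im orbT.
Qed.

Lemma greedy_nose_edge (e : edge N) (a : int) : synth k e ->
  (hollow_edge e ==> ~~ starts_nose k (src e)) -> src e = ar a -> e = nedge a.
Proof.
case: e => s [|j] d se /= hg sa; move: se hg; rewrite sa /nedge ?starts_nose_ar.
  by move=> /synth_hollow[_ ->] /negPf ->.
by move=> /synth_nose[-> -> ->].
Qed.

Lemma greedy_hollow_edge (e : edge N) (a : int) : synth k e ->
  (nose_edge e ==> ~~ starts_hollow k (src e)) -> src e = ar a -> e = hedge a.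
Proof.
case: e => s [|j] d se /= hg sa; move: se hg; rewrite sa /hedge ?starts_hollow_ar.
  by move=> /synth_hollow[-> ->].
by move=> /synth_nose[_ -> ->] /negPf ->.
Qed.

(* [- turn e] is the number of times that [e] goes clockwise past 0. *)
Definition turn (e : edge N) : int :=
  if internal e then 0 else if hollow_edge e then 1 else -1.

Lemma ext_turn (W : seq (edge N)) : ext W = \sum_(e <- W) turn e.
Proof.
elim: W => [|e W IH]; first by rewrite big_nil /ext subrr.
rewrite big_cons -IH /ext /= /turn /nose_edge.
by case: (internal e); case: (hollow_edge e) => /=; lia.
Qed.

Lemma ar_up (a b : int) : a < b <= a + n%:Z ->
  b - a = (ar b : nat)%:Z - (ar a : nat)%:Z + (~~ (ar a < ar b)%N)%:Z * n%:Z.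
Proof.
have [w e] := lift_decomp a; have [w' e'] := lift_decomp b.
have := ltn_ord (ar a); have := ltn_ord (ar b).
set x : nat := ar a in e *; set y : nat := ar b in e' * => yn xn /andP[h1 h2].
have ba : b - a = (y%:Z - x%:Z) + (w' - w) * n%:Z by rewrite e e' mulrBl; lia.
have [d0|d0] := leP (w' - w) (-1).
  have : (w' - w) * n%:Z <= -1 * n%:Z by apply: ler_wpM2r; lia.
  by lia.
have [d2|d2] := leP 2 (w' - w).
  have : 2 * n%:Z <= (w' - w) * n%:Z by apply: ler_wpM2r; lia.
  by lia.
have [d|d] : w' - w = 0 \/ w' - w = 1 by lia.
  rewrite d mul0r addr0 in ba; have -> : (x < y)%N by lia.
  by rewrite ba mul0r addr0.
rewrite d mul1r in ba; have -> : (x < y)%N = false by lia.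
by rewrite ba mul1r.
Qed.

Lemma mnose_range (a : int) : a < mnose f k a <= a + n%:Z.
Proof.
by have := mnose_gt fL k a; have := k_range a (nidx_le f k a); rewrite /mnose; lia.
Qed.

Lemma nose_turn (a : int) : mnose f k a - a =
  (ar (mnose f k a) : nat)%:Z - (ar a : nat)%:Z - turn (nose_at a) * n%:Z.
Proof.
rewrite (ar_up (mnose_range a)) /turn /internal /=.
by case: ltnP => _ /=; rewrite ?mul0r ?mulNr ?subr0 ?addr0 ?opprK.
Qed.

Lemma hollow_turn (a : int) : g a - a =
  (ar (g a) : nat)%:Z - (ar a : nat)%:Z - turn (hollow_at a) * n%:Z.
Proof.
have h : g a < a <= g a + n%:Z.
  by have := g_lt fL a; have := g_gt a; lia.
have := ar_up h; rewrite /turn /internal /=.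
by case: ltnP => _ /=; rewrite ?mul0r ?mul1r; lia.
Qed.

(** * Cycles of the synthetic graph as closed greedy paths *)

Section Orbits.
Variables (F : int * int -> int * int) (ef : int -> edge N).
Hypothesis F_sh : forall (w e : int) (p : int * int), F (sh n w e p) = sh n w e (F p).
Hypothesis ef_src : forall a : int, src (ef a) = ar a.
Hypothesis ef_dst : forall a t : int, dst (ef a) = ar (F (a, t)).1.
Hypothesis ef_turn : forall a t : int, (F (a, t)).1 - a =
  (ar (F (a, t)).1 : nat)%:Z - (ar a : nat)%:Z - turn (ef a) * n%:Z.
Hypothesis ef_synth : forall a : int, synth k (ef a).

Definition orbit_walk (s : nat) (q : int * int) : seq (edge N) :=
  [seq ef (iter i F q).1 | i <- iota 0 s].

Lemma orbit_walkS (s : nat) (q : int * int) :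
  orbit_walk s.+1 q = rcons (orbit_walk s q) (ef (iter s F q).1).
Proof. by rewrite /orbit_walk -[s.+1]addn1 iotaD map_cat /= cats1. Qed.

Lemma orbit_walk_cons (s : nat) (q : int * int) :
  orbit_walk s.+1 q = ef q.1 :: orbit_walk s (F q).
Proof.
rewrite /orbit_walk /= (iotaDl 1 0 s) -map_comp; congr cons.
by apply: eq_map => j /=; rewrite -iterSr.
Qed.

Lemma orbit_walk_turn (s : nat) (q : int * int) : (iter s F q).1 - q.1 =
  (ar (iter s F q).1 : nat)%:Z - (ar q.1 : nat)%:Z - ext (orbit_walk s q) * n%:Z.
Proof.
rewrite ext_turn; elim: s => [|s IH]; first by rewrite big_nil mul0r subr0 !subrr.
rewrite orbit_walkS -cats1 big_cat big_seq1 iterS mulrDl.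
have h := ef_turn (iter s F q).1 (iter s F q).2; rewrite -surjective_pairing in h.
have -> : (F (iter s F q)).1 - q.1 =
  ((F (iter s F q)).1 - (iter s F q).1) + ((iter s F q).1 - q.1) by rewrite addrA subrK.
by rewrite h IH; ring.
Qed.

Lemma orbit_walk_path (m i : nat) (q : int * int) :
  path (@consecutive R N) (ef (iter i F q).1) [seq ef (iter j F q).1 | j <- iota i.+1 m].
Proof.
elim: m i => //= m IH i; have /= -> := IH i.+1.
by rewrite andbT /consecutive ef_src (ef_dst _ (iter i F q).2) -surjective_pairing.
Qed.

(** The edge is the one that [ef] prescribes at any lift of its source; boolean, for use with
    [all]. *)
Definition follows (e : edge N) : bool := `[< forall a : int, src e = ar a -> e = ef a >].

Lemma orbit_of_path (e : edge N) (W : seq (edge N)) (q : int * int) :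
  path (@consecutive R N) e W -> all follows (e :: W) -> src e = ar q.1 ->
  e :: W = orbit_walk (size W).+1 q /\ dst (last e W) = ar (iter (size W).+1 F q).1.
Proof.
elim: W e q => [|e' W IH] e q /=.
  move=> _ /andP[/asboolP h _] sq; rewrite /orbit_walk /= (h q.1) //.
  by rewrite (ef_dst _ q.2) -surjective_pairing.
move=> /andP[/eqP c p] /andP[/asboolP h h'] sq.
have ee : e = ef q.1 by apply: h.
have sq' : src e' = ar (F q).1.
  by rewrite -c ee (ef_dst _ q.2) -surjective_pairing.
have [h1 h2] := IH e' (F q) p h' sq'; split; last by rewrite h2 -iterSr.
by rewrite h1 ee [RHS]orbit_walk_cons.
Qed.

Lemma ar_orbit (i : nat) (p q : int * int) :
  ar p.1 = ar q.1 -> ar (iter i F p).1 = ar (iter i F q).1.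
Proof.
move=> /eqP/ar_eqP [w e]; have -> : q = sh n w (q.2 - p.2) p.
  by rewrite /sh -e addrC subrK -surjective_pairing.
by rewrite iter_sh // /sh /= ar_shift.
Qed.

Lemma walk_cycle (W : seq (edge N)) (v : 'I_n) : cycle_walk k W ->
  all follows W -> v \in map (@src R N) W ->
  exists (s : nat) (e : int), (0 < s)%N /\
    iter s F ((v : nat)%:Z, 0) = sh n (- ext W) e ((v : nat)%:Z, 0).
Proof.
case: W => [|e0 W]; first by case/and4P.
move=> /and4P[_ _ cyc _] h vW; move: cyc; rewrite /= rcons_path => /andP[p c].
pose q := ((src e0 : nat)%:Z, 0 : int); have sq : src e0 = ar q.1 by rewrite ar_ord.
have [eW lW] := orbit_of_path p h sq.
move: lW; rewrite (eqP c) sq => lW; set s := (size W).+1 in eW lW.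
have e1 := orbit_walk_turn s q; rewrite -lW subrr sub0r -eW in e1.
have e2 : iter s F q = sh n (- ext (e0 :: W)) ((iter s F q).2 - q.2) q.
  rewrite /sh mulNr -e1 addrC subrK addrC subrK; exact: surjective_pairing.
have [i hv] : exists i, v = ar (iter i F q).1.
  by move: vW; rewrite eW /orbit_walk -map_comp => /mapP[i _ ->]; exists i; rewrite /= ef_src.
exists s, ((iter s F q).2 - q.2); split=> //.
have /eqP/ar_eqP [w ew] : ar (iter i F q).1 = ar (v : nat)%:Z by rewrite ar_ord.
have -> : ((v : nat)%:Z, 0 : int) = sh n w (- (iter i F q).2) (iter i F q).
  by rewrite /sh -ew subrr.
by rewrite iter_sh // (sh_shift (n := n) i F_sh e2) !(sh_add fL); congr sh; lia.
Qed.

(** The first return to the residue of b, after m steps, makes the vertices distinct. As m may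
    differ from s, ext and w are compared through the common iterate m s. *)
Lemma orbit_walk_cycle (s : nat) (b w e : int) : (0 < s)%N ->
  iter s F (b, 0) = sh n w e (b, 0) ->
  exists (W : seq (edge N)) (s0 : nat), [/\ cycle_walk k W, (0 < s0)%N,
    W = orbit_walk s0 (b, 0),
    ar b \in map (@src R N) W & - ext W * s%:Z = w * s0%:Z].
Proof.
move=> s0 bs; pose q := (b, 0 : int).
have ex : exists i, (0 < i)%N && (ar (iter i F q).1 == ar b).
  by exists s; rewrite s0 /q bs /sh /= ar_shift eqxx.
case: (ex_minnP ex) => m /andP[m0 /eqP mb] mmin.
pose W := orbit_walk m q.
have e1 := orbit_walk_turn m q; rewrite mb subrr sub0r -/W in e1.
have e2 : iter m F q = sh n (- ext W) ((iter m F q).2 - q.2) q.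
  rewrite /sh mulNr -e1 addrC subrK addrC subrK; exact: surjective_pairing.
exists W, m; split=> //.
- apply/and4P; split; first by rewrite size_map size_iota.
  + by rewrite all_map; apply/allP => i _; exact: ef_synth.
  + rewrite /W /orbit_walk -(prednK m0) /= rcons_path.
    have := orbit_walk_path m.-1 0 q; rewrite /= => -> /=.
    have -> : last (ef q.1) [seq ef (iter i F q).1 | i <- iota 1 m.-1] = ef (iter m.-1 F q).1.
      rewrite -[ef q.1]/((fun i => ef (iter i F q).1) 0%N) last_map.
      have last_iota (r i : nat) : last i (iota i.+1 r) = (i + r)%N.
        by elim: r i => [|r IH] i /=; rewrite ?addn0 // IH addSnnS.
      by rewrite last_iota.
    rewrite /consecutive ef_src (ef_dst _ (iter m.-1 F q).2) -surjective_pairing.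
    by rewrite -iterS prednK // mb.
  + rewrite /W /orbit_walk -map_comp map_inj_in_uniq ?iota_uniq // => i j.
    rewrite !mem_iota !add0n /= !ef_src => im jm eij.
    wlog ij : i j im jm eij / (i < j)%N => [th|].
      by have [ij|ij|//] := ltngtP i j; [exact: th|apply/esym/th].
    have lt : (m <= m - j + i)%N; last by lia.
    apply: mmin; apply/andP; split; first by lia.
    rewrite iterD (ar_orbit _ eij) -iterD subnK ?mb //; lia.
- rewrite /W /orbit_walk -map_comp; apply/mapP; exists 0%N; first by rewrite mem_iota.
  by rewrite /= ef_src.
- have h1 := iter_cycle fL F_sh s e2; have h2 := iter_cycle fL F_sh m bs.
  rewrite mulnC in h2; rewrite h2 in h1; move: h1 => /(congr1 fst) /addrI /mulIf h.
  by rewrite mulrC [RHS]mulrC; apply/esym/h; rewrite eqz_nat; lia.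
Qed.
End Orbits.

Lemma nedge_src (a : int) : src (nedge a) = ar a.
Proof. by rewrite /nedge; case: ifP. Qed.

Lemma hedge_src (a : int) : src (hedge a) = ar a.
Proof. by rewrite /hedge; case: ifP. Qed.

Lemma nedge_dst (a t : int) : dst (nedge a) = ar (nstep f k (a, t)).1.
Proof. by rewrite /nedge /nstep /=; case: ifP. Qed.

Lemma hedge_dst (a t : int) : dst (hedge a) = ar (hstep f k (a, t)).1.
Proof. by rewrite /hedge /hstep /=; case: ifP. Qed.

Lemma nedge_turn (a t : int) : (nstep f k (a, t)).1 - a =
  (ar (nstep f k (a, t)).1 : nat)%:Z - (ar a : nat)%:Z - turn (nedge a) * n%:Z.
Proof.
by rewrite /nedge /nstep; case: ifP => _; [exact: nose_turn|exact: hollow_turn].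
Qed.

Lemma hedge_turn (a t : int) : (hstep f k (a, t)).1 - a =
  (ar (hstep f k (a, t)).1 : nat)%:Z - (ar a : nat)%:Z - turn (hedge a) * n%:Z.
Proof.
by rewrite /hedge /hstep; case: ifP => _; [exact: hollow_turn|exact: nose_turn].
Qed.

Lemma greedy_nose_follows (W : seq (edge N)) : all (synth k) W -> greedy_nose k W ->
  all (follows nedge) W.
Proof.
rewrite /greedy_nose; elim: W => //= e W IH /andP[se sW] /andP[ge gW].
rewrite IH // andbT; apply/asboolP => a; exact: greedy_nose_edge.
Qed.

Lemma greedy_hollow_follows (W : seq (edge N)) : all (synth k) W -> greedy_hollow k W ->
  all (follows hedge) W.
Proof.
rewrite /greedy_hollow; elim: W => //= e W IH /andP[se sW] /andP[ge gW].
rewrite IH // andbT; apply/asboolP => a; exact: greedy_hollow_edge.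
Qed.

Lemma greedy_nose_orbit (s : nat) (q : int * int) :
  greedy_nose k (orbit_walk (nstep f k) nedge s q).
Proof.
rewrite /greedy_nose /orbit_walk all_map; apply/allP => i _ /=.
by rewrite nedge_src starts_nose_ar /nedge; case: ifP.
Qed.

Lemma greedy_hollow_orbit (s : nat) (q : int * int) :
  greedy_hollow k (orbit_walk (hstep f k) hedge s q).
Proof.
rewrite /greedy_hollow /orbit_walk all_map; apply/allP => i _ /=.
by rewrite hedge_src starts_hollow_ar /hedge; case: ifP.
Qed.

Lemma shared_cyclesP : shared_cycles n f k <-> exists WN WH : seq (edge N),
  [/\ [/\ cycle_walk k WN, greedy_nose k WN & ext WN < 0],
      [/\ cycle_walk k WH, greedy_hollow k WH & ext WH > 0] &
      exists v : 'I_n, v \in map (@src R N) WN /\ v \in map (@src R N) WH].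
Proof.
have nsh := nstep_sh fL k; have hsh := hstep_sh fL k.
split=> [[b [s [s' [w [w' [e [e' [[s0 w0 h] [s'0 w'0 h']]]]]]]]]|].
  have [WN [m [cN m0 WNE bN eN]]] :=
    orbit_walk_cycle nsh nedge_src nedge_dst nedge_turn synth_nedge s0 h.
  have [WH [m' [cH m'0 WHE bH eH]]] :=
    orbit_walk_cycle hsh hedge_src hedge_dst hedge_turn synth_hedge s'0 h'.
  exists WN, WH; split; last by exists (ar b).
    split=> //; first by rewrite WNE; exact: greedy_nose_orbit.
    have : 0 < - ext WN * s%:Z by rewrite eN; apply: mulr_gt0; lia.
    by rewrite pmulr_lgt0; lia.
  split=> //; first by rewrite WHE; exact: greedy_hollow_orbit.
  have : - ext WH * s'%:Z < 0 by rewrite eH nmulr_rlt0; lia.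
  by rewrite pmulr_llt0; lia.
move=> [WN [WH [[cN gN eN] [cH gH eH] [v [vN vH]]]]].
have aN : all (synth k) WN by case/and4P: cN.
have aH : all (synth k) WH by case/and4P: cH.
have [s [e [s0 h]]] := walk_cycle nsh nedge_src nedge_dst nedge_turn cN
  (greedy_nose_follows aN gN) vN.
have [s' [e' [s'0 h']]] := walk_cycle hsh hedge_src hedge_dst hedge_turn cH
  (greedy_hollow_follows aH gH) vH.
exists (v : nat)%:Z, s, s', (- ext WN), (- ext WH), e, e'.
by split; split; rewrite ?oppr_gt0 ?oppr_lt0.
Qed.

(** * Rows *)

Lemma iter_lt_mono (i j : nat) (a : int) : (i < j)%N -> iter i f a < iter j f a.
Proof.
move=> ij; have := iter_ge fL (j - i) (iter i f a).
by rewrite -iterD (subnK (ltnW ij)); lia.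
Qed.

Lemma row_uniq (r r' : nat) (a : int) : iter r f (-1) < a <= iter r.+1 f (-1) ->
  iter r' f (-1) < a <= iter r'.+1 f (-1) -> r = r'.
Proof.
move=> /andP[h1 h2] /andP[h3 h4]; have [lt|lt|//] := ltngtP r r'.
  have : iter r.+1 f (-1) <= iter r' f (-1).
    by move: lt; rewrite leq_eqVlt => /orP[/eqP ->|/iter_lt_mono/ltW].
  by lia.
have : iter r'.+1 f (-1) <= iter r f (-1).
  by move: lt; rewrite leq_eqVlt => /orP[/eqP ->|/iter_lt_mono/ltW].
by lia.
Qed.

Lemma ar_small (i : int) : 0 <= i < n%:Z -> ((ar i : nat) : int) = i.
Proof. by move=> h; rewrite ar_val modz_small. Qed.

(** Rows are the intervals between iterates of -1, the place just before the initial arc. Opening a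
    row from g a to a matches one application of [f]. Staying in the row of a - 1 could fail only if
    a - 1 is an iterate of -1, and then a = H_r(g a). *)
Lemma arow_spec (a : 'I_n) :
  iter (arow a) f (-1) < (a : nat)%:Z <= iter (arow a).+1 f (-1).
Proof.
have [m] := ubnP (a : nat); elim: m a => // m IH a; rewrite ltnS => am.
have f1 : 0 <= f (-1) by have := f_gt (-1); lia.
rewrite arowE; case: eqVneq => [->|a0] //=.
have HrE (b : 'I_n) : (b < a)%N && (Hr b == Some a) <->
    (b : nat)%:Z = g (a : nat)%:Z /\ g ((a : nat)%:Z - 1) < g (a : nat)%:Z.
  rewrite -{2}(ar_ord n0 b); have gA := g_gt (a : nat)%:Z; have gL := g_lt fL (a : nat)%:Z.
  have an := ltn_ord a; have bn := ltn_ord b.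
  split=> [/andP[ba /eqP/Hr_ar[y [ay gy gy']]]|[e lt]].
    have /eqP/ar_eqP[w e] : ar (a : nat)%:Z = ar y by rewrite ar_ord.
    have gE (z : int) : g (z + w * n%:Z) = g z + w * n%:Z.
      by apply: shift_mulz => z'; exact: (g_per fL).
    rewrite e gE in gy; rewrite e addrAC gE -gy ltrD2r in gy'.
    split=> //; have [w0|w0|w0] := ltgtP w 0; last by rewrite w0 mul0r addr0 in gy.
      have : w * n%:Z <= -1 * n%:Z by apply: ler_wpM2r; lia.
      by lia.
    have : 1 * n%:Z <= w * n%:Z by apply: ler_wpM2r; lia.
    by lia.
  apply/andP; split; first by lia.
  by apply/eqP/Hr_ar; exists (a : nat)%:Z; rewrite ar_ord e.
case: pickP => [b /HrE[e lt]|no].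
  have bm : (b < m)%N by have := g_lt fL (a : nat)%:Z; lia.
  have /andP[lb hb] := IH b bm; rewrite e in lb hb.
  apply/andP; split; last by apply: le_trans (f_g fL _) _; exact: fm.
  have : f (g (a : nat)%:Z - 1) < (a : nat)%:Z by rewrite ltF; lia.
  by apply: le_lt_trans; rewrite iterS; apply: fm; lia.
have an := ltn_ord a; have La : ((Lf a : nat) : int) = (a : nat)%:Z - 1.
  rewrite -{1}(ar_ord n0 a) Lf_ar ar_small //; lia.
have Lm : (Lf a < m)%N by lia.
have := IH (Lf a) Lm; rewrite La; set r := arow (Lf a) => /andP[h1 h2].
apply/andP; split; first by lia.
rewrite leNgt; apply/negP => h3; rewrite -iterS in h3.
have fz : iter r.+1 f (-1) = (a : nat)%:Z - 1 by lia.
have z1 : -1 <= iter r f (-1) by have := iter_ge fL r (-1); lia.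
have ga : iter r f (-1) < g (a : nat)%:Z by rewrite -ltF -iterS fz; lia.
have ga' : g ((a : nat)%:Z - 1) <= iter r f (-1) by rewrite -leF -iterS fz.
have gl := g_lt fL (a : nat)%:Z.
have /negP := no (ar (g (a : nat)%:Z)); apply; apply/HrE.
by rewrite ar_small; [split=> //; lia|lia].
Qed.

Lemma arow_ar (r : nat) (a : int) : 0 <= a < n%:Z ->
  iter r f (-1) < a <= iter r.+1 f (-1) -> arow (ar a) = r.
Proof.
by move=> h hr; apply: (row_uniq (arow_spec (ar a))); rewrite ar_small.
Qed.

Lemma jump_hollow (a : int) : inim f a -> 0 <= g a -> a < n%:Z -> jump (hollow_at a) = -1.
Proof.
move=> im g0 an; have gl := g_lt fL a; rewrite /jump /=.
have /andP[h1 h2] := arow_spec (ar (g a)); set r := arow (ar (g a)) in h1 h2 *.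
rewrite ar_small in h1 h2; last by lia.
have -> : arow (ar a) = r.+1; last by lia.
apply: arow_ar; first by lia.
rewrite -[in X in X && _](f_gK im) -[in X in _ && X](f_gK im); apply/andP; split; last exact: fm.
have : f (g a - 1) < a by rewrite ltF; lia.
by rewrite f_gK //; apply: le_lt_trans; rewrite iterS; apply: fm; lia.
Qed.

(** As a lies strictly before the end of its row, [tops_lt] keeps f^i a strictly before the end of
    the row i higher, so the extra step of the nose does not leave that row. *)
Lemma jump_nose (a : int) : 0 <= a -> mnose f k a < n%:Z ->
  a < iter (arow (ar a)).+1 f (-1) -> jump (nose_at a) = (nidx f k a)%:Z.
Proof.
move=> a0 mn lt; have mg := mnose_gt fL k a; rewrite /jump /=.
have /andP[h1 h2] := arow_spec (ar a); set r := arow (ar a) in h1 h2 lt *.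
rewrite ar_small in h1 h2; last by lia.
have -> : arow (ar (mnose f k a)) = (nidx f k a + r)%N; last by lia.
apply: arow_ar; first by lia.
rewrite /mnose -addnS !iterD ltzD1 lezD1 (iter_mono fL) ?(ltW h1) //=.
by have := tops_lt fL (@nidx_tops f k a) lt.
Qed.

Lemma internal_hollow (a : int) : 0 <= a < n%:Z -> internal (hollow_at a) -> 0 <= g a.
Proof.
move=> an ia; have lt : (ar (g a) < ar a)%N := ia.
rewrite leNgt; apply/negP => g0.
have gA := g_gt a; have e : ar (g a) = ar (g a + n%:Z).
  by rewrite -[X in g a + X]mul1r ar_shift.
have h1 : ((ar (g a) : nat) : int) = g a + n%:Z by rewrite e ar_small; lia.
have h2 := ar_small an; lia.
Qed.

Lemma internal_nose (a : int) : 0 <= a < n%:Z -> internal (nose_at a) -> mnose f k a < n%:Z.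
Proof.
move=> an ia; have lt : (ar a < ar (mnose f k a))%N := ia.
rewrite ltNge; apply/negP => mn.
have /andP[m1 m2] := mnose_range a.
have e : ar (mnose f k a) = ar (mnose f k a - n%:Z).
  by rewrite -[X in _ - X]mul1r -mulNr ar_shift.
have h1 : ((ar (mnose f k a) : nat) : int) = mnose f k a - n%:Z by rewrite e ar_small; lia.
have h2 := ar_small an; lia.
Qed.

Lemma edge_cases (e : edge N) : synth k e -> exists2 a : int, 0 <= a < n%:Z &
  (e = hollow_at a /\ inim f a) \/ (e = nose_at a /\ has_nose f k a).
Proof.
case: e => s [|j] d; rewrite -(ar_ord n0 s) => se; exists (s : nat)%:Z; try by have := ltn_ord s; lia.
  by left; have /synth_hollow[im ->] := se.
by right; have /synth_nose[hn -> ->] := se.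
Qed.

Lemma forward_nose (a : int) : 0 <= a < n%:Z -> forward (nose_at a) ->
  [/\ mnose f k a < n%:Z & a < iter (arow (ar a)).+1 f (-1)].
Proof.
move=> an /andP[ia]; rewrite /backward ia /= => /forallPn [b].
rewrite negb_imply -ltnNge => /andP[/eqP rb ab]; split; first exact: internal_nose.
have /andP[_] := arow_spec b; rewrite rb; apply: lt_le_trans.
by rewrite -{1}(ar_small an) ltz_nat.
Qed.

Lemma nose_forward (a : int) : 0 <= a -> mnose f k a < n%:Z ->
  (forall r, a <> iter r f (-1)) -> forward (nose_at a).
Proof.
move=> a0 mn na; have mg := mnose_gt fL k a; have an : 0 <= a < n%:Z by lia.
have ia : internal (nose_at a) by rewrite /internal /= -ltz_nat !ar_small //; lia.
rewrite /forward /backward ia /=; apply/forallPn; exists (ar (a + 1)).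
rewrite negb_imply -ltnNge -ltz_nat !ar_small //; try lia.
rewrite ltrDl andbT; apply/eqP/arow_ar; first by lia.
have /andP[h1 h2] := arow_spec (ar a); rewrite ar_small // in h1 h2.
have := na (arow (ar a)).+1; lia.
Qed.

Lemma hollow_forward (a : int) : 0 <= g a -> a < n%:Z -> forward (hollow_at a).
Proof.
move=> g0 an; have gl := g_lt fL a.
by rewrite /forward /backward /nose_edge /= andbT /internal /= -ltz_nat !ar_small //; lia.
Qed.

Section Height.
Variables (c l : int) (u : int -> int).
Hypothesis l0 : 0 < l.
Hypothesis u_mono : forall a b : int, a <= b -> u a <= u b.
Hypothesis u_f : forall a : int, u (f a) <= u a + l.
Hypothesis u_nose : forall (a : int) (j : nat), (j <= k)%N ->
  u a + j%:Z * l + 2 <= u (iter j f a + 1).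

(** Here m is 1 for a nose, which gains 2 in height and at most k rows, and 0 for a hollow. *)
Lemma forward_climb (e : edge N) : synth k e -> forward e -> exists m : nat,
  u (src e : nat)%:Z + jump e * l + 2 * m%:Z <= u (dst e : nat)%:Z /\
  jump e <= k%:Z * m%:Z.
Proof.
move=> se fe; have [a an [[ee im]|[ee hn]]] := edge_cases se; move: fe; rewrite ee => fe.
  have g0 : 0 <= g a by apply: internal_hollow => //; case/andP: fe.
  have gl := g_lt fL a; exists 0%N.
  rewrite jump_hollow //=; last by case/andP: an.
  rewrite !ar_small //; last by lia.
  by have := u_f (g a); rewrite f_gK //; lia.
have [mn lt] := forward_nose an fe; have /andP[a0 _] := an; exists 1%N.
have mg := mnose_gt fL k a.
rewrite jump_nose //= !ar_small //; last by lia.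
by have := u_nose a (nidx_le f k a); have := nidx_le f k a; rewrite -/(mnose f k a); lia.
Qed.

Lemma path_climb (e : edge N) (T : seq (edge N)) : all (synth k) (e :: T) ->
  path (@consecutive R N) e T -> all (@forward R N) (e :: T) -> exists m : nat,
  [/\ u (src e : nat)%:Z + walk_jump (e :: T) * l + 2 * m%:Z <= u (dst (last e T) : nat)%:Z,
      walk_jump (e :: T) <= k%:Z * m%:Z &
      walk_jump (e :: T) = (arow (dst (last e T)))%:Z - (arow (src e))%:Z].
Proof.
elim: T e => [|e' T IH] e.
  move=> /andP[se _] _ /andP[fe _]; have [m [h1 h2]] := forward_climb se fe.
  by exists m; rewrite /walk_jump big_seq1.
move=> /andP[se sT] /andP[/eqP c' p] /andP[fe fT].
have [m [h1 h2]] := forward_climb se fe; have [m' [h3 h4 h5]] := IH e' sT p fT.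
exists (m + m')%N; rewrite /walk_jump big_cons -/(walk_jump (e' :: T)) /=.
move: h3 h4 h5; rewrite -c'; set J := walk_jump _ => h3 h4 h5; split.
- by rewrite mulrDl PoszD mulrDr; lia.
- by rewrite PoszD mulrDr; lia.
- by rewrite h5 /jump; lia.
Qed.

(** Let the path have jump J and m noses. Its height grows by at least 2 m, but by at most [l],
    since both end arcs lie in the intervals of their rows. Hence m <= l, while J <= k m. *)
Lemma jump_bound (T : seq (edge N)) : walk k T -> all (@forward R N) T ->
  walk_jump T <= k%:Z * l.
Proof.
case: T => [|e T] /andP[sT p] fT; first by rewrite /walk_jump big_nil; apply: mulr_ge0; lia.
have [m [h1 h2 h3]] := path_climb sT p fT; set J := walk_jump _ in h1 h2 h3 *.
have [J0|J0] := leP J 0; first by apply: le_trans J0 _; apply: mulr_ge0; lia.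
have /andP[s1 _] := arow_spec (src e); have /andP[_ d2] := arow_spec (dst (last e T)).
set r := arow (src e) in s1 h3; set r' := arow (dst (last e T)) in d2 h3.
have rr : (r'.+1 = absz J + 1 + r)%N by lia.
have ui (a : int) (j : nat) : u (iter j f a) <= u a + j%:Z * l.
  elim: j => [|j IH]; first by rewrite mul0r addr0.
  by have := u_f (iter j f a); rewrite /= -addn1 PoszD mulrDl mul1r; lia.
have h4 := u_mono (ltW s1); have h5 := u_mono d2.
rewrite rr iterD in h5; have h6 := ui (iter r f (-1)) (absz J + 1)%N.
have JE : (absz J + 1)%N%:Z = J + 1 by lia.
rewrite JE mulrDl mul1r in h6.
have ml : m%:Z <= l by lia.
by apply: le_trans h2 _; apply: ler_wpM2l; lia.
Qed.
End Height.
End Covering.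

End Theory.
End Lift.

(** * Equivalence of models *)

Section Models.
Variable R : realType.

Lemma divz_shift (n : nat) (i w : int) : (0 < n)%N ->
  ((i + w * n%:Z) %/ n%:Z)%Z = (i %/ n%:Z)%Z + w.
Proof. by move=> n0; have nz : n%:Z != 0; [lia|rewrite [i + _]addrC divzMDl // addrC]. Qed.

(** * From proper models to lifts and back *)

Section OfPca.
Variable N : model R.
Hypothesis N_pca : pca N.
Hypothesis n0 : (0 < narc N)%N.
Notation n := (narc N).
Notation C := (clen N).
Notation ar := (ar n0).
Let C0 : 0 < C := pca_clen N_pca.

Let B (i : int) : R := beg (ar i) + (i %/ n%:Z)%Z%:~R * C.
Let E (i : int) : R :=
  fin (ar i) + ((i %/ n%:Z)%Z + (fin (ar i) < beg (ar i))%R%:Z)%:~R * C.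

Let Bper (i : int) : B (i + n%:Z) = B i + C.
Proof.
rewrite /B -[X in i + X]mul1r ar_shift divz_shift // intrD mulrDl mul1r.
by rewrite addrA.
Qed.

Let Eper (i : int) : E (i + n%:Z) = E i + C.
Proof.
rewrite /E -[X in i + X]mul1r ar_shift divz_shift // !intrD !mulrDl !mul1r.
by ring.
Qed.

Let Bord (a : 'I_n) : B (a : nat)%:Z = beg a.
Proof.
rewrite /B ar_ord divz_small; first by rewrite mul0r addr0.
by have := ltn_ord a; lia.
Qed.

Let Bmod (i : int) : beg (ar i) = modr (B i) C.
Proof.
rewrite /B modr_shift // modr_id //; exact: (pca_beg_point N_pca).
Qed.

Let Emod (i : int) : fin (ar i) = modr (E i) C.
Proof.
rewrite /E modr_shift // modr_id //; exact: (pca_fin_point N_pca).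
Qed.

Let Bstep (i : int) : B i < B (i + 1).
Proof.
have [w ->] := ar_decomp n0 i; set a := ar i.
rewrite addrAC !(shift_real _ _ Bper) ltrD2r Bord; have an := ltn_ord a.
have [lt|ge] := ltnP a.+1 n.
  have -> : (a : nat)%:Z + 1 = (Ordinal lt : nat)%:Z by rewrite /=; lia.
  by rewrite Bord; apply: (pca_sorted N_pca) => /=.
have e : a.+1 = n by apply/eqP; rewrite eqn_leq an ge.
have -> : (a : nat)%:Z + 1 = (Ordinal n0 : nat)%:Z + n%:Z.
  by rewrite [RHS]add0r -[X in _ = X%:Z]e -addn1 PoszD.
rewrite Bper Bord; have /andP[_ h1] := pca_beg_point N_pca a.
have /andP[h2 _] := pca_beg_point N_pca (Ordinal n0).
by apply: lt_le_trans h1 _; rewrite lerDr.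
Qed.

Let arc_bounds (i : int) : B i < E i < B i + C.
Proof.
rewrite /B /E intrD mulrDl addrAC addrA; set w := _%:~R * C.
have /andP[b0 b1] := pca_beg_point N_pca (ar i).
have /andP[e0 e1] := pca_fin_point N_pca (ar i).
have ne := pca_beg_fin N_pca (i := ar i) (j := ar i).
have [lt|gt|e] := ltgtP (fin (ar i)) (beg (ar i)); last by case: ne.
  by rewrite mul1r; lra.
by rewrite mul0r; lra.
Qed.

(** Were E (i + 1) smaller, arc i + 1 would begin later and end earlier than arc i, against
    properness. With a single arc, E (i + 1) is E i plus a turn. *)
Let Estep (i : int) : E i < E (i + 1).
Proof.
have [n1|n1] := eqVneq n 1%N.
  by have := Eper i; rewrite n1 => ->; rewrite ltrDl.
have ne : ar i <> ar (i + 1).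
  move=> /eqP/ar_eqP[w /addrI e].
  have [w0|w0] := leP w 0; first by have : w * n%:Z <= 0; [apply: mulr_le0_ge0|]; lia.
  by have : 1 * n%:Z <= w * n%:Z; [apply: ler_wpM2r|]; lia.
have Ene : E i <> E (i + 1).
  by move=> e; apply: ne; apply: (pca_fin_inj N_pca); rewrite !Emod e.
rewrite ltNge le_eqVlt; apply/negP => /orP[/eqP/esym //|lt].
apply: (pca_proper N_pca (i := ar (i + 1)) (j := ar i)); first by apply/nesym.
move=> x xC; have Bs := Bstep i; have /andP[_ e1] := arc_bounds i.
rewrite -(modr_id xC) !Bmod !Emod !in_arc_modr ?arc_bounds //.
move=> -[w /andP[h1 h2]]; exists w; apply/andP; split; first by apply: lt_trans Bs h1.
exact: lt_trans h2 lt.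
Qed.

Lemma pca_lift : exists (B E : int -> R) (f : int -> int), lift N B E f.
Proof.
have Bm := step_mono Bstep; have Em := step_mono Estep.
have step (i : int) : exists j : int, (B j < E i < B (j + 1)) && (i <= j < i + n%:Z).
  have /andP[h1 h2] := arc_bounds i.
  have ex : exists m : nat, B (i + m%:Z) < E i by exists 0%N; rewrite addr0.
  have ub (m : nat) : B (i + m%:Z) < E i -> (m <= n.-1)%N.
    move=> h; rewrite leqNgt; apply/negP => nm.
    have : B (i + n%:Z) <= B (i + m%:Z).
      have [->//|/Bm/ltW//] : i + n%:Z = i + m%:Z \/ i + n%:Z < i + m%:Z by lia.
    by rewrite Bper; lra.
  case: (ex_maxnP ex ub) => m hm mmax; exists (i + m%:Z).
  have mn := ub m hm; rewrite hm /=; apply/andP; split; last by lia.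
  rewrite ltNge le_eqVlt -addrA -PoszD addn1; apply/negP => /orP[/eqP e|/mmax]; last by lia.
  apply: (pca_beg_fin N_pca (i := ar (i + m.+1%:Z)) (j := ar i)).
  by rewrite Bmod Emod e.
have [f hf] := choice step.
exists B, E, f; split=> //.
- have := Bord (Ordinal n0); rewrite /= => ->.
  by case/andP: (pca_beg_point N_pca (Ordinal n0)).
- have lt : (n.-1 < n)%N by rewrite prednK.
  have := Bper (-1); have -> : -1 + n%:Z = (Ordinal lt : nat)%:Z by rewrite /=; lia.
  by rewrite Bord; have /andP[_ h] := pca_beg_point N_pca (Ordinal lt); lra.
- by move=> a; rewrite -{1}(ar_ord n0 a) Emod.
- by move=> i; case/andP: (hf i).
- by move=> i; case/andP: (hf i).
Qed.
End OfPca.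

Lemma lift_pca (N : model R) (B E : int -> R) (f : int -> int) : lift N B E f -> pca N.
Proof.
move=> H; have C0 := lift_c H; set C := clen N in C0 *.
have finE (a : 'I_(narc N)) : on_circle N (fin a).
  by rewrite (lift_fin H); exact: modr_bounds.
split=> //.
- by move=> a; rewrite (lift_beg H); exact: (lift_B_circle H).
- by move=> a b ab; rewrite !(lift_beg H) (lift_ltB H) ltz_nat.
- exact: lift_fin_inj H.
- move=> a b; rewrite -(ar_ord (lift_n H) a) -(ar_ord (lift_n H) b).
  rewrite (lift_beg_ar H) (lift_fin_ar H) => /modr_inj [w]; rewrite -(lift_Bshift H) => e.
  have := lift_f H (b : nat)%:Z; rewrite e !(lift_ltB H); lia.
- move=> a b ab incl.
  have [w hw] : exists w : int, (b : nat)%:Z + w * (narc N)%:Z < (a : nat)%:Z <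
      (b : nat)%:Z + w * (narc N)%:Z + (narc N)%:Z.
    have an := ltn_ord a; have bn := ltn_ord b.
    have [lt|gt|e] := ltngtP (a : nat) b; last by case: ab; apply: val_inj.
      by exists (-1); lia.
    by exists 0; lia.
  set b' := _ + _ in hw; set a' : int := (a : nat) in hw.
  have arb : b = ar (lift_n H) b' by rewrite ar_shift ar_ord.
  have ara : a = ar (lift_n H) a' by rewrite ar_ord.
  move/andP: hw => [ba ab'].
  have inb (x : R) : B a' < x < E a' -> exists v : int, B b' < x + v%:~R * C < E b'.
    move=> hx; have := incl (modr x C); rewrite {1}ara {1}ara {1}arb {1}arb.
    rewrite !(lift_beg_ar H) !(lift_fin_ar H) !in_arc_modr //; try exact: (lift_arc H).
    by apply; [exact: modr_bounds|exists 0; rewrite mul0r addr0].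
  have /andP[a1 a2] := lift_arc H a'; have /andP[b1 b2] := lift_arc H b'.
  rewrite -/C in a2 b2; have hB : B b' < B a' by rewrite (lift_ltB H).
  have hB' : B a' < B b' + C by rewrite -(lift_Bper H) (lift_ltB H).
  have hE : E b' < E a' by rewrite (lift_ltE H).
  (* If a reaches past the next copy of b, the beginning point of that copy is in a but not in the
     open arc b; otherwise a point just before the end of a is. *)
  have [lt|le] := ltP (B b' + C) (E a').
    have [|v hv] := inb (B b' + C); first by rewrite hB' lt.
    have [v0|v0|v0|v0] := turn_cases v C0; rewrite ?v0 ?mul0r ?mul1r in hv; lra.
  pose m := Num.max (E b') (B a').
  have m1 : m < E a' by rewrite gt_max hE a1.
  have m2 : E b' <= m by rewrite le_max lexx.
  have m3 : B a' <= m by rewrite le_max lexx orbT.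
  have [|v hv] := inb ((m + E a') / 2); first by lra.
  by have [v0|v0|v0|v0] := turn_cases v C0; rewrite ?v0 ?mul0r ?mul1r in hv; lra.
Qed.

(** Unrolling leaves the cover as it is and only lengthens the period. *)
Lemma lift_unroll (N : model R) (B E : int -> R) (f : int -> int) (lam : nat) :
  lift N B E f -> (0 < lam)%N -> lift (unroll lam N) B E f.
Proof.
move=> H lam0; have n0 := lift_n H; have C0 := lift_c H.
have lamn : (lam * narc N)%N%:Z = lam%:Z * (narc N)%:Z by rewrite PoszM.
have lamC : lam%:Z%:~R * clen N = lam%:R * clen N by [].
have baseE (m : 'I_(lam * narc N)) :
    (m : nat)%:Z = (base m : nat)%:Z + (m %/ narc N)%N%:Z * (narc N)%:Z.
  by rewrite /= {1}(divn_eq m (narc N)) PoszD PoszM addrC.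
have finE (a : 'I_(narc N)) : E (a : nat)%:Z = fin a + (fin a < beg a)%R%:R * clen N.
  have /andP[h1 h2] := lift_arc H (a : nat)%:Z.
  have /andP[b0 b1] := lift_B_circle H a.
  rewrite (lift_fin H) (lift_beg H); have [lt|ge] := ltP (E (a : nat)%:Z) (clen N).
    rewrite modr_id; last by lra.
    by rewrite ltNge (ltW h1) /= mul0r addr0.
  have -> : modr (E (a : nat)%:Z) (clen N) = E (a : nat)%:Z - clen N.
    rewrite -[RHS](@modr_id _ _ (clen N)); last by lra.
    by rewrite -(modr_shift _ (- 1) C0) intrN mulN1r.
  have -> : E (a : nat)%:Z - clen N < B (a : nat)%:Z by lra.
  by rewrite mul1r subrK.
split=> /=.
- by rewrite muln_gt0 lam0.
- by rewrite mulr_gt0 // ltr0n.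
- by move=> i; rewrite lamn (lift_Bshift H) lamC.
- by move=> i; rewrite lamn (lift_Eshift H) lamC.
- exact: (lift_Bmono H).
- exact: (lift_Emono H).
- exact: (lift_B0 H).
- exact: (lift_B1 H).
- by move=> m; rewrite (baseE m) (lift_Bshift H) (lift_beg H).
- move=> m; rewrite (baseE m) (lift_Eshift H) finE natrD mulrDr; congr modr.
  rewrite -[(m %/ narc N)%N%:Z%:~R]/((m %/ narc N)%N%:R).
  by rewrite addrAC -addrA -mulrDl [_ * clen N]mulrC mulrDr.
- exact: (lift_f H).
- move=> i; have /andP[h1 h2] := lift_range H i; rewrite h1 lamn /=.
  apply: lt_le_trans h2 _; rewrite lerD2l -[X in X <= _]mul1r ler_wpM2r //; lia.
Qed.

(** * The order of the extremes determines the lift of F_r, and conversely *)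

Section Keys.
Variables (T : finType) (key : T -> R).
Hypothesis key_inj : injective key.
Let s := sort (fun x y => key x <= key y) (enum T).

Lemma key_index (x y : T) : (key x <= key y) = (index x s <= index y s)%N.
Proof.
have tr : transitive (fun x y => key x <= key y) by move=> a b c; apply: le_trans.
have st : sorted (fun x y => key x <= key y) s.
  by apply: sort_sorted => a b; apply: le_total.
have ins z : z \in s by rewrite mem_sort mem_enum.
have rf : reflexive (fun x y => key x <= key y) by move=> z; apply: lexx.
apply/idP/idP => [xy|h]; last exact: (sorted_leq_index tr rf st _ _ (ins x) (ins y) h).
rewrite leqNgt; apply/negP => h.
have yx := sorted_ltn_index tr st _ _ (ins y) (ins x) h.
have e : x = y by apply: key_inj; apply/le_anti; rewrite xy.
by move: h; rewrite e ltnn.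
Qed.
End Keys.

Section Wrap.
Variables (N : model R) (B E : int -> R) (f : int -> int).
Hypothesis H : lift N B E f.
Notation n := (narc N).

Definition key (e : bool * 'I_n) : R := from_init N (expos e).

(* The representative of arc a whose ending point is less than a turn after B 0. *)
Definition wrapped (a : 'I_n) : int := a%:Z - ((n%:Z <= f a%:Z)%R)%:Z * n%:Z.

Lemma f_wrappedE (a : 'I_n) :
  f (wrapped a) = f a%:Z - ((n%:Z <= f a%:Z)%R)%:Z * n%:Z.
Proof.
rewrite /wrapped; case: (_ <= _); last by rewrite !mul0r !subr0.
by rewrite !mul1r -{2}(subrK n%:Z (a%:Z : int)) (lift_per H) addrK.
Qed.

Lemma f_wrapped (a : 'I_n) : 0 <= f (wrapped a) < n%:Z.
Proof.
have := lift_range H a%:Z; have an := ltn_ord a.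
by rewrite f_wrappedE; case: (leP n%:Z (f a%:Z)) => h /=; lia.
Qed.

Lemma keyE (e : bool * 'I_n) :
  key e = (if e.1 then E (wrapped e.2) else B e.2%:Z) - B 0.
Proof.
have n0 := lift_n H; have C0 := lift_c H.
rewrite /key /from_init insubT (lift_beg H) /=.
have B0 : B 0 = modr (B 0) (clen N).
  by rewrite modr_id //; exact: (lift_B_circle H (Ordinal n0)).
have Bn : B n%:Z = B 0 + clen N by rewrite -(lift_Bper H) add0r.
case: e => -[] a /=; last first.
  rewrite /expos /= (lift_beg H) {1}B0 -[X in cwdist _ _ X](@modr_id _ _ (clen N)).
    apply: cwdist_modr => //; have := lift_B_circle H a.
    have := lift_B0 H; have : B 0 <= B a%:Z by rewrite (lift_leB H).
    by have : B a%:Z < B n%:Z; [rewrite (lift_ltB H); have := ltn_ord a; lia|rewrite Bn; lra].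
  exact: (lift_B_circle H a).
rewrite /expos /= (lift_fin H) {1}B0.
have -> : modr (E a%:Z) (clen N) = modr (E (wrapped a)) (clen N).
  by rewrite /wrapped -mulNr (lift_Eshift H) modr_shift.
apply: cwdist_modr => //; rewrite -Bn (lift_ltEB H).
have /andP[h1 h2] := f_wrapped a; rewrite h2 andbT.
by apply: ltW; rewrite (lift_ltBE H).
Qed.

Lemma key_inj : injective key.
Proof.
move=> [[] a] [[] b]; rewrite !keyE /= => /addIr e.
- have {}e : wrapped a = wrapped b by apply/eqP; rewrite eq_le -!(lift_leE H) e lexx.
  congr (_, _); apply: val_inj => /=; have an := ltn_ord a; have bn := ltn_ord b.
  by move: e; rewrite /wrapped; case: (_ <= _); case: (_ <= _); rewrite ?mul1r ?mul0r => e; lia.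
- have := lift_f H (wrapped a); rewrite e !(lift_ltB H); lia.
- have := lift_f H (wrapped b); rewrite -e !(lift_ltB H); lia.
- have {}e : (a : nat)%:Z = (b : nat)%:Z by apply/eqP; rewrite eq_le -!(lift_leB H) e lexx.
  by congr (_, _); apply: val_inj; case: e.
Qed.

Lemma key_le (e e' : bool * 'I_n) : (key e <= key e') =
  match e.1, e'.1 with
  | false, false => (e.2 <= e'.2)%N
  | false, true => e.2%:Z <= f (wrapped e'.2)
  | true, false => f (wrapped e.2) < e'.2%:Z
  | true, true => wrapped e.2 <= wrapped e'.2
  end.
Proof.
have ne i j : B i <> E j.
  by move=> e0; have := lift_f H j; rewrite -e0 !(lift_ltB H); lia.
rewrite !keyE lerD2r; case: e e' => -[] a [[] b] /=.
- exact: (lift_leE H).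
- by rewrite -(lift_ltEB H) le_eqVlt; case: eqP => // /esym /ne.
- by rewrite -(lift_ltBE H) le_eqVlt; case: eqP => // /ne.
- by rewrite (lift_leB H) lez_nat.
Qed.

Lemma card_le_ord (m : nat) (z : int) : -1 <= z < m%:Z ->
  #|[set b : 'I_m | (b : nat)%:Z <= z]|%:Z = z + 1.
Proof.
move=> /andP[z1 zm]; have pm : (absz (z + 1)%R <= m)%N by lia.
have ep : (absz (z + 1)%R)%:Z = z + 1 by lia.
move: (absz _) pm ep => p pm ep; rewrite -ep -[in RHS](card_ord p); congr Posz.
have w_inj : injective (widen_ord pm) by move=> a b /(congr1 val) /= /ord_inj.
rewrite -(card_imset _ w_inj); apply: eq_card => b.
rewrite finset.in_set; apply/idP/imsetP => [bz|[i _ ->] /=].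
  have bp : (b < p)%N by lia.
  by exists (Ordinal bp) => //; apply: val_inj.
by have := ltn_ord i; lia.
Qed.

(** An invariant of the sequence of extremes: at an ending point it shows the value of [f] up to a
    turn. *)
Definition begs_before (e : bool * 'I_n) : nat :=
  #|[set b : 'I_n | key (false, b) <= key e]|.

Lemma begs_beforeE (e : bool * 'I_n) :
  (begs_before e)%:Z = (if e.1 then f (wrapped e.2) else e.2%:Z) + 1.
Proof.
rewrite -(@card_le_ord n).
  congr Posz; apply: eq_card => b; rewrite !finset.in_set key_le /=.
  by case: e => -[] a //=; rewrite lez_nat.
by case: e => -[] a /=; [have := f_wrapped a|have := ltn_ord a]; lia.
Qed.
End Wrap.

(** By [key_le], the order of the extremes depends on [f] alone. *)
Lemma lift_equivalent (X Y : model R) (BX EX BY EY : int -> R) (f : int -> int) :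
  lift X BX EX f -> lift Y BY EY f -> narc X = narc Y -> equivalent X Y.
Proof.
case: Y => c n b e HX HY /= nn; case: n / nn b e HY => b e HY.
exists id; first by exists id.
rewrite -[RHS](@map_id _); have -> : (fun e0 : bool * 'I_(narc X) => (e0.1, e0.2)) = id.
  by apply: funext => -[].
congr (map id (sort _ _)); apply/funext => x; apply/funext => y.
have hY := key_le HY x y; have hX := key_le HX x y.
by rewrite /key /= in hX hY; rewrite hX hY.
Qed.

(** The bijection preserves [begs_before], hence the numbers of the arcs and the values of [f] up to
    a turn; [lift_range] fixes the turn. *)
Lemma equivalent_lift (X Y : model R) (BX EX BY EY : int -> R) (f f' : int -> int) :
  lift X BX EX f -> lift Y BY EY f' -> equivalent X Y ->
  narc X = narc Y /\ f =1 f'.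
Proof.
move=> HX HY [g g_bij eg]; have g_inj := bij_inj g_bij.
have nn : narc X = narc Y by rewrite -(card_ord (narc X)) (bij_eq_card g_bij) card_ord.
pose h (e : bool * 'I_(narc X)) := (e.1, g e.2).
have h_inj : injective h by move=> [? ?] [? ?] [-> /g_inj ->].
have keyh x y : (key x <= key y) = (key (h x) <= key (h y)).
  rewrite (key_index (key_inj HX)) (key_index (key_inj HY)).
  by rewrite -[sort _ _ in RHS]eg !(index_map h_inj).
have bb e : begs_before e = begs_before (h e).
  rewrite /begs_before -(card_imset _ g_inj); apply: eq_card => b.
  have [g' gK g'K] := g_bij.
  rewrite finset.in_set -[b]g'K (mem_imset _ _ g_inj) finset.in_set; exact: keyh.
have gE (a : 'I_(narc X)) : (g a : nat)%:Z = (a : nat)%:Z.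
  have /(congr1 Posz) := bb (false, a).
  by rewrite (begs_beforeE HX) (begs_beforeE HY) /= => /addIr.
split=> // i; have [w ->] := ar_decomp (lift_n HX) i.
set a := ar _ _; have /(congr1 Posz) := bb (true, a).
rewrite (begs_beforeE HX) (begs_beforeE HY) /= => /addIr.
rewrite (f_wrappedE HX) (f_wrappedE HY) gE => e.
have fY (x : int) : f' (x + w * (narc X)%:Z) = f' x + w * (narc X)%:Z.
  by rewrite nn; apply: shift_mulz (lift_per HY).
have rX := lift_range HX (a : nat)%:Z; have rY := lift_range HY (a : nat)%:Z.
rewrite fY (shift_mulz _ _ (lift_per HX)); congr (_ + _).
move: e rX rY; rewrite -nn; move: (a : nat)%:Z => x.
by do 2 case: (_ <= _); rewrite ?mul1r ?mul0r; lia.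
Qed.

(** * Laps of F_r and the number omega *)

Section Spca.
Variables (N : model R) (B E : int -> R) (f : int -> int).
Hypothesis H : lift N B E f.
Notation n := (narc N).
Notation C := (clen N).

(** An arc that covers the ending point of a ends later than a, so it is a later arc, and it begins
    within the reach of a. *)
Lemma covers_gt : covers N -> forall a : int, a < f a.
Proof.
move=> cov a; have C0 := lift_c H.
have [i] := cov (modr (E a) C) (modr_bounds _ C0).
rewrite -(ar_ord (lift_n H) i) (lift_beg_ar H) (lift_fin_ar H).
move=> /(in_arc_modr _ C0 (lift_arc H _)) [w].
rewrite -(lift_Eshift H) (lift_ltE H) (lift_ltBE H).
set j := (i : nat)%:Z => /andP[h1 h2].
have : j - w * n%:Z <= f a.
  have := shift_mulz a w (lift_per H); lia.
by lia.
Qed.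

(** Up to a turn, A^w ends just after B m for some a <= m <= f a, and [small_eps] keeps this end
    before that of A. *)
Lemma wraps_of_lap (w : nat) (a : int) :
  a + n%:Z <= iter w f a <= f a + n%:Z -> power_wraps N w.
Proof.
move=> /andP[h1 h2]; have C0 := lift_c H.
have := lift_range H a; set m := iter w f a - n%:Z => fr.
have mE : iter w f a = m + 1 * n%:Z by rewrite /m; lia.
exists (ar (lift_n H) a) => x xC; rewrite -(modr_id xC) /= (Frj_ar H) mE ar_shift.
have [e0 he] := eps_spec N w.
have := he (ar (lift_n H) a) (true, ar (lift_n H) a); rewrite (Frj_ar H) mE ar_shift /expos /=.
have am : B a <= B m by rewrite (lift_leB H); lia.
have mE' : B m < E a by rewrite (lift_ltBE H); lia.
have /andP[_ aE] := lift_arc H a.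
rewrite (lift_beg_ar H m) (lift_beg_ar H) (lift_fin_ar H); set s := _.+1%:R.
have es : 0 < eps N w * s by rewrite mulr_gt0 // ltr0n.
rewrite cwdist_modr //; last by rewrite (ltW mE'); lra.
rewrite subr_gt0 mE' -ltNge => es'.
have -> : modr (modr (B m) C + eps N w * s) C = modr (B m + eps N w * s) C.
  by have [v ->] := modr_ex (B m) C; rewrite addrAC modr_shift.
rewrite !in_arc_modr //; [|exact: (lift_arc H)|lra].
by move=> [v hv]; exists v; lra.
Qed.

(** At the least j for which f^j completes a lap, f^(j-1) does not; so f^j i is at most f i + n,
    [wraps_of_lap] applies, and omega is at most j. *)
Lemma omega_range (k j : nat) (i : int) : ~~ pig N -> (k < omega N)%N -> (j <= k)%N ->
  iter j f i < i + n%:Z.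
Proof.
move=> npig; rewrite /omega (negbTE npig); set P := [set _ | _]%classic => ko.
have n0 := lift_n H.
elim/ltn_ind: j i => -[|[|j]] IH i jk; [rewrite /=; lia|by case/andP: (lift_range H i)|].
rewrite ltNge; apply/negP => lap.
have pw : power_wraps N j.+2.
  apply: (@wraps_of_lap _ i); rewrite lap /=.
  rewrite -(lift_per H); apply: (lift_mono H); apply: ltW.
  by apply: (IH j.+1) => //; lia.
have ex : exists w, P w.
  have ex1 : exists w, `[< (1 < w)%N /\ power_wraps N w >].
    by exists j.+2; apply/asboolP.
  case: (ex_minnP ex1) => w /asboolP [w1 wP] wmin.
  by exists w; split=> // v v1 vP; apply: wmin; apply/asboolP.
have [_ _ mn] := xgetPex 0%N ex.
have := mn j.+2 isT pw; lia.
Qed.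
End Spca.

Lemma spca_lift (M : model R) : spca M ->
  exists (B E : int -> R) (f : int -> int), lift M B E f /\ forall a : int, a < f a.
Proof.
move=> [Mp pl np]; have cov : covers M.
  by apply: contrapT => /pl; rewrite (negbTE np).
have n0 : (0 < narc M)%N.
  rewrite lt0n; apply: contra np => /eqP n0; apply/forallP => i.
  by exfalso; have := ltn_ord i; lia.
have [B [E [f H]]] := pca_lift Mp n0.
by exists B, E, f; split=> //; exact: (covers_gt H cov).
Qed.

Lemma lift_cwdist (N : model R) (B E : int -> R) (f : int -> int) (d : R) :
  lift N B E f -> (forall a : int, E a = B a + d) ->
  forall i : 'I_(narc N), cwdist (clen N) (beg i) (fin i) = d.
Proof.
move=> H Ed i; rewrite -(ar_ord (lift_n H) i) (lift_beg_ar H) (lift_fin_ar H).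
have /andP[h1 h2] := lift_arc H (i : nat)%:Z.
rewrite cwdist_modr; [by rewrite Ed; lra|exact: (lift_c H)|by rewrite (ltW h1)].
Qed.

Lemma lift_beg_unique (N : model R) (B E : int -> R) (f : int -> int) (a w : int) :
  forall H : lift N B E f, a = (ar (lift_n H) a : nat)%:Z + w * (narc N)%:Z ->
  B a = beg (ar (lift_n H) a) + w%:~R * clen N.
Proof. by move=> H {1}->; rewrite (lift_Bshift H) (lift_beg H). Qed.

Section IntegerModel.
Variables (n : nat) (c : int) (v f : int -> int).
Hypothesis n0 : (0 < n)%N.
Hypothesis v0 : v 0 = 0.
Hypothesis v_per : forall a : int, v (a + n%:Z) = v a + c.
Hypothesis v_step : forall a : int, v a < v (a + 1).

Lemma int_mono (a b : int) : a < b -> v a < v b.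
Proof.
have h : forall i : int, (v i)%:~R < (v (i + 1))%:~R :> R by move=> i; rewrite ltr_int.
by move=> /(step_mono h); rewrite ltr_int.
Qed.

Lemma int_lift (N : model R) (e : int) :
  narc N = n -> clen N = c%:~R ->
  (forall a : 'I_(narc N), beg a = (v (a : nat)%:Z)%:~R) ->
  (forall a : 'I_(narc N), fin a = modr (v (a : nat)%:Z + e)%:~R c%:~R) ->
  (forall a : int, v (f a) < v a + e < v (f a + 1)) ->
  (forall a : int, a <= f a < a + n%:Z) ->
  lift N (fun a => (v a)%:~R) (fun a => (v a + e)%:~R) f.
Proof.
move=> Nn Nc Nb Nf fe fr.
have c0 : 0 < c.
  have := v_per 0; rewrite add0r v0 add0r => <-; rewrite -v0; apply: int_mono; lia.
split; rewrite ?Nn ?Nc //.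
- by rewrite ltr0z.
- by move=> a; rewrite v_per intrD.
- by move=> a; rewrite v_per !intrD addrAC.
- by move=> a a' h; rewrite ltr_int; apply: int_mono.
- by move=> a a' h; rewrite ltr_int ltrD2r; apply: int_mono.
- by rewrite v0.
- by rewrite ltrz0; have := v_step (-1); rewrite addNr v0.
- by move=> a; rewrite !ltr_int.
Qed.
End IntegerModel.

(** * Multiplicative models *)

Section Multiplicative.
Variables (M : model R) (B E : int -> R) (f : int -> int) (k : nat).
Hypothesis H : lift M B E f.
Hypothesis f_gt : forall a : int, a < f a.
Hypothesis k_gt0 : (0 < k)%N.
Hypothesis k_range : forall (j : nat) (i : int), (j <= k)%N ->
  iter j f i < i + (narc M)%:Z.
Notation n := (narc M).

(** Take [u] as beginning points, moved so that A_0 begins at 0, and arcs of length l + 1. The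
    constraints put v a + i l + 1 strictly between v (f^i a) and v (f^i a + 1), which is why
    [feasible] asks for 2. So i x U has the lift f^i, as U^i has. *)
Lemma feasible_multiplicative : feasible n f k ->
  exists U : model R, k_multiplicative k U /\ equivalent M U.
Proof.
move=> [c [l [u [l0 u_per u_f u_nose]]]]; have n0 := lift_n H.
pose v a := u a - u 0.
have v0 : v 0 = 0 by rewrite /v subrr.
have v_per (a : int) : v (a + n%:Z) = v a + c by rewrite /v u_per; lia.
have v_step (a : int) : v a < v (a + 1).
  by have := u_nose a 0%N isT; rewrite /v mul0r addr0 /=; lia.
have c0 : 0 < c.
  by have := v_per 0; rewrite add0r v0 add0r => <-; rewrite -v0; apply: (int_mono v_step); lia.
have [l' el] : exists l' : nat, l = l'%:Z by exists (absz l); lia.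
have u_iter (j : nat) (a : int) : u (iter j f a) <= u a + j%:Z * l.
  elim: j => [|j IH]; first by rewrite mul0r addr0.
  by apply: le_trans (u_f _) _; rewrite -addn1 PoszD mulrDl mul1r addrA lerD2r.
have fe (i : nat) (a : int) : (i <= k)%N ->
    v (iter i f a) < v a + (i%:Z * l + 1) < v (iter i f a + 1).
  move=> ik; have := u_nose a i ik; have := u_iter i a; rewrite /v; lia.
pose U := @Model R c%:~R n (fun a => (v (a : nat)%:Z)%:~R)
  (fun a => modr (v (a : nat)%:Z + (l + 1))%:~R c%:~R).
have fL := iter_ge (CircleLift n0 (lift_mono H) (lift_per H) f_gt).
have fr (i : nat) (a : int) : (i <= k)%N -> a <= iter i f a < a + n%:Z.
  by move=> ik; rewrite k_range // andbT; have := fL i a; lia.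
have HU : lift U (fun a => (v a)%:~R) (fun a => (v a + (l + 1))%:~R) f.
  apply: (int_lift n0 v0 v_per v_step) => // a.
    by have := fe 1%N a k_gt0; rewrite mul1r.
  exact: (fr 1%N a k_gt0).
have HT (i : nat) : (i <= k)%N -> lift (times l' i U) (fun a => (v a)%:~R)
    (fun a => (v a + (i%:Z * l + 1))%:~R) (iter i f).
  move=> ik; apply: (int_lift n0 v0 v_per v_step) => //= a; last exact: fr.
    have -> : i%:Z * l + 1 = (i * l' + 1)%N%:Z by rewrite el PoszD PoszM.
    by rewrite intrD.
  exact: fe.
exists U; split; last exact: (lift_equivalent H HU).
have dU : forall i : 'I_(narc U), cwdist (clen U) (beg i) (fin i) = (l + 1)%:~R.
  by apply: (lift_cwdist HU) => a; rewrite intrD.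
exists (absz c), l'; split.
  split.
  - by split; [exact: (lift_pca HU)|exists (l + 1)%:~R].
  - by rewrite /= -[c in LHS]gez0_abs ?ltW.
  - by move=> i; rewrite dU el -addn1.
  - move=> [[] a]; rewrite /expos /=; last exact: intr_int.
    by apply: modr_int; apply: intr_int.
move=> i ik; split.
  split; first exact: (lift_pca (HT i ik)).
  by exists (i%:Z * l + 1)%:~R; apply: (lift_cwdist (HT i ik)) => a; rewrite intrD.
apply: (lift_equivalent (HT i ik) (lift_power HU f_gt _)) => //.
by move=> a; apply: k_range.
Qed.

Section OfMultiplicative.
Variables (U : model R) (c l : nat).
Hypothesis U_ca : ca_model c l U.
Hypothesis U_mult : forall i, (i <= k)%N ->
  uca (times l i U) /\ equivalent (times l i U) (power U i).
Variables (BU EU : int -> R).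
Hypothesis HU : lift U BU EU f.
Hypothesis U_range : forall (j : nat) (i : int), (j <= k)%N ->
  iter j f i < i + (narc U)%:Z.

Let cU : clen U = c%:R. Proof. by case: U_ca. Qed.

Let BU_int (a : int) : BU a \is a Num.int.
Proof.
have [w wE] := ar_decomp (lift_n HU) a.
have [_ _ _ h] := U_ca; have bi : beg (ar (lift_n HU) a) \is a Num.int := h (false, _).
by rewrite (lift_beg_unique wE) cU rpredD ?rpredM ?intr_int ?natr_int.
Qed.

Let EU_l (a : int) : EU a = BU a + l.+1%:R.
Proof.
have [_ _ h _] := U_ca; rewrite -(h (ar (lift_n HU) a)).
rewrite (lift_beg_ar HU) (lift_fin_ar HU).
have /andP[h1 h2] := lift_arc HU a.
rewrite cwdist_modr; [by lra|exact: (lift_c HU)|by rewrite (ltW h1)].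
Qed.

(** Equivalence with U^i forces the lift f^i, but ending points are known only modulo c; the unknown
    w is later shown to be 0. *)
Let times_lift (i : nat) : (i <= k)%N -> exists E' : int -> R,
  lift (times l i U) BU E' (iter i f) /\
  forall a : int, exists w : int, E' a = BU a + (i * l + 1)%:R + w%:~R * c%:R.
Proof.
move=> ik; have [[Tp _] Teq] := U_mult ik.
have [B' [E' [f' HT]]] := pca_lift Tp (lift_n HU).
have HP := lift_power HU f_gt (fun a : int => U_range a ik).
have [_ ef] := equivalent_lift HT HP Teq.
have {}ef : f' = iter i f by apply: funext.
have eB : B' = BU.
  apply: funext => a; have [w wE] := ar_decomp (lift_n HT) a.
  rewrite (lift_beg_unique wE).
  have wE' : a = (ar (lift_n HU) a : nat)%:Z + w * (narc U)%:Z.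
    by rewrite (bool_irrelevance (lift_n HU) (lift_n HT)).
  by rewrite (lift_beg_unique wE') (bool_irrelevance (lift_n HU) (lift_n HT)).
rewrite -ef -eB; exists E'; split=> // a.
have := lift_fin_ar HT a; rewrite /= cU.
have -> : beg (ar (lift_n HT) a) = modr (BU a) c%:R.
  by rewrite -eB -cU -(lift_beg_ar HT).
have [v ->] := modr_ex (BU a) c%:R; rewrite addrAC modr_shift -?cU ?(lift_c HU) //.
by rewrite cU eB => /modr_inj [w ->]; exists w.
Qed.

Lemma multiplicative_feasible : feasible (narc U) f k.
Proof.
have C0 := lift_c HU; have l_lt : (l.+1%:R : R) < c%:R.
  by have /andP[_] := lift_arc HU 0; rewrite EU_l ltrD2l cU.
pose u a := Num.floor (BU a).
have uE a : BU a = (u a)%:~R by rewrite /u floorK ?BU_int.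
(* At the first i with i l + 1 >= c, the arcs of i x U would be shorter than those of U, so that f^i
   0 <= f 0 with i >= 2. *)
have small (i : nat) : (i <= k)%N -> (i * l + 1 < c)%N.
  elim: i => [|i IH] ik; first by move: l_lt; rewrite ltr_nat; lia.
  have {}IH := IH (ltnW ik).
  case: i ik IH => [|i] ik IH; first by move: l_lt; rewrite ltr_nat; lia.
  rewrite ltnNge; apply/negP => ge.
  have [E' [HT hE]] := times_lift ik; have [w ew] := hE 0.
  have /andP[h1 h2] := lift_arc HT 0.
  have wl : (i.+2 * l + 1)%N%:Z + w * c%:Z <= l%:Z.
    have : (i.+2 * l + 1)%N%:Z + w * c%:Z < c%:Z.
      move: h2; rewrite /= cU ew -!addrA ltrD2l -(ltr_int R) intrD intrM.
      by rewrite -[_%N%:Z%:~R]/(_%:R) -[c%:Z%:~R]/(c%:R).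
    have [w0|w0] := leP 0 w; first by have : 0 <= w * c%:Z; [apply: mulr_ge0|]; lia.
    have : w * c%:Z <= -1 * c%:Z by apply: ler_wpM2r; lia.
    rewrite mulSn in ge IH *; lia.
  have lt : E' 0 < EU 0.
    rewrite ew EU_l -addrA ltrD2l; move: wl; rewrite -(ler_int R) intrD intrM => wl.
    by apply: le_lt_trans wl _; rewrite ltr_nat.
  have /andP[h3 _] := lift_f HT 0.
  have := lt_trans h3 lt; rewrite (lift_ltBE HU).
  have := iter_ge (CircleLift (lift_n HU) (lift_mono HU) (lift_per HU) f_gt) i (f (f 0)).
  rewrite -!iterSr => h4; have := f_gt (f 0); move: h4; rewrite !iterSr; lia.
have power_bounds (j : nat) (a : int) : (j <= k)%N ->
    u (iter j f a) < u a + (j%:Z * l%:Z + 1) < u (iter j f a + 1).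
  move=> jk; have [E' [HT hE]] := times_lift jk; have [w ew] := hE a.
  have jc := small j jk.
  have w0 : w = 0.
    have : 0 < (j * l + 1)%N%:Z + w * c%:Z < c%:Z.
      rewrite -(ltr_int R) -[X in _ && X](ltr_int R) intrD intrM.
      have := lift_arc HT a; rewrite /= cU ew -addrA ltrDl ltrD2l.
      by rewrite -[_%N%:Z%:~R]/(_%:R) -[c%:Z%:~R]/(c%:R).
    have [wl|wg|//] := ltgtP w 0.
      have : w * c%:Z <= -1 * c%:Z by apply: ler_wpM2r; lia.
      by lia.
    have : 1 * c%:Z <= w * c%:Z by apply: ler_wpM2r; lia.
    by lia.
  have := lift_f HT a; rewrite ew w0 mul0r addr0 !uE.
  have -> : j%:Z * l%:Z + 1 = (j * l + 1)%N%:Z by rewrite PoszD PoszM.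
  by rewrite -[(j * l + 1)%:R]/((j * l + 1)%N%:Z%:~R) -!intrD !ltr_int.
have u_mono (a b : int) : a < b -> u a < u b.
  by move=> ab; rewrite -(ltr_int R) -!uE; apply: (lift_Bmono HU).
have pb1 a := power_bounds 1%N a k_gt0.
exists c%:Z, l%:Z, u; split.
- have := pb1 0; have := u_mono _ _ (f_gt 0); rewrite mul1r /=; lia.
- move=> a; apply/eqP; rewrite -(eqr_int R) intrD -!uE (lift_Bper HU) cU; exact/eqP.
- by move=> a; have := pb1 a; rewrite mul1r /=; lia.
- by move=> a j jk; have := power_bounds j a jk; lia.
Qed.
End OfMultiplicative.
End Multiplicative.

(** * Twisting bounds *)

Section Forward.
Variables (N : model R) (B E : int -> R) (f : int -> int) (k : nat).
Hypothesis H : lift N B E f.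
Hypothesis f_gt : forall a : int, a < f a.
Hypothesis k_range : forall (j : nat) (i : int), (j <= k)%N ->
  iter j f i < i + (narc N)%:Z.
Notation n := (narc N).
Notation ar := (ar (lift_n H)).

Lemma orbit_walk_walk (s : nat) (q : int * int) :
  walk k (orbit_walk (nstep f k) (nedge H k) s q).
Proof.
apply/andP; split.
  by rewrite all_map; apply/allP => i _; apply: synth_nedge.
case: s => // s; rewrite /orbit_walk /=.
have := @orbit_walk_path _ _ _ _ _ H (nstep f k) (nedge H k)
  (nedge_src H k) (nedge_dst H k) s 0 q; exact.
Qed.

(** Not being an iterate of -1, the source of the nose has a right neighbour in its row; so the nose
    is not backward and [jump_nose] applies. *)
Lemma nedge_forward (p : int * int) : 0 <= p.1 < n%:Z -> 0 <= (nstep f k p).1 < n%:Z ->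
  (has_nose f k p.1 -> forall r : nat, p.1 <> iter r f (-1)) ->
  forward (nedge H k p.1) /\ jump (nedge H k p.1) = (nstep f k p).2 - p.2.
Proof.
case: p => a t; rewrite /nstep /nedge /= => an; case: ifP => hn /= bn na.
  have /andP[a0 a1] := an; have /andP[b0 b1] := bn.
  have {}na := na isT; split; first exact: nose_forward.
  rewrite jump_nose //; first by lia.
  have /andP[_] := arow_spec H f_gt (ar a); rewrite ar_small // le_eqVlt.
  by case/orP => [/eqP /na|].
have /andP[a0 a1] := an; have /andP[b0 b1] := bn.
have im : inim f a by apply: (@has_nose_or f k); rewrite hn.
split; first exact: hollow_forward.
by rewrite jump_hollow //; lia.
Qed.

Lemma orbit_walk_forward (s : nat) (q : int * int) :
  (forall i, (i <= s)%N -> 0 <= (iter i (nstep f k) q).1 < n%:Z) ->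
  (forall i, (i <= s)%N -> has_nose f k (iter i (nstep f k) q).1 ->
     forall r : nat, (iter i (nstep f k) q).1 <> iter r f (-1)) ->
  all (@forward R N) (orbit_walk (nstep f k) (nedge H k) s q) /\
  walk_jump (orbit_walk (nstep f k) (nedge H k) s q) = (iter s (nstep f k) q).2 - q.2.
Proof.
move=> rng na; elim: s rng na => [|s IH] rng na.
  by rewrite /walk_jump big_nil subrr.
have [h1 h2] := IH (fun i h => rng i (leqW h)) (fun i h => na i (leqW h)).
have [h3 h4] := nedge_forward (rng s (leqnSn s)) (rng s.+1 (leqnn _)) (na s (leqnSn s)).
rewrite orbit_walkS all_rcons h3 h1; split=> //.
rewrite /walk_jump -cats1 big_cat big_seq1 -/(walk_jump _) h2 h4 /=; lia.
Qed.
End Forward.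

Lemma all2_map (S T U : Type) (r : T -> U -> bool) (F : S -> T) (G : S -> U) (s : seq S) :
  all2 r (map F s) (map G s) = all (fun x => r (F x) (G x)) s.
Proof. by elim: s => //= x s ->. Qed.

Section Twisting.
Variables (M : model R) (B E : int -> R) (f : int -> int) (k : nat).
Hypothesis H : lift M B E f.
Hypothesis f_gt : forall a : int, a < f a.
Hypothesis k_gt0 : (0 < k)%N.
Hypothesis k_range : forall (j : nat) (i : int), (j <= k)%N ->
  iter j f i < i + (narc M)%:Z.
Notation n := (narc M).
Let fL : circle_lift n f := CircleLift (lift_n H) (lift_mono H) (lift_per H) f_gt.

Let unroll_range (lam : nat) : (0 < lam)%N -> forall (j : nat) (i : int), (j <= k)%N ->
  iter j f i < i + (narc (unroll lam M))%:Z.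
Proof.
move=> lam0 j i jk; apply: lt_le_trans (k_range i jk) _.
by rewrite lerD2l lez_nat /= leq_pmull.
Qed.

(** Unrolled models share [f] and [u], so [jump_bound] gives k l uniformly in lam. *)
Lemma feasible_twisting : feasible n f k -> exists g : nat, twisting_bound k M g.
Proof.
move=> [c [l [u [l0 u_per u_f u_nose]]]]; exists (absz (k%:Z * l)%R).+1 => lam hl.
have lam0 : (0 < lam)%N by apply: leq_trans hl.
move=> [W [T [_ wT _ fT jT]]].
have := jump_bound (lift_unroll H lam0) f_gt (unroll_range lam0) l0
  (fun a b => @u_le _ _ fL _ k_gt0 _ _ l0 u_nose a b) u_f u_nose wT fT.
by lia.
Qed.

Lemma base_ar (lam : nat) (lam0 : (0 < lam)%N) (a : int) :
  base (ar (lift_n (lift_unroll H lam0)) a) = ar (lift_n H) a.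
Proof.
have [w ew] := ar_decomp (lift_n (lift_unroll H lam0)) a.
rewrite [in RHS]ew; move: (ar _ a) => x.
have -> : (narc (unroll lam M))%:Z = lam%:Z * n%:Z by rewrite -PoszM.
by rewrite mulrA ar_shift; apply: val_inj; rewrite /= modz_nat.
Qed.

Lemma nedge_copy (lam : nat) (lam0 : (0 < lam)%N) (a : int) :
  edge_copy (nedge (lift_unroll H lam0) k a) (nedge H k a).
Proof.
by rewrite /edge_copy /nedge; case: ifP => _; rewrite !base_ar !eqxx.
Qed.

(** Otherwise g laps of the path of [infeasible_up] have a forward copy with jump g L >= g. *)
Lemma twisting_feasible (g : nat) : twisting_bound k M g -> feasible n f k.
Proof.
move=> tw; apply: contrapT => nf.
have [L [p [q [i [L0 p0 i0 cyc na]]]]] := infeasible_up fL k_gt0 nf.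
pose S := (g * i)%N.
have eS := iter_cycle fL (nstep_sh fL k) g cyc.
have [D hD] : exists D : nat, forall t, (t <= S)%N -> `|(iter t (nstep f k) q).1| <= D%:Z.
  elim: S => [|s [D hD]]; first by exists (absz q.1) => -[|//] _ /=; lia.
  exists (maxn D (absz (iter s.+1 (nstep f k) q).1)) => t.
  rewrite leq_eqVlt ltnS => /orP[/eqP -> |/hD]; lia.
have [j0 per0] := orbit_periodic fL (-1).
(* [K] turns carry the path, which stays within D of 0, beyond f^j0 (-1), from where on all iterates
   of -1 are periodic and avoided by noses; [lam] leaves room for it on the unrolled circle. *)
pose K := (D + absz (iter j0 f (-1))%R + 1)%N.
pose lam := (g + D + K + 1)%N; have lam0 : (0 < lam)%N by rewrite /lam addn1.
pose q' := sh n K%:Z 0 q.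
have n0 := lift_n H.
have q'E t : iter t (nstep f k) q' = sh n K%:Z 0 (iter t (nstep f k) q).
  by apply: iter_sh; apply: nstep_sh fL k.
have Kn : K%:Z <= K%:Z * n%:Z by rewrite -[X in X <= _]mulr1; apply: ler_wpM2l; lia.
have rng t : (t <= S)%N -> 0 <= (iter t (nstep f k) q').1 < (narc (unroll lam M))%:Z.
  move=> /hD tD; rewrite q'E /sh /= PoszM.
  have -> : lam%:Z * n%:Z = K%:Z * n%:Z + (g + D + 1)%N%:Z * n%:Z.
    by rewrite -mulrDl -PoszD; congr (_%:Z * _); rewrite /lam; lia.
  have : (g + D + 1)%N%:Z <= (g + D + 1)%N%:Z * n%:Z.
    by rewrite -[X in X <= _]mulr1; apply: ler_wpM2l; lia.
  by move: Kn; rewrite /K; move: (_ * n%:Z) (_ * n%:Z) => X Y; lia.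
have nr t : (t <= S)%N -> has_nose f k (iter t (nstep f k) q').1 ->
    forall r : nat, (iter t (nstep f k) q').1 <> iter r f (-1).
  move=> /hD tD; rewrite q'E /sh => hn r er.
  have hn' : has_nose f k (iter t (nstep f k) q).1.
    by move: hn; rewrite /= /has_nose (nidx_shift fL) (inim_shift fL).
  apply: (na t hn').
  have jr : (j0 <= r)%N.
    rewrite leqNgt; apply/negP => /(iter_lt_mono H f_gt (-1)); rewrite -er /=.
    by move: Kn; rewrite /K; move: (_ * n%:Z) => X; lia.
  have := periodic_iter fL (r - j0) per0.
  rewrite -iterD subnK // -er /= => -[s [w [s0 es]]].
  exists s, w; split=> //; move: es; rewrite (iter_shift fL) addrAC; exact: addIr.
have [fT jT] := orbit_walk_forward (lift_unroll H lam0) f_gt rng nr.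
apply: (tw lam); first by rewrite /lam; lia.
exists (orbit_walk (nstep f k) (nedge H k) S q'),
  (orbit_walk (nstep f k) (nedge (lift_unroll H lam0) k) S q'); split=> //.
- exact: orbit_walk_walk.
- by apply: orbit_walk_walk => //; apply: unroll_range.
- by rewrite /walk_copy all2_map; apply/allP => t _; apply: nedge_copy.
- rewrite jT q'E eS /sh /=.
  have : g%:Z <= g%:Z * L%:Z by rewrite -[X in X <= _]mulr1; apply: ler_wpM2l; lia.
  by lia.
Qed.
End Twisting.
End Models.

Theorem theorem9 (R : realType) (M : model R) (k : nat)
    (M_spca : spca M) (k_bounds : (1 <= k < omega M)%N) :
  let cond1 := exists U : model R, k_multiplicative k U /\ equivalent M U in
  let cond2 := exists WN WH : seq (edge M),
    [/\ [/\ cycle_walk k WN, greedy_nose k WN & ext WN < 0],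
        [/\ cycle_walk k WH, greedy_hollow k WH & ext WH > 0] &
        exists v : 'I_(narc M), v \in map (@src R M) WN /\ v \in map (@src R M) WH] in
  let cond3 := exists g : nat, twisting_bound k M g in
  (cond1 <-> cond2) /\ (cond2 <-> cond3).
Proof.
have /andP[k_gt0 k_omega] := k_bounds.
have [B [E [f [H f_gt]]]] := spca_lift M_spca.
have k_range (j : nat) (i : int) : (j <= k)%N -> iter j f i < i + (narc M)%:Z.
  by move=> jk; apply: (omega_range H i (spca_npig M_spca) k_omega jk).
have fL := CircleLift (lift_n H) (lift_mono H) (lift_per H) f_gt.
move=> cond1 cond2 cond3.
have h1 : cond1 <-> feasible (narc M) f k.
  split=> [[U [[c [l [U_ca U_mult]]] MU]]|]; last exact: (feasible_multiplicative H f_gt k_gt0 k_range).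
  have [[Up _] _ _ _] := U_ca; have [h _ _] := MU.
  have [BU [EU [f' HU]]] := pca_lift Up (leq_ltn_trans (leq0n _) (ltn_ord (h (Ordinal (lift_n H))))).
  have [nn /funext ff] := equivalent_lift H HU MU; rewrite -ff in HU.
  have U_range : forall (j : nat) (i : int), (j <= k)%N -> iter j f i < i + (narc U)%:Z.
    by rewrite -nn.
  suff: feasible (narc U) f k by rewrite -nn.
  exact: (multiplicative_feasible f_gt k_gt0 U_ca U_mult HU U_range).
have h2 : cond2 <-> feasible (narc M) f k.
  rewrite /cond2 -(shared_cyclesP H f_gt k_range); split; last exact: (feasible_shared fL k_gt0).
  by move=> sc; apply: contrapT => /(infeasible_not_shared fL k_gt0).
have h3 : cond3 <-> feasible (narc M) f k.
  split=> [[g]|]; first exact: (twisting_feasible H f_gt k_gt0 k_range).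
  exact: (feasible_twisting H f_gt k_gt0 k_range).
by rewrite h1 h2 h3.
Qed.
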